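(* Let $M$ be a compact connected $C^\infty$ manifold without boundary of dimension $n\ge 2$, equipped with a strictly positive $C^\infty$ volume density $d\mu$. Let $P$ be an elliptic differential operator of order $m$ on $M$ with $C^\infty$ coefficients, formally self-adjoint with respect to $d\mu$, with principal symbol $p(x,\xi)>0$ for $\xi\neq 0$, and nonnegative, $P\ge 0$, as a self-adjoint operator on $L^2(M)$. Assume that $n>m\ge 2$ and that for each $x\in M$ the cosphere $\Sigma_x=\{\xi\in T_x^*M : p(x,\xi)=1\}$ is strictly convex. Assume furthermore that the subprincipal symbol of $P$ vanishes, and that the Hamilton flow of the principal symbol $p$ is periodic, with a common minimal period on $p^{-1}(1)$. Let $\Xi=\{z\in\mathbb{C}\setminus\{0\}:\arg(z)\in(0,2\pi/m)\}$. Then there exist: (i) a sequence $z_k\in\Xi$ such that $\operatorname{Re} z_k\to\infty$ and $0<\operatorname{Im} z_k\to 0$ as $k\to\infty$, and $$\|(P-z_k^m)^{-1}\|_{L^{\frac{2n}{n+m}}(M)\to L^{\frac{2n}{n-m}}(M)}\to\infty,\quad k\to\infty;$$ and (ii) a sequence $z_k\in\Xi$ such that $\operatorname{Re}(z_ke^{-2\pi i/m})\to\infty$ and $0<-\operatorname{Im}(z_ke^{-2\pi i/m})\to 0$ as $k\to\infty$, and $$\|(P-z_k^m)^{-1}\|_{L^{\frac{2n}{n+m}}(M)\to L^{\frac{2n}{n-m}}(M)}\to\infty,\quad k\to\infty.$$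
   Context: $L^r(M)$ is taken with respect to $d\mu$. Formal self-adjointness means $\int_M (Pu)\overline{v}\,d\mu=\int_M u\,\overline{Pv}\,d\mu$ for all $u,v\in C^\infty(M)$. The principal symbol $p\in C^\infty(T^*M)$ is a real-valued homogeneous polynomial of degree $m$ in $\xi$; positivity for $\xi\ne0$ forces $m$ to be even. $P$ with domain $C^\infty(M)$ is essentially self-adjoint on $L^2(M)$; its unique self-adjoint extension, again denoted $P$, has domain $H^m(M)$. For $\zeta\in\mathbb{C}\setminus[0,\infty)$ the $L^2$ resolvent $(P-\zeta)^{-1}$ is a bounded operator $L^{\frac{2n}{n+m}}(M)\to L^{\frac{2n}{n-m}}(M)$ (extended by continuity from $C^\infty(M)$). The map $z\mapsto z^m$ sends $\Xi$ bijectively onto $\mathbb{C}\setminus[0,\infty)$. The cosphere $\Sigma_x$ is a smooth compact connected hypersurface in $T_x^*M\cong\mathbb{R}^n$; it is called strictly convex if its second fundamental form is definite at each point (equivalently, its Gaussian curvature is nowhere vanishing). The subprincipal symbol of $P$ is the standard one: in local coordinates in which $d\mu$ is Lebesgue measure and the full symbol of $P$ is $p+p_{m-1}+\dots$ (with $p_{m-1}$ homogeneous of degree $m-1$ in $\xi$), it equals $p_{m-1}-\frac{1}{2i}\sum_{j=1}^n\frac{\partial^2 p}{\partial x_j\partial\xi_j}$. The periodicity hypothesis means that there is $T>0$ such that every integral curve of the Hamilton vector field $H_p$ on $p^{-1}(1)\subset T^*M$ is periodic with minimal period $T$. *)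

(* Defs.v *)
From HB Require Import structures.
From mathcomp Require Import all_boot all_order all_algebra.
From mathcomp Require Import all_classical all_reals all_analysis.
From mathcomp Require Import complex.
Import Order.TTheory GRing.Theory Num.Theory.
Import numFieldNormedType.Exports.

Set Implicit Arguments.
Unset Strict Implicit.
Unset Printing Implicit Defensive.

Local Open Scope classical_set_scope.
Local Open Scope ring_scope.

Section EuclideanCalculus.
Context {R : realType} {n : nat}.
Local Notation C := R[i].
Local Notation V := 'rV[R]_n.

Definition basis_vec (j : 'I_n) : V := delta_mx 0 j.

Definition partial (j : 'I_n) (f : V -> R) : V -> R :=
  fun x => 'D_(basis_vec j) f x.

Definition smooth_on (U : set V) (f : V -> R) : Prop :=
  forall (s : seq 'I_n) (x : V), U x ->
    {for x, continuous (foldr partial f s)} /\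
    forall j, derivable (foldr partial f s) x (basis_vec j).

Definition smooth_onC (U : set V) (f : V -> C) : Prop :=
  smooth_on U (fun x => complex.Re (f x)) /\
  smooth_on U (fun x => complex.Im (f x)).

Definition partialC (j : 'I_n) (f : V -> C) : V -> C := fun x =>
  (partial j (fun y => complex.Re (f y)) x
   +i* partial j (fun y => complex.Im (f y)) x)%C.

(* Multi-indices with all entries at most m; this includes every multi-index
   of length at most m. *)
Definition multi_index (m : nat) := {ffun 'I_n -> 'I_m.+1}.

Definition mi_length m (a : multi_index m) : nat := (\sum_j a j)%N.

Definition mi_partialC m (a : multi_index m) (f : V -> C) : V -> C :=
  foldr partialC f (flatten [seq nseq (a j) j | j <- enum 'I_n]).

(* D^a = (-i)^|a| \partial^a *)
Definition mi_D m (a : multi_index m) (f : V -> C) : V -> C :=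
  fun x => (- 'i%C) ^+ mi_length a * mi_partialC a f x.

Definition mi_monomial m (a : multi_index m) (xi : V) : C :=
  ((\prod_j xi 0 j ^+ a j)%:C)%C.

Definition dotp (u v : V) : R := \sum_j u 0 j * v 0 j.

(* The norm `|_| of 'rV[R]_n in the library is the sup norm. *)
Definition enorm (v : V) : R := Num.sqrt (dotp v v).

Definition gradient (F : V -> R) (xi : V) : V := \row_j partial j F xi.

Definition unit_normal (F : V -> R) (xi : V) : V :=
  (enorm (gradient F xi))^-1 *: gradient F xi.

(* Second fundamental form, at xi, of the level set of F through xi, with
   respect to the normal grad F / |grad F|, evaluated on tangent vectors. *)
Definition second_fundamental_form (F : V -> R) (xi v w : V) : R :=
  dotp (\row_j 'D_v (fun eta => unit_normal F eta 0 j) xi) w.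

Definition strictly_convex_level (F : V -> R) (l : R) : Prop :=
  forall xi, F xi = l ->
    let tangent v := v != 0 /\ dotp (gradient F xi) v = 0 in
    (forall v, tangent v -> 0 < second_fundamental_form F xi v v) \/
    (forall v, tangent v -> second_fundamental_form F xi v v < 0).

End EuclideanCalculus.

(* Integral of a nonnegative Borel function over R^n with respect to Lebesgue
   measure, as an iterated integral (Tonelli). *)
Fixpoint lebesgue_int {R : realType} (n : nat) :
    ('rV[R]_n -> \bar R) -> \bar R :=
  match n return ('rV[R]_n -> \bar R) -> \bar R with
  | 0 => fun f => f 0
  | k.+1 => fun f =>
      (\int[@lebesgue_measure R]_t
         lebesgue_int (fun v : 'rV[R]_k => f (row_mx (t%:M : 'rV[R]_1) v)))%E
  end.

Section Manifold.
Context {R : realType} {n : nat} {M : ptopologicalType}.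
Local Notation C := R[i].
Local Notation V := 'rV[R]_n.

(* The values of phi off dom, and of psi off phi @` dom, carry no meaning. *)
Record chart := Chart { dom : set M ; phi : M -> V ; psi : V -> M }.

Definition img (c : chart) : set V := phi c @` dom c.

Definition is_chart (c : chart) : Prop :=
  [/\ open (dom c), open (img c),
      (forall x, dom c x -> psi c (phi c x) = x),
      (forall x, dom c x -> {for x, continuous (phi c)}) &
      (forall y, img c y -> {for y, continuous (psi c)})].

Definition smooth_transition (c c' : chart) : Prop :=
  forall j, smooth_on (phi c @` (dom c `&` dom c'))
                      (fun y => phi c' (psi c y) 0 j).

Definition compatible (c c' : chart) : Prop :=
  smooth_transition c c' /\ smooth_transition c' c.

(* A smooth structure is a maximal smooth atlas. *)
Record smooth_structure := SmoothStructure {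
  charts : set chart ;
  charts_chart : forall c, charts c -> is_chart c ;
  charts_cover : forall x, exists2 c, charts c & dom c x ;
  charts_compatible : forall c c', charts c -> charts c' -> compatible c c' ;
  charts_maximal : forall c, is_chart c ->
    (forall c', charts c' -> compatible c c') -> charts c }.

Definition chart_at (S : smooth_structure) (x : M) (c : chart) : Prop :=
  charts S c /\ dom c x.

Definition smooth_fun (S : smooth_structure) (u : M -> C) : Prop :=
  forall c, charts S c -> smooth_onC (img c) (fun y => u (psi c y)).

Definition borel := g_sigma_algebraType (@open M).

Record volume_density (S : smooth_structure) := VolumeDensity {
  vol : {measure set borel -> \bar R} ;
  density : chart -> V -> R ;
  density_smooth : forall c, charts S c -> smooth_on (img c) (density c) ;
  density_gt0 : forall c y, charts S c -> img c y -> 0 < density c y ;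
  volE : forall c (A : set borel), charts S c -> measurable A ->
    A `<=` dom c ->
    vol A = lebesgue_int
      (fun y => (density c y * \1_(phi c @` (A : set M)) y)%:E) }.

Definition lebesgue_chart S (mu : volume_density S) (c : chart) : Prop :=
  charts S c /\ forall y, img c y -> density mu c y = 1.

(* A differential operator of order at most m with smooth coefficients; coef
   is the family of its coefficients with respect to D^a in each chart. *)
Record diffop (S : smooth_structure) (m : nat) := DiffOp {
  dop :> (M -> C) -> M -> C ;
  coef : chart -> @multi_index n m -> V -> C ;
  coef_smooth : forall c a, charts S c -> smooth_onC (img c) (coef c a) ;
  dopE : forall c u y, charts S c -> smooth_fun S u -> img c y ->
    dop u (psi c y) = \sum_(a : multi_index m | (mi_length a <= m)%N)
                        coef c a y * mi_D a (fun z => u (psi c z)) y }.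

Section Symbols.
Context (S : smooth_structure) (m : nat) (P : diffop S m).

(* The part of the full symbol, in the chart c, homogeneous of degree k. *)
Definition symbol (k : nat) (c : chart) (y xi : V) : C :=
  \sum_(a : multi_index m | mi_length a == k) coef P c a y * mi_monomial a xi.

Definition principal_symbol := symbol m.

Definition elliptic : Prop :=
  forall c y xi, charts S c -> img c y -> xi != 0 ->
    principal_symbol c y xi != 0.

(* In the order of R[i], 0 < z means that z is real and positive. *)
Definition positive_principal_symbol : Prop :=
  forall c y xi, charts S c -> img c y -> xi != 0 ->
    0 < principal_symbol c y xi.

Definition real_symbol (c : chart) (y xi : V) : R :=
  complex.Re (principal_symbol c y xi).

(* The cosphere at psi c y, read in the linear coordinates of the cotangent
   space induced by c, is the level set 1 of real_symbol c y. *)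
Definition strictly_convex_cospheres : Prop :=
  forall c y, charts S c -> img c y ->
    strictly_convex_level (real_symbol c y) 1.

Definition subprincipal_symbol (c : chart) (y xi : V) : C :=
  symbol m.-1 c y xi -
  (2 * 'i%C)^-1 *
    \sum_j partialC j
      (fun z => partialC j (fun eta => principal_symbol c z eta) xi) y.

Definition subprincipal_symbol_vanishes (mu : volume_density S) : Prop :=
  forall c y xi, lebesgue_chart mu c -> img c y ->
    subprincipal_symbol c y xi = 0.

(* A covector at x is the family of its coordinates in the charts at x, subject
   to the transformation law; the value 0 in the other charts makes equality of
   covectors coincide with equality of functions. *)
Definition is_covector (x : M) (xi : chart -> V) : Prop :=
  (forall c c', chart_at S x c -> chart_at S x c' -> forall i,
     xi c 0 i = \sum_j
       partial i (fun y => phi c' (psi c y) 0 j) (phi c x) * xi c' 0 j) /\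
  (forall c, ~ chart_at S x c -> xi c = 0).

(* Integral curves of the Hamilton field of p on p = 1. This set is compact, so
   that the maximal curves are defined on the whole line. *)
Definition hamilton_curve (g : R -> M * (chart -> V)) : Prop :=
  [/\ continuous (fun t => (g t).1),
      (forall t, is_covector (g t).1 (g t).2),
      (forall t c, chart_at S (g t).1 c ->
         real_symbol c (phi c (g t).1) ((g t).2 c) = 1) &
      (forall t c j, chart_at S (g t).1 c ->
         is_derive t 1 (fun s => phi c (g s).1 0 j)
           (partial j (real_symbol c (phi c (g t).1)) ((g t).2 c)) /\
         is_derive t 1 (fun s => (g s).2 c 0 j)
           (- partial j (fun y => real_symbol c y ((g t).2 c))
                (phi c (g t).1)))].

Definition minimal_period {X : Type} (g : R -> X) (T : R) : Prop :=
  [/\ 0 < T, (forall t, g (t + T) = g t) &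
      forall T', 0 < T' < T -> ~ (forall t, g (t + T') = g t)].

Definition hamilton_flow_periodic : Prop :=
  exists2 T : R, 0 < T & forall g, hamilton_curve g -> minimal_period g T.

End Symbols.

Section Operators.
Context (S : smooth_structure) (mu : volume_density S).
Context (m : nat) (P : diffop S m).

Definition integralC (f : M -> C) : C :=
  (Rintegral (vol mu) setT (fun x => complex.Re (f x))
   +i* Rintegral (vol mu) setT (fun x => complex.Im (f x)))%C.

Definition inner (u v : M -> C) : C := integralC (fun x => u x * (v x)^*%C).

Definition formally_self_adjoint : Prop :=
  forall u v, smooth_fun S u -> smooth_fun S v ->
    inner (P u) v = inner u (P v).

Definition Lr_norm (r : R) (u : M -> C) : \bar R :=
  Lnorm (vol mu) r%:E (fun x => (ComplexField.Normc.normc (u x))%:E).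

Definition measurableC (u : M -> C) : Prop :=
  measurable_fun (setT : set borel) (fun x : borel => complex.Re (u x)) /\
  measurable_fun (setT : set borel) (fun x : borel => complex.Im (u x)).

Definition L2 (u : M -> C) : Prop :=
  measurableC u /\ (Lr_norm 2 u < +oo)%E.

(* Graph of the closure in L^2 of P with domain C^oo(M). When P is essentially
   self-adjoint this closure is its unique self-adjoint extension. *)
Definition extension_graph (u v : M -> C) : Prop :=
  [/\ L2 u, L2 v &
      exists w : nat -> M -> C,
        [/\ (forall k, smooth_fun S (w k)),
            (fun k => Lr_norm 2 (fun x => w k x - u x)) @ \oo --> 0%E &
            (fun k => Lr_norm 2 (fun x => P (w k) x - v x)) @ \oo --> 0%E]].

Definition nonnegative_operator : Prop :=
  forall u v, extension_graph u v -> 0 <= inner v u.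

(* u = (P - zeta)^-1 f in L^2 *)
Definition is_resolvent (zeta : C) (f u : M -> C) : Prop :=
  extension_graph u (fun x => f x + zeta * u x).

(* Norm of (P - zeta)^-1 : L^r -> L^q, as the supremum over the dense subspace
   C^oo(M) of L^r. *)
Definition resolvent_norm (zeta : C) (r q : R) : \bar R :=
  ereal_sup [set t | exists f u : M -> C,
    [/\ smooth_fun S f, (Lr_norm r f <= 1)%E, is_resolvent zeta f u &
        t = Lr_norm q u]].

End Operators.

End Manifold.

Arguments chart : clear implicits.
Arguments smooth_structure : clear implicits.

Definition expi {R : realType} (t : R) : R[i] := (cos t +i* sin t)%C.

Definition Xi {R : realType} (m : nat) : set R[i] :=
  [set z | exists r t : R,
     [/\ 0 < r, 0 < t < 2 * pi / m%:R & z = (r%:C)%C * expi t]].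

(* Main.v *)
Require Import Defs.
From HB Require Import structures.
From mathcomp Require Import all_boot all_order all_algebra finmap.
From mathcomp Require Import all_classical all_reals all_analysis.
From mathcomp Require Import complex measurable_realfun.
From mathcomp Require Import ring lra zify.
Import Order.TTheory GRing.Theory Num.Theory.
Import numFieldNormedType.Exports.

(** Why the theorem holds. The points z_k may approach the boundary half-lines
    of the sector as fast as one likes. Suppose that u is a smooth function with
    ||(P - l) u|| <= e ||u|| in L^2 for some large l > 0 and some small e. Write
    l = s^m and z = s exp(it), with t > 0 chosen after u and so small that
    f = (P - z^m) u is still small in L^2 compared with u. The function u is the
    resolvent of f. Since the volume of M is finite and
    2n/(n+m) <= 2 <= 2n/(n-m), the norm of f in L^(2n/(n+m)) is small and the
    norm of u in L^(2n/(n-m)) is not, so that the resolvent norm is large at z^m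
    ([resolvent_norm_large]). Replacing t by -t gives points near the other
    half-line. All that is needed is thus an approximate eigenvalue l of P beyond
    every bound, with smooth approximate eigenfunctions
    ([approximate_eigenfunctions]).

    This follows from a statement on symmetric operators
    ([approximate_spectrum_unbounded]): if A is symmetric and not bounded above,
    and if for every real l the range of A - l - it is dense for some real t,
    then A has approximate eigenvalues beyond every bound. If A - l is bounded
    below on its domain, the range of A - l is dense as well, and an almost
    extremal vector for (A - l)^-1 produces an approximate eigenvector for one of
    the two points at distance d from l, where d is the distance from l to the
    spectrum. If the half-line (b, oo) contained no approximate eigenvalue, this
    distance would be at least l - b, and l -> oo would give A <= b.

    The density of the range is obtained from an explicit parametrix
    ([local_estimate]). On a small cube in a chart, with cutoff chi, the function
    chi f is uniformly close to a trigonometric polynomial g with coefficients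
    c_k and frequencies xi_k. Put u = chi g', where g' has the coefficients
    c_k / (p(y0, xi_k) - it) and p(y0, .) is the principal symbol at the center
    y0. Then (P - l - it) u is chi g plus two errors. The first one comes from
    the oscillation of the leading coefficients and is at most a quarter of the
    main term if the cube is small; the second one comes from the lower-order
    terms and tends to 0 as t grows. The continuity in L^2 of the Fourier
    multipliers involved is Parseval's identity: it holds exactly on grids that
    are finer than the frequencies ([grid_mean_square]) and passes to integrals
    over the cube by Riemann sums ([trig_norm]). Adding the functions u of a
    finite cover gives a function u with Re <(P - l - it) u, f> >= k ||f||^2 and
    ||(P - l - it) u|| <= B ||f||, so that f - tau (P - l - it) u is smaller than
    f for a suitable tau > 0, and iteration makes the residual as small as one
    likes ([dense_shifted]). Finally, modulated waves of high frequency show that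
    P is not bounded above ([energy_unbounded]). *)

Set Implicit Arguments.
Unset Strict Implicit.
Unset Printing Implicit Defensive.
Local Open Scope classical_set_scope.
Local Open Scope ring_scope.

(** * Symmetric operators with dense range *)

Section SemiInnerProduct.
Context {R : realType} {V : lmodType R}.

Record semi_inner (D : V -> Prop) (g : V -> V -> R) : Prop := SemiInner {
  si0 : D 0 ;
  siD : forall u v, D u -> D v -> D (u + v) ;
  siZ : forall a u, D u -> D (a *: u) ;
  giD : forall u v w, D u -> D v -> D w -> g (u + v) w = g u w + g v w ;
  giZ : forall a u w, D u -> D w -> g (a *: u) w = a * g u w ;
  giC : forall u v, D u -> D v -> g u v = g v u ;
  gi_ge0 : forall u, D u -> 0 <= g u u }.

Context (D : V -> Prop) (g : V -> V -> R) (H : semi_inner D g).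
Local Notation N u := (g u u).

Lemma siN u : D u -> D (- u).
Proof. by move=> Du; rewrite -scaleN1r; apply: (siZ H). Qed.

Lemma siB u v : D u -> D v -> D (u - v).
Proof. by move=> Du Dv; apply: (siD H) => //; exact: siN. Qed.

Lemma gi_Dr u v w : D u -> D v -> D w -> g w (u + v) = g w u + g w v.
Proof.
move=> Du Dv Dw; rewrite (giC H) ?(giD H)//; last exact: (siD H).
by rewrite (giC H Du)// (giC H Dv).
Qed.

Lemma gi_Zr a u w : D u -> D w -> g w (a *: u) = a * g w u.
Proof.
move=> Du Dw; rewrite (giC H) ?(giZ H)//; last exact: (siZ H).
by rewrite (giC H Du).
Qed.

Lemma gi_Nl u w : D u -> D w -> g (- u) w = - g u w.
Proof. by move=> Du Dw; rewrite -scaleN1r (giZ H)// mulN1r. Qed.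

Lemma gi_Nr u w : D u -> D w -> g w (- u) = - g w u.
Proof. by move=> Du Dw; rewrite -scaleN1r gi_Zr// mulN1r. Qed.

Lemma gi_0l w : D w -> g 0 w = 0.
Proof. by move=> Dw; rewrite -(scale0r 0) (giZ H)// ?mul0r//; exact: (si0 H). Qed.

Lemma gi_ND u v : D u -> D v -> N (u + v) = N u + 2 * g u v + N v.
Proof.
move=> Du Dv; rewrite (giD H)// ?gi_Dr//; last exact: (siD H).
rewrite (giC H Dv Du); ring.
Qed.

Lemma gi_NB u v : D u -> D v -> N (u - v) = N u - 2 * g u v + N v.
Proof.
move=> Du Dv; have Dnv := siN Dv.
rewrite gi_ND// gi_Nr// gi_Nl// gi_Nr//; ring.
Qed.

Lemma gi_NZ a u : D u -> N (a *: u) = a ^+ 2 * N u.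
Proof.
move=> Du; rewrite (giZ H)// ?gi_Zr//; last exact: (siZ H).
by rewrite mulrA -expr2.
Qed.

Lemma cauchy_schwarz u v : D u -> D v -> g u v ^+ 2 <= N u * N v.
Proof.
move=> Du Dv.
have pos t : 0 <= t ^+ 2 * N u + 2 * t * g u v + N v.
  have DZ : D (t *: u) by apply: (siZ H).
  have := gi_ge0 H (siD H DZ Dv).
  by rewrite gi_ND// gi_NZ// (giZ H)// mulrA.
have Nu := gi_ge0 H Du; have Nv := gi_ge0 H Dv.
have [Nu0|Nu0] := eqVneq (N u) 0.
  rewrite Nu0 mul0r; have [->|g0] := eqVneq (g u v) 0; first by rewrite expr0n.
  have := pos (- (N v + 1) / (2 * g u v)); rewrite Nu0 mulr0 add0r.
  have -> : 2 * (- (N v + 1) / (2 * g u v)) * g u v = - (N v + 1) by field.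
  by lra.
have Np : 0 < N u by rewrite lt_def Nu0.
have := pos (- (g u v / N u)).
have -> : (- (g u v / N u)) ^+ 2 * N u + 2 * - (g u v / N u) * g u v + N v =
  (N u * N v - g u v ^+ 2) / N u by field.
by rewrite pmulr_lge0 ?invr_gt0// subr_ge0.
Qed.

Lemma cauchy_schwarz_sqrt u v : D u -> D v ->
  `|g u v| <= Num.sqrt (N u) * Num.sqrt (N v).
Proof.
move=> Du Dv; rewrite -sqrtrM ?(gi_ge0 H)// -sqrtr_sqr.
by apply: ler_wsqrtr; exact: cauchy_schwarz.
Qed.

Lemma gi_triangle u v : D u -> D v ->
  Num.sqrt (N (u + v)) <= Num.sqrt (N u) + Num.sqrt (N v).
Proof.
move=> Du Dv.
rewrite -[leRHS]ger0_norm ?addr_ge0 ?sqrtr_ge0// -sqrtr_sqr; apply: ler_wsqrtr.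
rewrite gi_ND// sqrrD !sqr_sqrtr ?(gi_ge0 H)//.
rewrite lerD2r lerD2l mulr2n mulrDl mul1r.
have := cauchy_schwarz_sqrt Du Dv; have := ler_norm (g u v); lra.
Qed.

(** The weight s lets one of the two terms keep a constant close to 1. *)
Lemma gi_young s u v : 0 < s -> D u -> D v ->
  N (u + v) <= (1 + s^-1) * N u + (1 + s) * N v.
Proof.
move=> s0 Du Dv; rewrite gi_ND//.
have DZ : D (s *: v) by apply: (siZ H).
have := gi_ge0 H (siB Du DZ); rewrite gi_NB// gi_NZ// gi_Zr// => h.
have : 0 <= s^-1 * (N u - 2 * (s * g u v) + s ^+ 2 * N v).
  by rewrite mulr_ge0// invr_ge0 ltW.
have -> : s^-1 * (N u - 2 * (s * g u v) + s ^+ 2 * N v) =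
  s^-1 * N u - 2 * g u v + s * N v by field; rewrite gt_eqF.
by lra.
Qed.

Section DenseRange.
Context (L : V -> V) (LD : forall u, D u -> D (L u)).
Hypothesis LB : forall u v, D u -> D v -> L (u - v) = L u - L v.
Hypothesis L0 : L 0 = 0.

(** The residual f - L u is again in the domain, so that it can be corrected
    in turn: the residuals decrease geometrically. *)
Lemma dense_range_of_contraction (q : R) : 0 <= q < 1 ->
  (forall f, D f -> exists2 u, D u & N (L u - f) <= q * N f) ->
  forall f e, D f -> 0 < e -> exists2 u, D u & N (L u - f) <= e.
Proof.
move=> /andP[q0 q1] hq f e Df e0.
have iter k : exists2 u, D u & N (L u - f) <= q ^+ k * N f.
  elim: k => [|k [u Du hu]].
    exists 0; first exact: (si0 H).
    by rewrite L0 add0r expr0 mul1r gi_Nl ?gi_Nr ?opprK//; exact: siN.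
  have Df' : D (L u - f) by apply: siB => //; exact: LD.
  have [u' Du' hu'] := hq _ Df'.
  exists (u - u'); first exact: siB.
  rewrite LB//.
  have -> : L u - L u' - f = - (L u' - (L u - f)).
    by rewrite !opprB addrAC.
  have DL : D (L u' - (L u - f)) by apply: siB => //; exact: LD.
  rewrite gi_Nl ?gi_Nr ?opprK//; last exact: siN.
  apply: le_trans hu' _; rewrite exprS -mulrA ler_wpM2l//.
have qe0 : 0 < e / (1 + N f).
  by rewrite divr_gt0// ltr_wpDr// (gi_ge0 H).
have nq : `|q| < 1 by rewrite ger0_norm.
have /cvgrPdist_lt/(_ _ qe0)[k _ /(_ k (leqnn k))] := cvg_expr nq.
rewrite /= sub0r normrN ger0_norm ?exprn_ge0// => hk.
have [u Du hu] := iter k; exists u => //; apply: le_trans hu _.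
move: hk; rewrite ltr_pdivlMr ?ltr_wpDr ?(gi_ge0 H)// => /ltW.
apply: le_trans; rewrite ler_wpM2l ?exprn_ge0// lerDr//.
Qed.
End DenseRange.

Section SelfAdjoint.
Context (A J : V -> V).
Hypothesis AD : forall u, D u -> D (A u).
Hypothesis JD : forall u, D u -> D (J u).
Hypothesis ADD : forall u v, D u -> D v -> A (u + v) = A u + A v.
Hypothesis AZ : forall a u, D u -> A (a *: u) = a *: A u.
Hypothesis JDD : forall u v, D u -> D v -> J (u + v) = J u + J v.
Hypothesis JZ : forall a u, D u -> J (a *: u) = a *: J u.
Hypothesis AJ : forall u, D u -> A (J u) = J (A u).
Hypothesis Asym : forall u v, D u -> D v -> g (A u) v = g u (A v).
Hypothesis Jskew : forall u v, D u -> D v -> g (J u) v = - g u (J v).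
Hypothesis JJ : forall u, D u -> N (J u) = N u.

(** The operator A - (l + i t) when J is the multiplication by i. Real scalars
    and the real part of the inner product are enough, since only these enter
    the estimates. *)
Definition shifted (l t : R) (u : V) : V := A u - l *: u - t *: J u.

Lemma shift0E l u : shifted l 0 u = A u - l *: u.
Proof. by rewrite /shifted scale0r subr0. Qed.

Lemma Dshift l t u : D u -> D (shifted l t u).
Proof.
move=> Du; apply: siB; last by apply: (siZ H); exact: JD.
by apply: siB; [exact: AD|exact: (siZ H)].
Qed.

Lemma shiftB l t u v : D u -> D v ->
  shifted l t (u - v) = shifted l t u - shifted l t v.
Proof.
move=> Du Dv; have Dv' := siN Dv.
rewrite /shifted ADD// JDD// -scaleN1r AZ// JZ// !scaleN1r.
rewrite !scalerDr !scalerN !opprD !opprK !addrA.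
by rewrite [LHS](ACl (1*3*5*2*4*6)).
Qed.

Lemma shiftZ l t a u : D u -> shifted l t (a *: u) = a *: shifted l t u.
Proof.
move=> Du; rewrite /shifted AZ// JZ// !scalerBr !scalerA.
by rewrite (mulrC l) (mulrC t).
Qed.

Lemma shiftD l t u v : D u -> D v ->
  shifted l t (u + v) = shifted l t u + shifted l t v.
Proof.
move=> Du Dv; have Dv' := siN Dv.
rewrite -[v in LHS]opprK shiftB// -[- v]scaleN1r shiftZ// scaleN1r opprK//.
Qed.

Lemma shift0 l t : shifted l t 0 = 0.
Proof. by rewrite -{1}(scale0r 0) shiftZ ?scale0r//; exact: (si0 H). Qed.

(** The cross terms cancel, because A is symmetric and J is skew and commutes
    with A. *)
Lemma norm_shifted l t u : D u ->
  N (shifted l t u) = N (shifted l 0 u) + t ^+ 2 * N u.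
Proof.
move=> Du; have DA := AD Du; have DJ := JD Du.
have Db : D (shifted l 0 u) by exact: Dshift.
have DtJ : D (t *: J u) by apply: (siZ H).
rewrite {1 2}/shifted -shift0E gi_NB// gi_NZ// JJ//.
suff -> : g (shifted l 0 u) (t *: J u) = 0 by rewrite mulr0 subr0.
rewrite gi_Zr// shift0E.
have Dlu : D (- (l *: u)) by apply: siN; apply: (siZ H).
rewrite (giD H)// gi_Nl//; last exact: (siZ H).
rewrite (giZ H)//.
have e1 : g u (J u) = 0.
  have := Jskew Du Du; rewrite (giC H DJ Du); lra.
have e2 : g (A u) (J u) = 0.
  have := Asym Du DJ; rewrite AJ// => h.
  have := Jskew Du DA; rewrite (giC H DJ DA) h; lra.
by rewrite e1 e2; ring.
Qed.

(** Solve at l + i t, up to a small error, and use the solution at l. The new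
    error t J u is at most a fixed fraction of f: the lower bound at l makes
    the squared norm of (A - l - i t) u at least (e + t^2) / t^2 times that of
    t J u. *)
Lemma dense_range_real l t e : 0 < e ->
  (forall u, D u -> e * N u <= N (shifted l 0 u)) ->
  (forall f d, D f -> 0 < d -> exists2 u, D u & N (shifted l t u - f) <= d) ->
  forall f d, D f -> 0 < d -> exists2 u, D u & N (shifted l 0 u - f) <= d.
Proof.
move=> e0 lb dense.
pose r := t ^+ 2 / (e + t ^+ 2).
have et : 0 < e + t ^+ 2 by rewrite ltr_pwDl// sqr_ge0.
have r0 : 0 <= r by rewrite divr_ge0 ?sqr_ge0// ltW.
have r1 : r < 1 by rewrite ltr_pdivrMr// mul1r ltrDr.
(* Any s with (1 + s)^2 r < 1 would do for the two applications of Young's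
   inequality; c collects the constants in front of N x. *)
pose s := (1 - r) / 4.
have s0 : 0 < s by rewrite /s; lra.
pose c := (1 + s^-1) * (1 + (1 + s) * r).
have c0 : 0 < c.
  have si : 0 < s^-1 by rewrite invr_gt0.
  have sr : 0 <= (1 + s) * r by apply: mulr_ge0 => //; lra.
  by apply: mulr_gt0; lra.
apply: (@dense_range_of_contraction (shifted l 0) _ _ _ ((7 + r) / 8)).
- by move=> u; exact: Dshift.
- by move=> u v; exact: shiftB.
- exact: shift0.
- by apply/andP; split; lra.
move=> f Df.
have [Nf0|Nf0] := eqVneq (N f) 0.
  exists 0; first exact: (si0 H).
  by rewrite shift0 add0r gi_Nl ?gi_Nr ?opprK ?Nf0 ?mulr0//; exact: siN.
have Nf : 0 < N f by rewrite lt_def Nf0 (gi_ge0 H).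
have d0 : 0 < (1 - r) / 8 / c * N f.
  by rewrite mulr_gt0// divr_gt0//; lra.
have [u Du hu] := dense _ _ Df d0; exists u => //.
set x := shifted l t u - f in hu.
have Dx : D x by apply: siB => //; exact: Dshift.
have DtJ : D (t *: J u) by apply: (siZ H) => //; exact: JD.
have E : shifted l 0 u - f = x + t *: J u.
  by rewrite shift0E /x /shifted [RHS]addrAC subrK.
have hJ : N (t *: J u) <= r * N (shifted l t u).
  rewrite gi_NZ ?JJ//; last exact: JD.
  rewrite norm_shifted// /r [leRHS]mulrAC ler_pdivlMr//.
  have := ler_wpM2l (sqr_ge0 t) (lb _ Du); lra.
have hL : N (shifted l t u) <= (1 + s^-1) * N x + (1 + s) * N f.
  have -> : shifted l t u = x + f by rewrite /x subrK.
  exact: gi_young.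
rewrite E; apply: le_trans (gi_young s0 Dx DtJ) _.
have si0' : 0 < s^-1 by rewrite invr_gt0.
have h1 : (1 + s) * N (t *: J u) <=
  (1 + s) * (r * ((1 + s^-1) * N x + (1 + s) * N f)).
  rewrite ler_pM2l; last lra.
  by apply: le_trans hJ _; rewrite ler_wpM2l.
apply: le_trans (lerD (lexx _) h1) _.
have -> : (1 + s^-1) * N x +
  (1 + s) * (r * ((1 + s^-1) * N x + (1 + s) * N f)) =
  c * N x + (1 + s) ^+ 2 * r * N f by rewrite /c; ring.
have h2 : c * N x <= (1 - r) / 8 * N f.
  have -> : (1 - r) / 8 * N f = c * ((1 - r) / 8 / c * N f).
    by field; rewrite gt_eqF.
  by rewrite ler_pM2l.
have h3 : (1 + s) ^+ 2 * r <= 3 / 4 + r / 4.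
  have : (1 + s) ^+ 2 <= 1 + 3 * s by rewrite /s; nra.
  by move=> h; apply: le_trans (ler_wpM2r r0 h) _; rewrite /s; nra.
have := ler_wpM2r (ltW Nf) h3; lra.
Qed.

Definition rayleigh l : set R :=
  [set x | exists2 u, D u /\ 0 < N u & x = N (shifted l 0 u) / N u].

(** The square of the distance from l to the spectrum. *)
Definition gap l : R := inf (rayleigh l).

Hypothesis nontrivial : exists2 u, D u & 0 < N u.

Lemma rayleigh_has_inf l : has_inf (rayleigh l).
Proof.
have [u Du Nu] := nontrivial; split.
  by exists (N (shifted l 0 u) / N u), u.
exists 0 => x [v [Dv Nv] ->]; rewrite divr_ge0 ?(gi_ge0 H)//; exact: Dshift.
Qed.

Lemma gap_le l u : D u -> gap l * N u <= N (shifted l 0 u).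
Proof.
move=> Du; have [Nu|Nu] := eqVneq (N u) 0.
  by rewrite Nu mulr0 (gi_ge0 H)//; exact: Dshift.
have Np : 0 < N u by rewrite lt_def Nu (gi_ge0 H).
rewrite -ler_pdivlMr//; apply: ge_inf; first exact: (rayleigh_has_inf l).2.
by exists u.
Qed.

Lemma gap_ge l e : (forall u, D u -> e * N u <= N (shifted l 0 u)) -> e <= gap l.
Proof.
move=> h; apply: lb_le_inf; first exact: (rayleigh_has_inf l).1.
by move=> x [u [Du Nu] ->]; rewrite ler_pdivlMr// h.
Qed.

(** Let d^2 be the gap and B the bounded symmetric operator (A - l)^-1. An
    almost minimizer u of the Rayleigh quotient almost solves B^2 u = u / d^2,
    that is (B - 1/d) (B + 1/d) u = 0. With w close to B u, the vectors w +
    u/d and w - u/d are therefore approximate eigenvectors of A for l + d and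
    l - d, and the parallelogram identity keeps one of them away from 0. *)
Lemma approximate_eigenvalue l k : 0 < gap l -> 0 < k ->
  (forall f d, D f -> 0 < d -> exists2 u, D u & N (shifted l 0 u - f) <= d) ->
  exists2 z, D z & (gap l)^-1 <= N z /\
    (N (shifted (l + Num.sqrt (gap l)) 0 z) <= k \/
     N (shifted (l - Num.sqrt (gap l)) 0 z) <= k).
Proof.
set e := gap l => e0 k0 dense; set d := Num.sqrt e.
have d0 : 0 < d by rewrite sqrtr_gt0.
have dd : d ^+ 2 = e by rewrite sqr_sqrtr// ltW.
pose eta := k / 8 * Num.min 1 e.
have m0 : 0 < Num.min 1 e by rewrite lt_min ltr01.
have eta0 : 0 < eta by rewrite /eta mulr_gt0//; lra.
have etak : eta <= k / 8.
  by rewrite /eta ler_piMr// ?ge_min ?lexx//; lra.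
have etae : eta / e <= k / 8.
  by rewrite ler_pdivrMr// /eta ler_wpM2l// ?ge_min ?lexx ?orbT//; lra.
have [x [u1 [Du1 Nu1] ->]] := inf_adherent eta0 (rayleigh_has_inf l).
rewrite -/(gap l) -/e => hu1.
pose u := (Num.sqrt (N u1))^-1 *: u1.
have Du : D u by apply: (siZ H).
have Nu : N u = 1.
  by rewrite gi_NZ// exprVn sqr_sqrtr ?mulVf ?gt_eqF// ltW.
pose f := shifted l 0 u; have Df : D f by exact: Dshift.
have Nf : N f <= e + eta.
  rewrite /f shiftZ// gi_NZ; last exact: Dshift.
  by rewrite exprVn sqr_sqrtr ?(ltW Nu1)// mulrC ltW.
have [w Dw hw] := dense u eta Du eta0.
set u' := shifted l 0 w in hw; have Du' : D u' by exact: Dshift.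
pose v := u' - u; have Dv : D v by apply: siB.
have ew : e * N w <= N u' by exact: gap_le.
have gwf : g w f = g u' u.
  rewrite /f /u' !shift0E.
  have Dlu a x' : D x' -> D (- (a *: x')) by move=> ?; apply: siN; apply: (siZ H).
  rewrite gi_Dr// ?(giD H)//; try by [exact: AD|exact: Dlu].
  rewrite gi_Nr// ?gi_Nl//; try by apply: (siZ H).
  by rewrite gi_Zr// (giZ H)// Asym.
pose y := d^-1 *: f - d *: w.
have Dy : D y by apply: siB; apply: (siZ H).
have Ny : N y <= eta + eta / e.
  rewrite /y gi_NB; try by apply: (siZ H).
  rewrite !gi_NZ// (giZ H)//; last by apply: (siZ H).
  rewrite gi_Zr// (giC H Df Dw) gwf mulKf ?gt_eqF// exprVn dd.
  have hv : N u' - 2 * g u' u + 1 <= eta by rewrite -[X in _ + X]Nu -(gi_NB Du' Du).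
  have : e^-1 * N f <= e^-1 * (e + eta) by rewrite ler_pM2l ?invr_gt0.
  by rewrite mulrDr mulVf ?gt_eqF// => h; lra.
have small s : s = 1 \/ s = -1 -> N (v + s *: y) <= k.
  move=> hs; have Dsy : D (s *: y) by apply: (siZ H).
  apply: le_trans (gi_young ltr01 Dv Dsy) _.
  rewrite gi_NZ//; have -> : s ^+ 2 = 1 by case: hs => ->; rewrite ?sqrrN expr1n.
  by rewrite invr1 mul1r; have : N v <= eta by []; lra.
pose z1 := w + d^-1 *: u; pose z2 := w - d^-1 *: u.
have Ddu : D (d^-1 *: u) by apply: (siZ H).
have Dz1 : D z1 by apply: (siD H).
have Dz2 : D z2 by apply: siB.
have sh a b p : shifted (a + b) 0 p = shifted a 0 p - b *: p.
  by rewrite !shift0E scalerDl opprD addrA.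
have hz1 : N (shifted (l + d) 0 z1) <= k.
  rewrite sh.
  have -> : shifted l 0 z1 - d *: z1 = v + 1 *: y.
    rewrite /z1 shiftD// shiftZ// (scalerDr d) scale1r.
    rewrite (scalerA d) mulfV ?gt_eqF// scale1r /v /y -/u' -/f opprD.
    by rewrite !addrA [LHS](ACl (1*4*2*3)).
  exact: small (or_introl erefl).
have hz2 : N (shifted (l - d) 0 z2) <= k.
  rewrite sh.
  have -> : shifted l 0 z2 - (- d) *: z2 = v + (-1) *: y.
    rewrite /z2 shiftB// shiftZ// (scaleNr d) opprK (scalerBr d) scaleN1r.
    rewrite (scalerA d) mulfV ?gt_eqF// scale1r /v /y -/u' -/f opprB.
    by rewrite !addrA [LHS](ACl (1*4*3*2)).
  exact: small (or_intror erefl).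
have par : 4 * e^-1 <= 2 * N z1 + 2 * N z2.
  have -> : 4 * e^-1 = N ((2 * d^-1) *: u).
    by rewrite gi_NZ// Nu mulr1 exprMn exprVn dd; ring.
  have -> : (2 * d^-1) *: u = z1 - z2.
    rewrite /z1 /z2 opprB -scalerA scaler_nat mulr2n.
    by rewrite addrA [RHS](ACl (1*4*2*3)) /= subrr add0r.
  rewrite gi_NB//.
  by have := gi_ge0 H (siD H Dz1 Dz2); rewrite gi_ND//; lra.
have [h|h] := leP (e^-1) (N z1).
  by exists z1 => //; split=> //; left.
by exists z2 => //; split; [lra|right].
Qed.

(** If there were no approximate eigenvalue beyond b, the gap at every l > b
    would be at least (l - b)^2, because one of the two points at the distance
    of the spectrum from l is an approximate eigenvalue and hence at most b.
    Comparing the terms linear in l in (l - b)^2 N u <= N ((A - l) u) for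
    large l gives g (A u) u <= b N u, against unboundedness. *)
Theorem approximate_spectrum_unbounded :
  (forall l, exists t, forall f d, D f -> 0 < d ->
     exists2 u, D u & N (shifted l t u - f) <= d) ->
  (forall b, exists2 u, D u & b * N u < g (A u) u) ->
  forall b e, 0 < e -> exists2 l, b < l &
    exists2 u, D u & 0 < N u /\ N (shifted l 0 u) <= e * N u.
Proof.
move=> dense unb b e e0; apply: contrapT => hno.
have reg l : b < l -> forall u, D u -> e * N u <= N (shifted l 0 u).
  move=> bl u Du; rewrite leNgt; apply/negP => hlt; apply: hno.
  exists l => //; exists u => //; split; last exact: ltW.
  rewrite lt_def (gi_ge0 H)// andbT; apply/eqP => Nu0.
  by move: hlt; rewrite Nu0 mulr0 ltNge (gi_ge0 H)//; exact: Dshift.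
have gap0 l : b < l -> e <= gap l by move=> bl; exact: gap_ge (reg l bl).
have lower l : b < l -> (l - b) ^+ 2 <= gap l.
  move=> bl; have gl : 0 < gap l := lt_le_trans e0 (gap0 l bl).
  have [t ht] := dense l.
  have dr := dense_range_real gl (@gap_le l) ht.
  have k0 : 0 < e / gap l / 2 by rewrite divr_gt0// divr_gt0.
  have [z Dz [Nz hz]] := approximate_eigenvalue gl k0 dr.
  have bad m : b < m -> N (shifted m 0 z) <= e / gap l / 2 -> False.
    move=> bm h; have := le_trans (reg m bm z Dz) h.
    have : e / gap l <= e * N z by rewrite ler_pM2l.
    have : 0 < e / gap l by rewrite divr_gt0.
    lra.
  have sq0 : 0 <= Num.sqrt (gap l) by rewrite sqrtr_ge0.
  rewrite -(@ler_sqrt _ _ (gap l)) ?(ltW gl)// sqrtr_sqr ger0_norm; last lra.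
  rewrite leNgt; apply/negP => hlt.
  by case: hz => [/bad|/bad]; apply; lra.
have [u Du hu] := unb b.
set G := g (A u) u in hu; set K := N (A u).
have K0 : 0 <= K by apply: (gi_ge0 H); exact: AD.
have gapG : 0 < G - b * N u by lra.
(* In (l - b)^2 N u <= K - 2 l G + l^2 N u the squares of l cancel; this l is
   too large for the remaining linear inequality. *)
pose l := `|b| + 1 + K / (G - b * N u).
have q0 : 0 <= K / (G - b * N u) by rewrite divr_ge0// ltW.
have lb : b < l by rewrite /l; have := ler_norm b; lra.
have := le_trans (ler_wpM2r (gi_ge0 H Du) (lower l lb)) (gap_le l Du).
have Dlu : D (l *: u) by apply: (siZ H).
have DAu := AD Du.
rewrite shift0E gi_NB// gi_NZ// gi_Zr// -/G -/K => h.
have lp : 0 < l by rewrite /l; have := normr_ge0 b; lra.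
have : 2 * l * (G - b * N u) <= K.
  by have := mulr_ge0 (sqr_ge0 b) (gi_ge0 H Du); nra.
rewrite leNgt => /negP; apply.
have : K = K / (G - b * N u) * (G - b * N u) by field; rewrite gt_eqF.
have : K / (G - b * N u) + 1 <= l by rewrite /l; have := normr_ge0 b; lra.
set Q := K / _ => h1 h2.
rewrite h2 ltr_pM2r//; lra.
Qed.
End SelfAdjoint.
End SemiInnerProduct.

(** The codomain is R as a module over itself, so that this linear form can
    serve as a differential. *)
Definition dot_form {R : realType} {n : nat} (a : 'rV[R]_n) (h : 'rV[R]_n) : R^o :=
  dotp h a.

Lemma dot_form_linear {R : realType} {n : nat} (a : 'rV[R]_n) :
  linear (dot_form a).
Proof.
move=> c u v; rewrite /dot_form /dotp scaler_sumr -big_split/=.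
by apply: eq_bigr => j _; rewrite !mxE mulrDl [in RHS]/GRing.scale/= mulrA.
Qed.

HB.instance Definition _ {R : realType} {n : nat} (a : 'rV[R]_n) :=
  GRing.isLinear.Build R 'rV[R]_n R^o *:%R (dot_form a) (dot_form_linear a).

Section Calculus.
Context {R : realType}.

Lemma le_coord_norm n (v : 'rV[R]_n) j : `|v 0 j| <= `|v|.
Proof.
rewrite [leRHS]/Num.norm/= mx_normrE.
exact: (le_bigmax _ (fun ij => `|v ij.1 ij.2|) (0, j)).
Qed.

Lemma norm_le_coord n (v : 'rV[R]_n) e : 0 <= e ->
  (forall j, `|v 0 j| <= e) -> `|v| <= e.
Proof.
move=> e0 h; rewrite /Num.norm/= mx_normrE; apply: bigmax_le => // -[i j] _ /=.
by rewrite ord1.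
Qed.

Lemma dot_form_continuous n (a : 'rV[R]_n) : continuous (dot_form a).
Proof.
apply: (@bounded_linear_continuous _ _ R^o); apply/(@linear_boundedP _ _ R^o).
exists (\sum_j `|a 0 j|); split; first by rewrite realE sumr_ge0.
move=> M hM v; rewrite /dot_form /dotp.
apply: le_trans (ler_norm_sum _ _ _) _.
apply: (@le_trans _ _ (\sum_j `|a 0 j| * `|v|)).
  by apply: ler_sum => j _; rewrite normrM mulrC ler_wpM2l ?le_coord_norm.
by rewrite -mulr_suml ler_wpM2r// ltW.
Qed.

Section Line.
Context {n : nat} (f : 'rV[R]_n -> R) (y v : 'rV[R]_n).

Lemma line_quotient (s : R) :
  (fun h : R => h^-1 *: (f ((h *: (1 : R) + s) *: v + y) - f (s *: v + y))) =
  (fun h : R => h^-1 *: (f (h *: v + (s *: v + y)) - f (s *: v + y))).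
Proof. by apply/funext => h; rewrite [h *: (1 : R)]mulr1 scalerDl addrA. Qed.

Lemma is_derive_line (s : R) : derivable f (s *: v + y) v ->
  is_derive s 1 (fun t => f (t *: v + y)) ('D_v f (s *: v + y)).
Proof.
move=> df; apply: DeriveDef.
  by rewrite /derivable /= line_quotient.
by rewrite /derive /= line_quotient.
Qed.

(** The mean value theorem along a line; a is the value of the derivative at
    the point where the function is differentiated. *)
Lemma line_mvt (a e t : R) :
  (forall s : R, `|s| <= `|t| -> derivable f (s *: v + y) v /\
                             `|'D_v f (s *: v + y) - a| <= e) ->
  `|f (t *: v + y) - f y - t * a| <= e * `|t|.
Proof.
move=> h; pose g s := f (s *: v + y).
have dg (s : R) : `|s| <= `|t| -> is_derive s 1 g ('D_v f (s *: v + y)).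
  by move=> /h[df _]; exact: is_derive_line.
have cg (p q : R) : (forall s : R, p <= s <= q -> `|s| <= `|t|) ->
    {within `[p, q], continuous g}.
  move=> hs; apply: derivable_within_continuous => s.
  by rewrite in_itv/= => /hs/dg[].
have g0 : g 0 = f y by rewrite /g scale0r add0r.
rewrite -g0 -/(g t).
have [t0|t0|->] := ltgtP t 0; last first.
- by rewrite subrr mul0r subr0 !normr0 mulr0.
- have nt (s : R) : 0 <= s <= t -> `|s| <= `|t|.
    by move=> /andP[s0 st]; rewrite !ger0_norm// (le_trans s0).
  have [|c] := @MVT _ g (fun s => 'D_v f (s *: v + y)) 0 t t0 _ (cg _ _ nt).
    move=> s; rewrite in_itv/= => /andP[s0 st]; apply: dg; apply: nt.
    by rewrite !ltW.
  rewrite in_itv/= subr0 => /andP[c0 ct] ->.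
  rewrite (mulrC t) -mulrBl normrM ler_wpM2r//.
  by apply: (h c _).2; apply: nt; rewrite !ltW.
- have nt (s : R) : t <= s <= 0 -> `|s| <= `|t|.
    by move=> /andP[s0 st]; rewrite !ler0_norm ?lerN2// (le_trans s0).
  have [|c] := @MVT _ g (fun s => 'D_v f (s *: v + y)) t 0 t0 _ (cg _ _ nt).
    move=> s; rewrite in_itv/= => /andP[s0 st]; apply: dg; apply: nt.
    by rewrite !ltW.
  rewrite in_itv/= sub0r => /andP[c0 ct] E.
  rewrite -[g t - g 0]opprB E mulrN opprK (mulrC t) -mulrBl normrM ler_wpM2r//.
  by apply: (h c _).2; apply: nt; rewrite !ltW.
Qed.
End Line.

Section Differentiable.
Context {n : nat} (f : 'rV[R]_n -> R) (x : 'rV[R]_n).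
Hypothesis Hd : \forall y \near x, forall j, derivable f y (basis_vec j).
Hypothesis Hc : forall j, {for x, continuous (partial j f)}.

Let grad : 'rV[R]_n := \row_j partial j f x.

Let trunc (h : 'rV[R]_n) (k : nat) : 'rV[R]_n :=
  \row_j (if (j < k)%N then h 0 j else 0).

Let truncS h (k : 'I_n) : trunc h k.+1 = h 0 k *: basis_vec k + trunc h k.
Proof.
apply/rowP => j; rewrite !mxE eqxx/= ltnS leq_eqVlt.
have [->|jk] := eqVneq j k; first by rewrite eqxx/= ltnn addr0 mulr1.
by rewrite val_eqE (negbTE jk)/= mulr0 add0r.
Qed.

(** The increment is telescoped along n steps parallel to the axes; on each of
    them the mean value theorem replaces it by the partial derivative at x,
    with an error controlled by continuity. *)
Lemma differentiable_of_partials : differentiable f x.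
Proof.
suff main : (f : 'rV[R]_n -> R^o) \o shift x =
    cst (f x : R^o) + dot_form grad +o_ (0 : 'rV[R]_n) id.
  apply/diff_locallyP.
  rewrite (diff_unique (@dot_form_continuous n grad) main).
  by split => //; exact: dot_form_continuous.
apply/eqaddoP => e e0.
have n1 : 0 < n%:R + 1 :> R by rewrite ltr_pwDr.
have e1 : 0 < e / (n%:R + 1) by rewrite divr_gt0.
have [d d0 hd] : exists2 d, 0 < d & forall y, `|y| < d -> forall j,
    derivable f (y + x) (basis_vec j) /\
    `|partial j f (y + x) - partial j f x| <= e / (n%:R + 1).
  have : \forall y \near x, forall j, derivable f y (basis_vec j) /\
      `|partial j f y - partial j f x| <= e / (n%:R + 1).
    apply: (@filter_forall _ _ (fun (j : 'I_n) y =>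
      derivable f y (basis_vec j) /\
      `|partial j f y - partial j f x| <= e / (n%:R + 1)) (nbhs x) _) => j.
    apply: filterI.
      by apply: filterS Hd => y; exact.
    have /cvgrPdist_le/(_ _ e1) := @Hc j.
    by apply: filterS => y; rewrite distrC.
  move=> /nbhs_ballP[d d0 hd]; exists d => // y yd j.
  apply: hd; rewrite -ball_normE/=.
  by rewrite opprD addrCA subrr addr0 normrN.
apply/nbhs_ballP; exists d => //= h; rewrite -ball_normE/= sub0r normrN => hh.
change (`|f (h + x) - (f x + dot_form grad h)| <= e * `|h|).
have tn k : `|trunc h k| <= `|h|.
  apply: norm_le_coord => // j; rewrite mxE.
  by case: ifP => _; rewrite ?normr0 ?le_coord_norm.
have -> : f (h + x) - (f x + dot_form grad h) =
  \sum_(k < n) (f (trunc h k.+1 + x) - f (trunc h k + x) - h 0 k * partial k f x).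
  rewrite sumrB; have -> : \sum_(k < n) (f (trunc h k.+1 + x) - f (trunc h k + x))
     = f (trunc h n + x) - f (trunc h 0 + x).
    rewrite -(big_mkord predT (fun k => f (trunc h k.+1 + x) - f (trunc h k + x))).
    by rewrite telescope_sumr.
  have -> : trunc h n = h by apply/rowP => j; rewrite mxE ltn_ord.
  have -> : trunc h 0 = 0 by apply/rowP => j; rewrite !mxE.
  rewrite add0r opprD addrA; congr (_ - _).
  by apply: eq_bigr => j _; rewrite mxE.
apply: le_trans (ler_norm_sum _ _ _) _.
apply: (@le_trans _ _ (\sum_(k < n) e / (n%:R + 1) * `|h|)).
  apply: ler_sum => k _; rewrite truncS -(addrA (_ *: _)).
  apply: le_trans (_ : e / (n%:R + 1) * `|h 0 k| <= _); last first.
    by rewrite ler_wpM2l ?le_coord_norm// ltW.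
  apply: line_mvt => s hs; rewrite addrA; apply: hd.
  apply: le_lt_trans hh; apply: norm_le_coord => // j.
  rewrite !mxE eqxx/=; have [->|jk] := eqVneq j k.
    by rewrite ltnn addr0 mulr1 (le_trans hs)// le_coord_norm.
  by rewrite mulr0 add0r; case: ifP; rewrite ?normr0 ?le_coord_norm.
rewrite sumr_const card_ord -[leLHS]mulr_natr [leLHS]mulrAC ler_wpM2r// -mulrA ler_piMr ?ltW//.
by rewrite mulrC ltr_pdivrMr// mul1r ltrDl.
Qed.
End Differentiable.
End Calculus.

Lemma continuous_for_ext (T T' : topologicalType) (f g : T -> T') (x : T) : (\forall y \near x, f y = g y) ->
  {for x, continuous f} -> {for x, continuous g}.
Proof.
move=> fg cf; rewrite /prop_for /continuous_at -(nbhs_singleton fg).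
by apply: cvg_trans cf; exact: (@near_eq_cvg _ _ (nbhs x) _).
Qed.

(** * Functions of class C^r *)

Section CDiff.
Context {R : realType} {n : nat}.
Implicit Types (U : set 'rV[R]_n) (f g : 'rV[R]_n -> R).

(** Recursion on the order makes closure under sums, products and compositions
    accessible to induction, which the definition of smoothness by lists of
    indices does not. *)
Fixpoint cdiff (r : nat) U f : Prop :=
  (forall x, U x -> {for x, continuous f}) /\
  match r with
  | 0 => True
  | r'.+1 => (forall x j, U x -> derivable f x (basis_vec j)) /\
             forall j, cdiff r' U (partial j f)
  end.

Lemma cdiff_continuous r U f x : cdiff r U f -> U x -> {for x, continuous f}.
Proof. by case: r => [|r] [h _]; exact: h. Qed.

Lemma cdiffW r U f : cdiff r.+1 U f -> cdiff r U f.
Proof.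
elim: r f => [|r IH] f [hc [hd hp]]; first by split.
by split => //; split => // j; apply: IH.
Qed.

Lemma smooth_on_partial U f j : smooth_on U f -> smooth_on U (partial j f).
Proof. by move=> h s x Ux; have := h (rcons s j) x Ux; rewrite foldr_rcons. Qed.

Lemma smooth_onP U f : smooth_on U f <-> forall r, cdiff r U f.
Proof.
split=> [h r|h s].
  elim: r f h => [|r IH] f h.
    by split => // x Ux; have [] := h [::] x Ux.
  split; first by move=> x Ux; have [] := h [::] x Ux.
  split; first by move=> x j Ux; have [_ hd] := h [::] x Ux; exact: hd.
  by move=> j; apply: IH; exact: smooth_on_partial.
elim/last_ind: s f h => [|s j IH] f h x Ux.
  split => [|j]; first by have [hc _] := h 0%N; exact: hc.
  by have [_ [hd _]] := h 1%N; exact: hd.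
rewrite foldr_rcons; apply: IH => // r.
by have [_ [_ hp]] := h r.+1; exact: hp.
Qed.

Lemma open_near U x : open U -> U x -> \forall y \near x, U y.
Proof. by move=> Uo Ux; exact: open_nbhs_nbhs. Qed.

Lemma cdiff_ext r U f g : open U -> (forall x, U x -> f x = g x) ->
  cdiff r U f -> cdiff r U g.
Proof.
move=> Uo; elim: r f g => [|r IH] f g fg /= [hc hr].
  split => // x Ux; apply: continuous_for_ext (hc x Ux).
  by apply: filterS (open_near Uo Ux) => y; exact: fg.
have fgn x : U x -> \forall y \near x, f y = g y.
  by move=> Ux; apply: filterS (open_near Uo Ux) => y; exact: fg.
case: hr => hd hp; split.
  by move=> x Ux; apply: continuous_for_ext (hc x Ux); exact: fgn.
split; first by move=> x j Ux; apply: near_eq_derivable (hd x j Ux); exact: fgn.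
move=> j; apply: IH (hp j) => x Ux.
by rewrite /partial; apply: near_eq_derive; exact: fgn.
Qed.

Lemma cdiff_cst r U (a : R) : cdiff r U (fun=> a).
Proof.
elim: r a => [|r IH] a; split => //.
- by move=> x _; exact: cst_continuous.
- by move=> x _; exact: cst_continuous.
split; first by move=> x j _; exact: derivable_cst.
move=> j; have -> : partial j (fun=> a) = fun=> 0.
  by apply/funext => x; rewrite /partial derive_cst.
exact: IH.
Qed.

Lemma cdiffD r U f g : open U -> cdiff r U f -> cdiff r U g ->
  cdiff r U (fun x => f x + g x).
Proof.
move=> Uo; elim: r f g => [|r IH] f g [fc fr] [gc gr]; split => //.
- by move=> x Ux; apply: continuousD; [exact: fc|exact: gc].
- by move=> x Ux; apply: continuousD; [exact: fc|exact: gc].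
case: fr gr => fd fp [gd gp]; split.
  by move=> x j Ux; apply: derivableD; [exact: fd|exact: gd].
move=> j; apply: cdiff_ext (IH _ _ (fp j) (gp j)) => // x Ux.
by rewrite /partial [RHS]deriveD//; [exact: fd|exact: gd].
Qed.

Lemma cdiffM r U f g : open U -> cdiff r U f -> cdiff r U g ->
  cdiff r U (fun x => f x * g x).
Proof.
move=> Uo; elim: r f g => [|r IH] f g Hf Hg.
  case: Hf Hg => fc fr [gc gr]; split => // x Ux.
  by apply: continuousM; [exact: fc|exact: gc].
have Hf' := cdiffW Hf; have Hg' := cdiffW Hg.
case: Hf Hg => fc [fd fp] [gc [gd gp]]; split.
  by move=> x Ux; apply: continuousM; [exact: fc|exact: gc].
split; first by move=> x j Ux; apply: derivableM; [exact: fd|exact: gd].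
move=> j.
have := cdiffD Uo (IH _ _ Hf' (gp j)) (IH _ _ Hg' (fp j)).
apply: cdiff_ext => // x Ux.
by rewrite /partial [RHS]deriveM//; [exact: fd|exact: gd].
Qed.

Lemma cdiff_sum r U I (s : seq I) (P : pred I) (F : I -> 'rV[R]_n -> R) : open U ->
  (forall i, P i -> cdiff r U (F i)) ->
  cdiff r U (fun x => \sum_(i <- s | P i) F i x).
Proof.
move=> Uo h; elim: s => [|i s IH].
  apply: cdiff_ext (cdiff_cst r U 0) => // x _; by rewrite big_nil.
have [Pi|Pi] := boolP (P i).
  apply: cdiff_ext (cdiffD Uo (h i Pi) IH) => // x _.
  by rewrite big_cons Pi.
by apply: cdiff_ext IH => // x _; rewrite big_cons (negbTE Pi).
Qed.

Lemma cdiff_prod r U I (s : seq I) (P : pred I) (F : I -> 'rV[R]_n -> R) : open U ->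
  (forall i, P i -> cdiff r U (F i)) ->
  cdiff r U (fun x => \prod_(i <- s | P i) F i x).
Proof.
move=> Uo h; elim: s => [|i s IH].
  apply: cdiff_ext (cdiff_cst r U 1) => // x _; by rewrite big_nil.
have [Pi|Pi] := boolP (P i).
  apply: cdiff_ext (cdiffM Uo (h i Pi) IH) => // x _.
  by rewrite big_cons Pi.
by apply: cdiff_ext IH => // x _; rewrite big_cons (negbTE Pi).
Qed.

Lemma partial_coord (i j : 'I_n) (x : 'rV[R]_n) :
  partial j (fun y : 'rV[R]_n => y 0 i) x = (i == j)%:R /\
  derivable (fun y : 'rV[R]_n => y 0 i) x (basis_vec j).
Proof.
have L : (fun y : 'rV[R]_n => y 0 i) = dot_form (basis_vec i) :> (_ -> R^o).
  apply/funext => y; rewrite /dot_form /dotp (bigD1 i)//= mxE !eqxx mulr1.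
  rewrite big1 ?addr0// => k /negbTE ki; by rewrite mxE eqxx ki mulr0.
have dL := @linear_differentiable R 'rV[R]_n R^o (dot_form (basis_vec i)) x
   (@dot_form_continuous _ _ _).
split; last by rewrite L; apply: diff_derivable.
rewrite /partial L deriveE// diff_lin; last exact: dot_form_continuous.
have := congr1 (@^~ (basis_vec j)) L; rewrite /= => <-.
by rewrite mxE eqxx/=.
Qed.

Lemma cdiff_coord r U (i : 'I_n) : cdiff r U (fun y : 'rV[R]_n => y 0 i).
Proof.
case: r => [|r].
  by split => // x _; exact: coord_continuous.
split; first by move=> x _; exact: coord_continuous.
split; first by move=> x j _; exact: (partial_coord i j x).2.
move=> j; rewrite (_ : partial j _ = fun=> (i == j)%:R); first exact: cdiff_cst.
by apply/funext => x; rewrite (partial_coord i j x).1.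
Qed.

Lemma cdiff_differentiable r U f x : open U -> cdiff r.+1 U f -> U x ->
  differentiable f x.
Proof.
move=> Uo [fc [fd fp]] Ux; apply: differentiable_of_partials.
  by apply: filterS (open_near Uo Ux) => y Uy j; exact: fd.
by move=> j; exact: cdiff_continuous (fp j) Ux.
Qed.
End CDiff.

Section Composition.
Context {R : realType} {n k : nat}.
Implicit Types (G : 'rV[R]_k -> 'rV[R]_n).

Lemma row_continuous G x :
  (forall j, {for x, continuous (fun y => G y 0 j)}) -> {for x, continuous G}.
Proof.
move=> h; apply/(@cvgrPdist_le _ _ _ (nbhs x)) => e e0.
have : \forall y \near x, forall j, `|G x 0 j - G y 0 j| <= e.
  apply: (@filter_forall _ _ (fun j y => `|G x 0 j - G y 0 j| <= e) (nbhs x) _) => j.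
  by have /cvgrPdist_le/(_ _ e0) := @h j.
apply: filterS => y hy; apply: norm_le_coord; first exact: ltW.
by move=> j; rewrite !mxE; exact: hy.
Qed.

Lemma row_differentiable G x :
  (forall j, differentiable (fun y => G y 0 j) x) -> differentiable G x.
Proof.
move=> h.
have -> : G = \sum_j (fun y => G y 0 j *: basis_vec j).
  apply/funext => y; rewrite fct_sumE {1}[G y]row_sum_delta.
  by apply: eq_bigr.
by apply: differentiable_sum => j; apply: differentiableZl; exact: h.
Qed.

Lemma partial_comp (f : 'rV[R]_n -> R) G x i :
  differentiable f (G x) -> (forall j, differentiable (fun y => G y 0 j) x) ->
  partial i (fun y => f (G y)) x =
  \sum_j partial j f (G x) * partial i (fun y => G y 0 j) x.
Proof.
move=> df dG; have dG' := row_differentiable dG.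
rewrite /partial deriveE; last exact: differentiable_comp.
rewrite (diff_comp dG' df)/= -(deriveE _ dG').
have dd : derivable G x (basis_vec i) by apply: diff_derivable.
rewrite derive_mx// [X in 'd _ _ X]row_sum_delta linear_sum.
apply: eq_bigr => j _; rewrite linearZ mxE -(deriveE _ df) mulrC.
by [].
Qed.

(** The chain rule writes the partial derivatives of the composition as sums
    of products of functions of order r, so that the induction closes. *)
Lemma cdiff_comp r U U' (f : 'rV[R]_n -> R) G : open U -> open U' ->
  (forall y, U y -> U' (G y)) -> cdiff r U' f ->
  (forall j, cdiff r U (fun y => G y 0 j)) -> cdiff r U (fun y => f (G y)).
Proof.
move=> Uo Uo' UG; elim: r f => [|r IH] f Hf HG.
  split => // x Ux; apply: (@continuous_comp _ _ _ G f).
    by apply: row_continuous => j; exact: cdiff_continuous (HG j) Ux.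
  by apply: cdiff_continuous Hf _; exact: UG.
have dG x j : U x -> differentiable (fun y => G y 0 j) x.
  exact: cdiff_differentiable Uo (HG j).
have df x : U x -> differentiable f (G x).
  by move=> Ux; apply: cdiff_differentiable Uo' Hf _; exact: UG.
have dfG x : U x -> differentiable (fun y => f (G y)) x.
  move=> Ux; apply: (@differentiable_comp _ _ _ _ G f); last exact: df.
  by apply: row_differentiable => j; exact: dG.
split; first by move=> x Ux; apply: differentiable_continuous; exact: dfG.
split; first by move=> x j Ux; apply: diff_derivable; exact: dfG.
move=> i; have [_ [_ fp]] := Hf.
have : cdiff r U (fun x => \sum_j partial j f (G x) * partial i (fun y => G y 0 j) x).
  apply: cdiff_sum => // j _; apply: cdiffM => //.
    by apply: IH; [exact: fp|move=> l; exact: cdiffW].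
  by have [_ [_ hp]] := HG j; exact: hp.
by apply: cdiff_ext => // x Ux; rewrite partial_comp//; [exact: df|move=> j; exact: dG].
Qed.
End Composition.

(** * Smooth functions on open sets *)

Section SmoothOn.
Context {R : realType} {n : nat}.
Implicit Types (U : set 'rV[R]_n) (f g : 'rV[R]_n -> R).

Lemma smooth_on_ext U f g : open U -> (forall x, U x -> f x = g x) ->
  smooth_on U f -> smooth_on U g.
Proof. by move=> Uo fg /smooth_onP h; apply/smooth_onP => r; exact: cdiff_ext (h r). Qed.

Lemma smooth_on_cst U (a : R) : smooth_on U (fun=> a).
Proof. by apply/smooth_onP => r; exact: cdiff_cst. Qed.

Lemma smooth_on_coord U (i : 'I_n) : smooth_on U (fun y => y 0 i).
Proof. by apply/smooth_onP => r; exact: cdiff_coord. Qed.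

Lemma smooth_onD U f g : open U -> smooth_on U f -> smooth_on U g ->
  smooth_on U (fun x => f x + g x).
Proof.
by move=> Uo /smooth_onP hf /smooth_onP hg; apply/smooth_onP => r; exact: cdiffD.
Qed.

Lemma smooth_onM U f g : open U -> smooth_on U f -> smooth_on U g ->
  smooth_on U (fun x => f x * g x).
Proof.
by move=> Uo /smooth_onP hf /smooth_onP hg; apply/smooth_onP => r; exact: cdiffM.
Qed.

Lemma smooth_onZ U a f : open U -> smooth_on U f -> smooth_on U (fun x => a * f x).
Proof. by move=> Uo hf; apply: smooth_onM => //; exact: smooth_on_cst. Qed.

Lemma smooth_on_sum U I (s : seq I) (P : pred I) (F : I -> 'rV[R]_n -> R) :
  open U -> (forall i, P i -> smooth_on U (F i)) ->
  smooth_on U (fun x => \sum_(i <- s | P i) F i x).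
Proof.
move=> Uo h; apply/smooth_onP => r; apply: cdiff_sum => // i Pi.
by have /smooth_onP := h i Pi; exact.
Qed.

Lemma smooth_on_prod U I (s : seq I) (P : pred I) (F : I -> 'rV[R]_n -> R) :
  open U -> (forall i, P i -> smooth_on U (F i)) ->
  smooth_on U (fun x => \prod_(i <- s | P i) F i x).
Proof.
move=> Uo h; apply/smooth_onP => r; apply: cdiff_prod => // i Pi.
by have /smooth_onP := h i Pi; exact.
Qed.

Lemma smooth_onS U U' f : U `<=` U' -> smooth_on U' f -> smooth_on U f.
Proof. by move=> UU h s x Ux; apply: h; exact: UU. Qed.

Lemma smooth_on_local U f :
  (forall x, U x -> exists2 W : set 'rV[R]_n, W x & smooth_on W f) -> smooth_on U f.
Proof. by move=> h s x Ux; have [W Wx hW] := h x Ux; exact: hW. Qed.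

Lemma smooth_on_continuous U f x : smooth_on U f -> U x -> {for x, continuous f}.
Proof. by move=> h Ux; have [] := h [::] x Ux. Qed.

Lemma smooth_on_derivable U f x j : smooth_on U f -> U x ->
  derivable f x (basis_vec j).
Proof. by move=> h Ux; have [_ hd] := h [::] x Ux; exact: hd. Qed.

Definition deriv_closed (Q : (R -> R) -> Prop) : Prop :=
  forall p, Q p -> exists2 q, Q q & forall x : R, is_derive x 1 p (q x).

(** The smoothness of p is expressed by a family that contains p and is stable
    under differentiation, such as the span of the sine and the cosine, or the
    products of exp(-1/t) by polynomials in 1/t. *)
Lemma smooth_on_comp1 (Q : (R -> R) -> Prop) U p f : open U -> deriv_closed Q ->
  Q p -> smooth_on U f -> smooth_on U (fun x => p (f x)).
Proof.
move=> Uo Qd Qp hf; apply/smooth_onP => r; elim: r p Qp => [|r IH] p Qp.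
  have [q Qq dpq] := Qd p Qp.
  split => // x Ux; apply: (@continuous_comp _ _ _ f p).
    exact: smooth_on_continuous hf Ux.
  by apply: differentiable_continuous; apply/derivable1_diffP; have [] := dpq (f x).
have [q Qq dpq] := Qd p Qp.
have dp y : differentiable p y by apply/derivable1_diffP; have [] := dpq y.
have /smooth_onP hf' := hf.
have df x : U x -> differentiable f x by move=> Ux; exact: cdiff_differentiable (hf' 1%N) Ux.
have dpf x : U x -> differentiable (fun y => p (f y)) x.
  by move=> Ux; apply: (@differentiable_comp _ _ _ _ f p) => //; exact: df.
split; first by move=> x Ux; apply: differentiable_continuous; exact: dpf.
split; first by move=> x j Ux; apply: diff_derivable; exact: dpf.
move=> j; have /smooth_onP hj := smooth_on_partial j hf.
apply: cdiff_ext (cdiffM Uo (IH q Qq) (hj r)) => // x Ux.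
rewrite /partial [RHS]deriveE; last exact: dpf.
rewrite (diff_comp (df x Ux) (dp _))/= -(deriveE _ (df x Ux)).
rewrite diff1E// derive1E; have [_ ->] := dpq (f x).
by rewrite [RHS]mulrC.
Qed.

Lemma smooth_on_trig U f : open U -> smooth_on U f ->
  smooth_on U (fun x => cos (f x)) /\ smooth_on U (fun x => sin (f x)).
Proof.
move=> Uo hf.
pose Q (p : R -> R) := exists a b : R, p = fun x => a * cos x + b * sin x.
have Qd : deriv_closed Q.
  move=> p [a [b ->]]; exists (fun x => b * cos x + (- a) * sin x).
    by exists b, (- a).
  move=> x; apply: is_derive_eq.
  change (a * - sin x + b * cos x = b * cos x + - a * sin x); ring.
split.
- apply: (smooth_on_ext Uo _ (smooth_on_comp1 Uo Qd _ hf)); last first.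
    by exists 1, 0.
  by move=> x _ /=; rewrite mul1r mul0r addr0.
- apply: (smooth_on_ext Uo _ (smooth_on_comp1 Uo Qd _ hf)); last first.
    by exists 0, 1.
  by move=> x _ /=; rewrite mul1r mul0r add0r.
Qed.
End SmoothOn.

(** * Bump functions *)

Section Bump.
Context {R : realType}.

(** All derivatives of exp(-1/t), extended by 0 to t <= 0, have this form. *)
Definition flat_poly (p : {poly R}) (t : R) : R :=
  if 0 < t then p.[t^-1] * expR (- t^-1) else 0.

Lemma horner_bound (p : {poly R}) (x : R) : 1 <= x ->
  `|p.[x]| <= (\sum_(i < size p) `|p`_i|) * x ^+ size p.
Proof.
move=> x1; have x0 : 0 <= x by rewrite (le_trans _ x1).
rewrite horner_coef mulr_suml; apply: le_trans (ler_norm_sum _ _ _) _.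
apply: ler_sum => i _; rewrite normrM ler_wpM2l// normrX ger0_norm//.
by apply: ler_weXn2l => //; exact: ltnW.
Qed.

(** The exponential beats the polynomial with a margin t^2, which makes the
    difference quotient at 0 tend to 0. *)
Lemma flat_poly_bound (p : {poly R}) : exists2 C : R, 0 <= C &
  forall t, 0 < t <= 1 -> `|flat_poly p t| <= C * t ^+ 2.
Proof.
(* Two more powers than the degree requires: they become the factor t^2. *)
pose S := \sum_(i < size p) `|p`_i|; pose d := size p.
have S0 : 0 <= S by apply: sumr_ge0.
exists (S * (d.+2)%:R ^+ d.+2); first by rewrite mulr_ge0// exprn_ge0.
move=> t /andP[t0 t1]; rewrite /flat_poly t0.
set x := t^-1; have x1 : 1 <= x by rewrite invf_ge1.
have x0 : 0 < x by rewrite (lt_le_trans _ x1).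
have -> : t = x^-1 by rewrite invrK.
rewrite normrM (ger0_norm (expR_ge0 _)) expRN.
rewrite ler_pdivrMr ?expR_gt0//; apply: le_trans (horner_bound p x1) _.
rewrite -/S -/d -(mulrA S) -(mulrA S); apply: ler_wpM2l => //.
have e : x ^+ d.+2 <= d.+2%:R ^+ d.+2 * expR x.
  have : (x / d.+2%:R) ^+ d.+2 <= expR x.
    rewrite -[in leRHS](divfK (_ : d.+2%:R != 0) x) ?pnatr_eq0// [in leRHS]mulrC.
    rewrite expRM_natl lerXn2r ?nnegrE ?expR_ge0 ?divr_ge0 ?(ltW x0)//.
    by apply: le_trans (expR_ge1Dx _); rewrite lerDr.
  by rewrite expr_div_n ler_pdivrMr ?exprn_gt0// mulrC.
have -> : x ^+ d = x ^+ d.+2 * x^-1 ^+ 2.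
  by rewrite -addn2 exprD exprVn mulfK// expf_neq0// gt_eqF.
move: e; set K := d.+2%:R ^+ d.+2; set Y := x ^+ d.+2; clearbody K Y => e.
rewrite (mulrC K) -mulrA mulrC; apply: ler_wpM2l => //.
by rewrite exprn_ge0// invr_ge0 ltW.
Qed.

Lemma is_derive_flat_poly p (t : R) :
  is_derive t 1 (flat_poly p) (flat_poly ('X ^+ 2 * (p - p^`())) t).
Proof.
have [t0|t0|->] := ltgtP t 0.
- have -> : flat_poly ('X ^+ 2 * (p - p^`())) t = 0.
    by rewrite /flat_poly ltNge ltW.
  apply: near_eq_is_derive (is_derive_cst 0 t 1).
  near=> s; rewrite /flat_poly ltNge; case: ifP => //.
  by rewrite ltW//; near: s; exact: lt_nbhsl.
- have tn : t != 0 by rewrite gt_eqF.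
  have dV : is_derive t 1 (fun s : R => s^-1) (- t ^- 2).
    have := @is_deriveV R (fun s => s) t 1 1 tn (is_derive_id _ _).
    by rewrite [_ *: _]mulr1.
  have dp := @is_derive1_comp _ (horner p) _ t _ _ (is_derive_poly p t^-1) dV.
  have dN := is_deriveN dV.
  have dE := @is_derive1_comp _ expR _ t _ _ (is_derive_expR (- t^-1)) dN.
  have dM := is_deriveM dp dE.
  apply: (near_eq_is_derive _ (is_derive_eq dM _)).
    near=> s; rewrite /flat_poly (_ : 0 < s = true)//.
    by near: s; exact: lt_nbhsr.
  rewrite /flat_poly t0 !hornerE.
  change (p.[t^-1] * (expR (- t^-1) * (- - t ^- 2)) +
    expR (- t^-1) * (p^`().[t^-1] * - t ^- 2) =
    t^-1 ^+ 2 * (p.[t^-1] - p^`().[t^-1]) * expR (- t^-1)).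
  by field.
- have -> : flat_poly ('X ^+ 2 * (p - p^`())) 0 = 0 by rewrite /flat_poly ltxx.
  have [C C0 hC] := flat_poly_bound p.
  suff h : h^-1 *: (flat_poly p (h *: (1:R) + 0) - flat_poly p 0) @[h --> (0:R)^'] --> (0:R).
    by apply: DeriveDef; [apply/cvg_ex; exists 0|exact: cvg_lim].
  apply/cvgrPdist_le => e e0; near=> s.
  rewrite [_ *: (1:R)]mulr1 addr0 {2}/flat_poly ltxx subr0 sub0r normrN.
  rewrite [_ *: _]/(_ * _) normrM.
  have [s0|s0] := leP s 0.
    by rewrite /flat_poly ltNge s0/= normr0 mulr0 ltW.
  have s1 : s <= 1.
    apply: le_trans (ler_norm s) _; near: s; apply: dnbhs0_le; exact: ltr01.
  rewrite normfV ler_pdivrMl ?normr_gt0 ?gt_eqF//.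
  have /le_trans -> // : `|flat_poly p s| <= C * s ^+ 2 by apply: hC; rewrite s0.
  rewrite gtr0_norm// expr2 mulrCA ler_wpM2l ?(ltW s0)//.
  have : s <= e / (C + 1).
    apply: le_trans (ler_norm s) _; near: s; apply: dnbhs0_le.
    by rewrite divr_gt0// ltr_wpDl.
  rewrite ler_pdivlMr ?ltr_wpDl// => h; apply: le_trans h.
  by rewrite mulrC ler_wpM2l ?(ltW s0)// lerDl.
Unshelve. all: by end_near.
Qed.

Definition flat (t : R) : R := flat_poly 1 t.

Lemma flat_ge0 t : 0 <= flat t.
Proof. by rewrite /flat /flat_poly; case: ifP => //; rewrite hornerE mul1r expR_ge0. Qed.

Lemma flat_gt0 t : 0 < t -> 0 < flat t.
Proof. by rewrite /flat /flat_poly => ->; rewrite hornerE mul1r expR_gt0. Qed.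

Lemma flat_le1 t : flat t <= 1.
Proof.
rewrite /flat /flat_poly; case: ifP => // t0.
by rewrite hornerE mul1r -expR0 ler_expR oppr_le0 invr_ge0 ltW.
Qed.

Lemma flat_le0 t : t <= 0 -> flat t = 0.
Proof. by rewrite /flat /flat_poly ltNge => ->. Qed.

Lemma smooth_on_flat n (U : set 'rV[R]_n) (f : 'rV[R]_n -> R) : open U ->
  smooth_on U f -> smooth_on U (fun x => flat (f x)).
Proof.
move=> Uo; apply: (@smooth_on_comp1 _ _ (fun q => exists p, q = flat_poly p)) => //.
- move=> _ [p ->]; exists (flat_poly ('X ^+ 2 * (p - p^`()))).
    by exists ('X ^+ 2 * (p - p^`())).
  by move=> x; exact: is_derive_flat_poly.
- by exists 1.
Qed.

(** A product over the coordinates, so that the supports are cubes. *)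
Definition bump_fun n (y0 : 'rV[R]_n) (r : R) (y : 'rV[R]_n) : R :=
  \prod_j flat (1 - ((y 0 j - y0 0 j) / r) ^+ 2).

Lemma smooth_bump n (y0 : 'rV[R]_n) r : smooth_on setT (bump_fun y0 r).
Proof.
have oT : open [set: 'rV[R]_n] by exact: openT.
apply: smooth_on_prod => // j _; apply: smooth_on_flat => //.
apply: smooth_onD => //; first exact: smooth_on_cst.
have h : smooth_on setT (fun y : 'rV[R]_n => r^-1 * (y 0 j + - y0 0 j)).
  apply: smooth_onZ => //; apply: smooth_onD => //.
    exact: smooth_on_coord.
  exact: smooth_on_cst.
apply: smooth_on_ext (smooth_onZ (-1) oT (smooth_onM oT h h)) => // y _.
by rewrite mulN1r expr2 ![r^-1 * _]mulrC.
Qed.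

Lemma bump_ge0 n (y0 : 'rV[R]_n) r y : 0 <= bump_fun y0 r y.
Proof. by apply: prodr_ge0 => j _; exact: flat_ge0. Qed.

Lemma bump_le1 n (y0 : 'rV[R]_n) r y : bump_fun y0 r y <= 1.
Proof. by apply: prodr_ile1 => j _; rewrite flat_ge0 flat_le1. Qed.

Lemma bump_gt0 n (y0 : 'rV[R]_n) r : 0 < bump_fun y0 r y0.
Proof. by apply: prodr_gt0 => j _; apply: flat_gt0; rewrite subrr mul0r expr0n subr0. Qed.

Lemma bump_eq0 n (y0 y : 'rV[R]_n) (r : R) j : 0 < r -> r <= `|y 0 j - y0 0 j| ->
  bump_fun y0 r y = 0.
Proof.
move=> r0 h; rewrite /bump_fun (bigD1 j)//= flat_le0 ?mul0r//.
rewrite subr_le0 -real_normK ?num_real// normrM normfV (gtr0_norm r0).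
by rewrite expr_ge1 ?divr_ge0 ?(ltW r0)// ler_pdivlMr// mul1r.
Qed.
End Bump.

(** * Complex-valued smooth functions and plane waves *)

Section SmoothOnC.
Context {R : realType} {n : nat}.
Local Notation C := R[i].
Implicit Types (U : set 'rV[R]_n) (f g : 'rV[R]_n -> C).

Lemma smooth_onC_ext U f g : open U -> (forall x, U x -> f x = g x) ->
  smooth_onC U f -> smooth_onC U g.
Proof.
move=> Uo fg [h1 h2]; split.
- by apply: smooth_on_ext h1 => // x Ux; rewrite fg.
- by apply: smooth_on_ext h2 => // x Ux; rewrite fg.
Qed.

Lemma smooth_onC_cst U (a : C) : smooth_onC U (fun=> a).
Proof. by split; exact: smooth_on_cst. Qed.

Lemma smooth_onC_real U (f : 'rV[R]_n -> R) : smooth_on U f ->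
  smooth_onC U (fun x => (f x)%:C%C).
Proof. by move=> h; split; [exact: h|exact: smooth_on_cst]. Qed.

Lemma cReD (x y : C) : complex.Re (x + y) = complex.Re x + complex.Re y.
Proof. by case: x; case: y. Qed.
Lemma cImD (x y : C) : complex.Im (x + y) = complex.Im x + complex.Im y.
Proof. by case: x; case: y. Qed.
Lemma cReM (x y : C) : complex.Re (x * y) =
  complex.Re x * complex.Re y - complex.Im x * complex.Im y.
Proof. by case: x; case: y. Qed.
Lemma cImM (x y : C) : complex.Im (x * y) =
  complex.Re x * complex.Im y + complex.Im x * complex.Re y.
Proof. by case: x => a b; case: y. Qed.

Lemma smooth_onCD U f g : open U -> smooth_onC U f -> smooth_onC U g ->
  smooth_onC U (fun x => f x + g x).
Proof.
move=> Uo [f1 f2] [g1 g2]; split.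
- by apply: smooth_on_ext (smooth_onD Uo f1 g1) => // x _; rewrite cReD.
- by apply: smooth_on_ext (smooth_onD Uo f2 g2) => // x _; rewrite cImD.
Qed.

Lemma smooth_onCM U f g : open U -> smooth_onC U f -> smooth_onC U g ->
  smooth_onC U (fun x => f x * g x).
Proof.
move=> Uo [f1 f2] [g1 g2]; split.
- apply: smooth_on_ext (smooth_onD Uo (smooth_onM Uo f1 g1)
    (smooth_onZ (-1) Uo (smooth_onM Uo f2 g2))) => // x _.
  by rewrite cReM mulN1r.
- apply: smooth_on_ext (smooth_onD Uo (smooth_onM Uo f1 g2)
    (smooth_onM Uo f2 g1)) => // x _.
  by rewrite cImM.
Qed.

Lemma smooth_onC_sum U I (s : seq I) (P : pred I) (F : I -> 'rV[R]_n -> C) :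
  open U -> (forall i, P i -> smooth_onC U (F i)) ->
  smooth_onC U (fun x => \sum_(i <- s | P i) F i x).
Proof.
move=> Uo h; elim: s => [|i s IH].
  by apply: smooth_onC_ext (smooth_onC_cst U 0) => // x _; rewrite big_nil.
have [Pi|Pi] := boolP (P i).
  apply: smooth_onC_ext (smooth_onCD Uo (h i Pi) IH) => // x _.
  by rewrite big_cons Pi.
by apply: smooth_onC_ext IH => // x _; rewrite big_cons (negbTE Pi).
Qed.

Lemma smooth_onC_partial U f j : smooth_onC U f -> smooth_onC U (partialC j f).
Proof. by move=> [h1 h2]; split; exact: smooth_on_partial. Qed.

Lemma smooth_onC_local U f :
  (forall x, U x -> exists2 W : set 'rV[R]_n, W x & smooth_onC W f) ->
  smooth_onC U f.
Proof.
move=> h; split; apply: smooth_on_local => x Ux; have [W Wx [h1 h2]] := h x Ux;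
by exists W.
Qed.

Lemma smooth_onC_comp k U (U' : set 'rV[R]_k) (f : 'rV[R]_k -> C)
    (G : 'rV[R]_n -> 'rV[R]_k) : open U -> open U' ->
  (forall y, U y -> U' (G y)) -> smooth_onC U' f ->
  (forall j, smooth_on U (fun y => G y 0 j)) -> smooth_onC U (fun y => f (G y)).
Proof.
move=> Uo Uo' UG [/smooth_onP h1 /smooth_onP h2] HG.
split; apply/smooth_onP => r.
- apply: (cdiff_comp (f := fun y => complex.Re (f y)) Uo Uo' UG) => // j.
  by have /smooth_onP := HG j; exact.
- apply: (cdiff_comp (f := fun y => complex.Im (f y)) Uo Uo' UG) => // j.
  by have /smooth_onP := HG j; exact.
Qed.

Definition wave (xi y : 'rV[R]_n) : C := expi (dotp xi y).

Lemma smooth_dotp U (xi : 'rV[R]_n) : open U -> smooth_on U (dotp xi).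
Proof.
move=> Uo; apply: smooth_on_sum => // j _; apply: smooth_onZ => //.
exact: smooth_on_coord.
Qed.

Lemma smooth_wave U xi : open U -> smooth_onC U (wave xi).
Proof. by move=> Uo; have [h1 h2] := smooth_on_trig Uo (smooth_dotp xi Uo); split. Qed.

Lemma partialC_ext U f g j y : open U -> U y -> (forall x, U x -> f x = g x) ->
  partialC j f y = partialC j g y.
Proof.
move=> Uo Uy fg; rewrite /partialC /partial.
have nfg : \forall z \near y, f z = g z.
  by apply: filterS (open_near Uo Uy) => z; exact: fg.
by congr (_ +i* _)%C; apply: near_eq_derive; apply: filterS nfg => z ->.
Qed.

Lemma foldr_partialC_ext U f g s y : open U -> U y ->
  (forall x, U x -> f x = g x) -> foldr partialC f s y = foldr partialC g s y.
Proof.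
move=> Uo Uy fg; elim: s y Uy => [|j s IH] y Uy /=; first exact: fg.
exact: partialC_ext Uo Uy IH.
Qed.

Lemma foldr_smooth_onC U f s : smooth_onC U f -> smooth_onC U (foldr partialC f s).
Proof. by move=> h; elim: s => [|j s IH]; [exact: h|exact: smooth_onC_partial]. Qed.

Lemma partialCD U f g j y : U y -> smooth_onC U f -> smooth_onC U g ->
  partialC j (fun x => f x + g x) y = partialC j f y + partialC j g y.
Proof.
move=> Uy [f1 f2] [g1 g2]; rewrite /partialC /partial.
have d h : smooth_on U h -> derivable h y (basis_vec j).
  by move=> hh; exact: smooth_on_derivable hh Uy.
under [X in ('D__ X _ +i* _)%C]eq_fun do rewrite cReD.
under [X in (_ +i* 'D__ X _)%C]eq_fun do rewrite cImD.
by rewrite (deriveD (d _ f1) (d _ g1)) (deriveD (d _ f2) (d _ g2)).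
Qed.

Lemma partialCM U f g j y : U y -> smooth_onC U f -> smooth_onC U g ->
  partialC j (fun x => f x * g x) y = partialC j f y * g y + f y * partialC j g y.
Proof.
move=> Uy [f1 f2] [g1 g2]; rewrite /partialC /partial.
have d h : smooth_on U h -> derivable h y (basis_vec j).
  by move=> hh; exact: smooth_on_derivable hh Uy.
under [X in ('D__ X _ +i* _)%C]eq_fun do rewrite cReM.
under [X in (_ +i* 'D__ X _)%C]eq_fun do rewrite cImM.
rewrite (deriveB (derivableM (d _ f1) (d _ g1)) (derivableM (d _ f2) (d _ g2))).
rewrite (deriveD (derivableM (d _ f1) (d _ g2)) (derivableM (d _ f2) (d _ g1))).
rewrite (deriveM (d _ f1) (d _ g1)) (deriveM (d _ f2) (d _ g2)).
rewrite (deriveM (d _ f1) (d _ g2)) (deriveM (d _ f2) (d _ g1)).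
apply/eqP; rewrite eq_complex cReD cImD !cReM !cImM /=; apply/andP.
by split; apply/eqP; rewrite /GRing.scale/=; ring.
Qed.

Lemma partialC_cst (a : C) j (y : 'rV[R]_n) : partialC j (fun=> a) y = 0.
Proof. by rewrite /partialC /partial !derive_cst. Qed.

Lemma derive_comp1 (p : R -> R) (f : 'rV[R]_n -> R) y v (a : R) :
  differentiable f y -> is_derive (f y) 1 p a ->
  'D_v (fun x => p (f x)) y = a * 'D_v f y.
Proof.
move=> df [dp pa].
have dp' : differentiable p (f y) by apply/derivable1_diffP.
rewrite deriveE; last exact: (@differentiable_comp _ _ _ _ f p).
by rewrite (diff_comp df dp')/= -(deriveE _ df) diff1E// derive1E pa mulrC.
Qed.

Lemma dotpC (u v : 'rV[R]_n) : dotp u v = dotp v u.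
Proof. by apply: eq_bigr => j _; rewrite mulrC. Qed.

Lemma dotp_basis (u : 'rV[R]_n) j : dotp u (basis_vec j) = u 0 j.
Proof.
rewrite /dotp (bigD1 j)//= mxE !eqxx mulr1 big1 ?addr0// => k /negbTE kj.
by rewrite mxE eqxx kj mulr0.
Qed.

Lemma partialC_wave xi j y : partialC j (wave xi) y = 'i%C * (xi 0 j)%:C%C * wave xi y.
Proof.
have L : dotp xi = dot_form xi by apply/funext => z; rewrite dotpC.
have df : differentiable (dotp xi) y.
  rewrite L; apply: (@linear_differentiable R 'rV[R]_n R^o).
  exact: dot_form_continuous.
have dd : 'D_(basis_vec j) (dotp xi) y = xi 0 j.
  rewrite deriveE// L (@diff_lin R 'rV[R]_n R^o); last exact: dot_form_continuous.
  by change (dotp (basis_vec j) xi = xi 0 j); rewrite dotpC dotp_basis.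
rewrite /partialC /partial /wave /expi /=.
rewrite (derive_comp1 _ df (is_derive_cos (dotp xi y))).
rewrite (derive_comp1 _ df (is_derive_sin (dotp xi y))) dd.
apply/eqP; rewrite eq_complex !cReM !cImM /=; apply/andP.
by split; apply/eqP; ring.
Qed.
End SmoothOnC.

(** * Charts, extension by zero and differential operators *)

Section Manifold.
Context {R : realType} {n : nat} {M : ptopologicalType}.
Context (S : smooth_structure R n M).
Local Notation C := R[i].
Local Notation V := 'rV[R]_n.

Section OneChart.
Context (c : chart R n M) (cS : charts S c).

Lemma chart_open_dom : open (dom c). Proof. by have [] := charts_chart cS. Qed.
Lemma chart_open_img : open (img c). Proof. by have [] := charts_chart cS. Qed.
Lemma chart_phiK x : dom c x -> psi c (phi c x) = x.
Proof. by have [_ _ h _ _] := charts_chart cS; exact: h. Qed.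
Lemma chart_phi_continuous x : dom c x -> {for x, continuous (phi c)}.
Proof. by have [_ _ _ h _] := charts_chart cS; exact: h. Qed.
Lemma chart_psi_continuous y : img c y -> {for y, continuous (psi c)}.
Proof. by have [_ _ _ _ h] := charts_chart cS; exact: h. Qed.
Lemma img_phi x : dom c x -> img c (phi c x). Proof. by move=> h; exists x. Qed.
Lemma dom_psi y : img c y -> dom c (psi c y).
Proof. by move=> [x hx <-]; rewrite chart_phiK. Qed.
Lemma chart_psiK y : img c y -> phi c (psi c y) = y.
Proof. by move=> [x hx <-]; rewrite chart_phiK. Qed.

Lemma open_psi_preimage (O : set M) : open O ->
  open [set y | img c y /\ O (psi c y)].
Proof.
move=> Oo; rewrite openE => y [iy Oy]; apply: filterI.
  exact: open_near chart_open_img iy.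
by apply: (chart_psi_continuous iy); exact: open_nbhs_nbhs.
Qed.

Lemma open_phi_preimage (O : set V) : open O ->
  open [set x | dom c x /\ O (phi c x)].
Proof.
move=> Oo; rewrite openE => x [dx Ox]; apply: filterI.
  by apply: open_nbhs_nbhs; split => //; exact: chart_open_dom.
by apply: (chart_phi_continuous dx); exact: open_nbhs_nbhs.
Qed.
End OneChart.

Lemma smooth_fun_continuous (u : M -> C) x : smooth_fun S u ->
  {for x, continuous (fun x => complex.Re (u x))} /\
  {for x, continuous (fun x => complex.Im (u x))}.
Proof.
move=> su; have [c cS dx] := charts_cover S x.
have [h1 h2] := su c cS; have iy := img_phi dx.
have nx : \forall z \near x, psi c (phi c z) = z.
  have : nbhs x (dom c) by apply: open_nbhs_nbhs; split => //; exact: chart_open_dom.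
  by apply: filterS => z; exact: chart_phiK.
split.
- have hc : {for x, continuous (fun z => complex.Re (u (psi c (phi c z))))}.
    apply: (@continuous_comp _ _ _ (phi c) (fun y => complex.Re (u (psi c y)))).
      exact: chart_phi_continuous.
    exact: smooth_on_continuous h1 iy.
  by apply: continuous_for_ext hc; apply: filterS nx => z ->.
- have hc : {for x, continuous (fun z => complex.Im (u (psi c (phi c z))))}.
    apply: (@continuous_comp _ _ _ (phi c) (fun y => complex.Im (u (psi c y)))).
      exact: chart_phi_continuous.
    exact: smooth_on_continuous h2 iy.
  by apply: continuous_for_ext hc; apply: filterS nx => z ->.
Qed.

Lemma smooth_fun_cst (a : C) : smooth_fun S (fun=> a).
Proof. by move=> c cS; exact: smooth_onC_cst. Qed.

Lemma smooth_funD u v : smooth_fun S u -> smooth_fun S v ->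
  smooth_fun S (fun x => u x + v x).
Proof.
by move=> hu hv c cS; apply: (smooth_onCD (chart_open_img cS)); [exact: hu|exact: hv].
Qed.

Lemma smooth_funM u v : smooth_fun S u -> smooth_fun S v ->
  smooth_fun S (fun x => u x * v x).
Proof.
by move=> hu hv c cS; apply: (smooth_onCM (chart_open_img cS)); [exact: hu|exact: hv].
Qed.

Lemma smooth_funZ (a : C) u : smooth_fun S u -> smooth_fun S (fun x => a * u x).
Proof. by move=> su; exact: (smooth_funM (smooth_fun_cst a) su). Qed.

Definition ext_fun (c : chart R n M) (F : V -> C) (x : M) : C :=
  if `[< dom c x >] then F (phi c x) else 0.

Lemma ext_fun_dom c F x : dom c x -> ext_fun c F x = F (phi c x).
Proof. by move=> dx; rewrite /ext_fun; case: asboolP. Qed.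

Lemma ext_fun_psi c F y : charts S c -> img c y -> ext_fun c F (psi c y) = F y.
Proof. by move=> cS iy; rewrite ext_fun_dom ?chart_psiK//; exact: dom_psi. Qed.

Lemma ext_fun_out c (F : V -> C) (K : set V) x :
  (forall y, ~ K y -> F y = 0) -> ~ (dom c x /\ K (phi c x)) -> ext_fun c F x = 0.
Proof.
move=> F0 nx; rewrite /ext_fun; case: asboolP => // dx.
by apply: F0 => Kx; apply: nx.
Qed.

Section ExtFun.
Context (c : chart R n M) (cS : charts S c) (K : set V).
Hypothesis Mh : hausdorff_space M.
Hypothesis Kc : compact K.
Hypothesis KU : K `<=` img c.

Lemma psi_compact : compact (psi c @` K).
Proof.
apply: continuous_compact => //; apply: continuous_in_subspaceT => y.
by rewrite inE => /KU; exact: chart_psi_continuous.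
Qed.

Lemma psi_closed : closed (psi c @` K).
Proof. by apply: compact_closed => //; exact: psi_compact. Qed.

Lemma notin_psiK x : ~ (psi c @` K) x -> ~ (dom c x /\ K (phi c x)).
Proof. by move=> h [dx Kx]; apply: h; exists (phi c x) => //; exact: chart_phiK. Qed.

(** In another chart the extension is, near each point, either a composition
    with a transition map or zero: the image in M of the compact set K is
    closed, as M is Hausdorff. *)
Lemma smooth_ext_fun (F : V -> C) : smooth_onC (img c) F ->
  (forall y, ~ K y -> F y = 0) -> smooth_fun S (ext_fun c F).
Proof.
move=> sF F0 c' c'S; apply: smooth_onC_local => y iy.
have [dy|ndy] := pselect (dom c (psi c' y)).
- pose W := [set z | img c' z /\ dom c (psi c' z)].
  have Wo : open W by apply: open_psi_preimage => //; exact: chart_open_dom.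
  exists W => //.
  have h : smooth_onC W (fun z => F (phi c (psi c' z))).
    apply: (smooth_onC_comp (G := fun z => phi c (psi c' z)) Wo (chart_open_img cS) _ sF).
      by move=> z [_ dz]; exact: img_phi.
    move=> j; have [h _] := charts_compatible c'S cS.
    apply: smooth_onS (h j) => z [iz dz]; exists (psi c' z); last exact: chart_psiK.
    by split => //; exact: dom_psi.
  by apply: smooth_onC_ext h => // z [_ dz]; rewrite ext_fun_dom.
- pose W := [set z | img c' z /\ (~` (psi c @` K)) (psi c' z)].
  have Wo : open W.
    by apply: open_psi_preimage => //; apply: closed_openC; exact: psi_closed.
  have Wy : W y.
    by split => // -[z Kz zy]; apply: ndy; rewrite -zy; apply: dom_psi => //; exact: KU.
  exists W => //.
  apply: smooth_onC_ext (smooth_onC_cst W 0) => // z [_ hz].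
  by rewrite (ext_fun_out F0)//; exact: notin_psiK.
Qed.
End ExtFun.

Section Operator.
Context (m : nat) (P : diffop S m).

Lemma smooth_dop u : smooth_fun S u -> smooth_fun S (P u).
Proof.
move=> su c cS; have oU := chart_open_img cS.
apply: (smooth_onC_ext oU (f := fun y => \sum_(a : multi_index m | (mi_length a <= m)%N)
  coef P c a y * mi_D a (fun z => u (psi c z)) y)).
  by move=> y iy; rewrite (dopE P cS su iy).
apply: smooth_onC_sum => // a _; apply: smooth_onCM => //.
  exact: coef_smooth.
apply: smooth_onCM => //; first exact: smooth_onC_cst.
exact: foldr_smooth_onC (su c cS).
Qed.

Lemma foldr_partialC_lin U (a : C) (f g : V -> C) s y : open U -> U y ->
  smooth_onC U f -> smooth_onC U g ->
  foldr partialC (fun x => a * f x + g x) s y =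
  a * foldr partialC f s y + foldr partialC g s y.
Proof.
move=> oU Uy sf sg; elim: s y Uy => [|j s IH] y Uy //=.
rewrite (partialC_ext j oU Uy IH).
have h1 : smooth_onC U (foldr partialC f s) by exact: foldr_smooth_onC.
have h2 : smooth_onC U (foldr partialC g s) by exact: foldr_smooth_onC.
have h0 := smooth_onC_cst U a.
rewrite (partialCD j Uy (smooth_onCM oU h0 h1) h2) (partialCM j Uy h0 h1).
by rewrite partialC_cst mul0r add0r.
Qed.

(** Linearity is read off from the expression of P in the charts. *)
Lemma dop_lin (a : C) u v : smooth_fun S u -> smooth_fun S v ->
  forall x, P (fun x => a * u x + v x) x = a * P u x + P v x.
Proof.
move=> su sv x; have [c cS dx] := charts_cover S x.
have suv : smooth_fun S (fun x => a * u x + v x).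
  exact: (smooth_funD (smooth_funZ a su) sv).
have iy := img_phi dx; rewrite -(chart_phiK cS dx).
rewrite (dopE P cS suv iy) (dopE P cS su iy) (dopE P cS sv iy) mulr_sumr -big_split/=.
apply: eq_bigr => b _; rewrite /mi_D /mi_partialC.
rewrite (foldr_partialC_lin a _ (chart_open_img cS) iy (su c cS) (sv c cS)).
by ring.
Qed.

Lemma dop_local (W : set M) u v x : open W -> W x -> smooth_fun S u ->
  smooth_fun S v -> (forall z, W z -> u z = v z) -> P u x = P v x.
Proof.
move=> oW Wx su sv uv; have [c cS dx] := charts_cover S x.
have iy := img_phi dx; rewrite -(chart_phiK cS dx).
rewrite (dopE P cS su iy) (dopE P cS sv iy); apply: eq_bigr => b _.
rewrite /mi_D /mi_partialC; congr (_ * (_ * _)).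
apply: (foldr_partialC_ext _ (open_psi_preimage cS oW)).
  by split => //; rewrite chart_phiK.
by move=> y [_ Wy]; exact: uv.
Qed.

Lemma dop0 x : P (fun=> 0) x = 0.
Proof.
have := dop_lin (-1) (smooth_fun_cst 0) (smooth_fun_cst 0) x.
have -> : (fun x0 : M => -1 * (fun=> 0) x0 + (fun=> 0) x0) = fun=> 0 :> C.
  by apply/funext => z; rewrite mulr0 addr0.
by rewrite mulN1r addNr.
Qed.

Lemma dop_ext_fun_out (c : chart R n M) (K : set V) (F : V -> C) x : charts S c ->
  hausdorff_space M -> compact K -> K `<=` img c -> smooth_onC (img c) F ->
  (forall y, ~ K y -> F y = 0) -> ~ (dom c x /\ K (phi c x)) ->
  P (ext_fun c F) x = 0.
Proof.
move=> cS Mh Kc KU sF F0 nx.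
rewrite -(dop0 x); apply: (@dop_local (~` (psi c @` K))).
- by apply: closed_openC; exact: psi_closed.
- move=> -[y Ky yx]; apply: nx; rewrite -yx; split.
    by apply: dom_psi => //; exact: KU.
  by rewrite chart_psiK//; exact: KU.
- exact: smooth_ext_fun Kc KU _ sF F0.
- exact: smooth_fun_cst.
- by move=> z hz; rewrite (ext_fun_out F0)//; exact: notin_psiK.
Qed.
End Operator.
End Manifold.

(** * Differential operators on modulated waves *)

Section LowerSymbol.
Context {R : realType} {n : nat}.
Local Notation C := R[i].
Local Notation V := 'rV[R]_n.

Definition ximono (t : seq 'I_n) (xi : V) : C := \prod_(j <- t) ('i%C * (xi 0 j)%:C%C).

Section Supported.
Context (U K : set V) (oU : open U) (cK : closed K).

Definition coefficient (b : V -> C) : Prop :=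
  smooth_onC U b /\ forall y, ~ K y -> b y = 0.

(** The lower-order part of P (b e) for a plane wave e is needed only in this
    qualitative form; an inductive predicate describes such finite sums
    without naming their terms. *)
Inductive lower_symbol (d : nat) : (V -> V -> C) -> Prop :=
| lower_nil : lower_symbol d (fun _ _ => 0)
| lower_cons t b L : (size t < d)%N -> coefficient b -> lower_symbol d L ->
    lower_symbol d (fun xi y => ximono t xi * b y + L xi y).

Lemma coefficient_partial b j : coefficient b -> coefficient (partialC j b).
Proof.
move=> [sb b0]; split; first exact: smooth_onC_partial.
move=> y Ky; rewrite (partialC_ext j (closed_openC cK) Ky (g := fun=> 0)).
  exact: partialC_cst.
by move=> z; exact: b0.
Qed.

Lemma coefficientM a b : smooth_onC U a -> coefficient b ->
  coefficient (fun y => a y * b y).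
Proof.
move=> sa [sb b0]; split; first exact: smooth_onCM.
by move=> y /b0 ->; rewrite mulr0.
Qed.

Lemma lower_symbol_ext d L L' : (forall xi y, L xi y = L' xi y) ->
  lower_symbol d L -> lower_symbol d L'.
Proof. by move=> h; have -> : L = L' by apply/funext => xi; apply/funext => y. Qed.

Lemma lower_symbol1 d t b : (size t < d)%N -> coefficient b ->
  lower_symbol d (fun xi y => ximono t xi * b y).
Proof.
move=> td hb; apply: lower_symbol_ext (lower_cons td hb (lower_nil d)) => xi y.
by rewrite addr0.
Qed.

Lemma lower_symbolD d L L' : lower_symbol d L -> lower_symbol d L' ->
  lower_symbol d (fun xi y => L xi y + L' xi y).
Proof.
move=> h h'; elim: h => [|t b L0 td hb hL IH].
  by apply: lower_symbol_ext h' => xi y; rewrite add0r.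
by apply: lower_symbol_ext (lower_cons td hb IH) => xi y; rewrite addrA.
Qed.

Lemma lower_symbol_sum d (I : Type) (s : seq I) (Q : pred I) (F : I -> V -> V -> C) :
  (forall i, Q i -> lower_symbol d (F i)) ->
  lower_symbol d (fun xi y => \sum_(i <- s | Q i) F i xi y).
Proof.
move=> h; elim: s => [|i s IH].
  by apply: lower_symbol_ext (lower_nil d) => xi y; rewrite big_nil.
have [Qi|Qi] := boolP (Q i).
  by apply: lower_symbol_ext (lower_symbolD (h i Qi) IH) => xi y; rewrite big_cons Qi.
by apply: lower_symbol_ext IH => xi y; rewrite big_cons (negbTE Qi).
Qed.

Lemma lower_symbol_leq d d' L : (d <= d')%N -> lower_symbol d L -> lower_symbol d' L.
Proof.
move=> dd; elim=> [|t b L0 td hb hL IH]; first exact: lower_nil.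
by apply: lower_cons => //; exact: leq_trans td dd.
Qed.

Lemma lower_symbolM d a L : smooth_onC U a -> lower_symbol d L ->
  lower_symbol d (fun xi y => a y * L xi y).
Proof.
move=> sa; elim=> [|t b L0 td hb hL IH].
  by apply: lower_symbol_ext (lower_nil d) => xi y; rewrite mulr0.
apply: lower_symbol_ext (lower_cons td (coefficientM sa hb) IH) => xi y.
by rewrite mulrDr mulrCA.
Qed.

Lemma lower_symbol_xi d j L : lower_symbol d L ->
  lower_symbol d.+1 (fun xi y => 'i%C * (xi 0 j)%:C%C * L xi y).
Proof.
elim=> [|t b L0 td hb hL IH].
  by apply: lower_symbol_ext (lower_nil _) => xi y; rewrite mulr0.
apply: lower_symbol_ext (lower_cons (t := j :: t) _ hb IH) => [xi y|//].
by rewrite /ximono big_cons mulrDr !mulrA.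
Qed.

Lemma lower_symbol_smooth d L xi : lower_symbol d L -> smooth_onC U (L xi).
Proof.
elim=> [|t b L0 td [hb _] hL IH]; first exact: smooth_onC_cst.
exact: (smooth_onCD oU (smooth_onCM oU (smooth_onC_cst _ _) hb) IH).
Qed.

Lemma lower_symbol_partial d j L : lower_symbol d L -> exists2 L', lower_symbol d L' &
  forall xi y, U y -> partialC j (L xi) y = L' xi y.
Proof.
elim=> [|t b L0 td hb hL [L' hL' E]].
  by exists (fun _ _ => 0) => [|xi y _]; [exact: lower_nil|exact: partialC_cst].
exists (fun xi y => ximono t xi * partialC j b y + L' xi y).
  by apply: lower_cons => //; exact: coefficient_partial.
move=> xi y Uy; rewrite (partialCD j Uy _ (lower_symbol_smooth xi hL)).
  rewrite (partialCM j Uy (smooth_onC_cst U _) hb.1) partialC_cst mul0r add0r.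
  by rewrite E.
by apply: smooth_onCM => //; [exact: smooth_onC_cst|exact: hb.1].
Qed.

(** A derivative that falls on the wave multiplies by a component of xi; one
    that falls on the amplitude loses a power of xi and goes to the
    lower-order part. *)
Lemma foldr_partialC_wave b s : coefficient b ->
  exists2 L, lower_symbol (size s) L & forall xi y, U y ->
    foldr partialC (fun z => b z * wave xi z) s y =
    (ximono s xi * b y + L xi y) * wave xi y.
Proof.
move=> hb; elim: s => [|j s [L hL E]].
  exists (fun _ _ => 0); first exact: lower_nil.
  by move=> xi y _ /=; rewrite /ximono big_nil mul1r addr0.
have [L1 hL1 E1] := lower_symbol_partial j hL.
exists (fun xi y => ximono s xi * partialC j b y +
   (L1 xi y + 'i%C * (xi 0 j)%:C%C * L xi y)).
  apply: lower_cons => //; first exact: coefficient_partial.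
  by apply: lower_symbolD; [exact: lower_symbol_leq hL1|exact: lower_symbol_xi].
move=> xi y Uy /=; rewrite (partialC_ext j oU Uy (E xi)).
have sw : smooth_onC U (wave xi) by exact: smooth_wave.
have sL := lower_symbol_smooth xi hL.
have sm : smooth_onC U (fun z => ximono s xi * b z).
  exact: (smooth_onCM oU (smooth_onC_cst U _) hb.1).
rewrite (partialCM j Uy (smooth_onCD oU sm sL) sw) (partialCD j Uy sm sL).
rewrite (partialCM j Uy (smooth_onC_cst U _) hb.1) partialC_cst partialC_wave E1//.
rewrite /ximono big_cons; ring.
Qed.
End Supported.

Definition mi_seq m (a : @multi_index n m) : seq 'I_n :=
  flatten [seq nseq (a j) j | j <- enum 'I_n].

Lemma size_mi_seq m (a : @multi_index n m) : size (mi_seq a) = mi_length a.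
Proof.
rewrite /mi_seq size_flatten /shape -map_comp sumnE big_map big_enum /=.
by apply: eq_bigr => j _; rewrite size_nseq.
Qed.

Lemma mi_monomial_ximono m (a : @multi_index n m) (xi : V) :
  ximono (mi_seq a) xi = 'i%C ^+ mi_length a * mi_monomial a xi.
Proof.
rewrite /ximono /mi_seq big_flatten big_map.
rewrite (eq_bigr (fun j => 'i%C ^+ a j * ((xi 0 j)%:C%C) ^+ a j)); last first.
  by move=> j _; rewrite big_nseq iter_mulr_1 exprMn.
rewrite big_split /= !big_enum /=; congr (_ * _).
  by rewrite prodrXr.
by rewrite /mi_monomial rmorph_prod; apply: eq_bigr => j _; rewrite rmorphXn.
Qed.
End LowerSymbol.

Section OperatorOnWaves.
Context {R : realType} {n : nat} {M : ptopologicalType}.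
Context (S : smooth_structure R n M).
Local Notation C := R[i].
Local Notation V := 'rV[R]_n.
Context (m : nat) (P : diffop S m) (c : chart R n M) (cS : charts S c) (K : set V).
Hypothesis Mh : hausdorff_space M.
Hypothesis Kc : compact K.
Hypothesis KU : K `<=` img c.

(** All derivatives in P are computed here, once and for all: on modulated
    waves P acts by its principal symbol, up to lower order in xi. *)
Lemma dop_wave (b : V -> C) : coefficient (img c) K b ->
  exists2 L, lower_symbol (img c) K m L & forall xi y, img c y ->
    P (ext_fun c (fun z => b z * wave xi z)) (psi c y) =
    (principal_symbol P c y xi * b y + L xi y) * wave xi y.
Proof.
move=> hb; have oU := chart_open_img cS.
have cK : closed K := compact_closed (@norm_hausdorff _ _) Kc.
have hL (a : @multi_index n m) := cid2 (foldr_partialC_wave oU cK (mi_seq a) hb).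
pose La a := s2val (hL a).
have hLa a : lower_symbol (img c) K (mi_length a) (La a).
  by rewrite -size_mi_seq /La; case: (hL a).
have Ea a xi y : img c y -> mi_partialC a (fun z => b z * wave xi z) y =
    (ximono (mi_seq a) xi * b y + La a xi y) * wave xi y.
  by rewrite /La; case: (hL a) => L ? h /=; exact: h.
pose k (a : @multi_index n m) : C := (- 'i%C) ^+ mi_length a.
pose T a xi y : C := coef P c a y * k a * (ximono (mi_seq a) xi * b y).
pose L xi y : C := \sum_(a : @multi_index n m | (mi_length a < m)%N) T a xi y +
   \sum_(a : @multi_index n m | (mi_length a <= m)%N) coef P c a y * k a * La a xi y.
have sk a : smooth_onC (img c) (fun y => coef P c a y * k a).
  by apply: smooth_onCM => //; [exact: coef_smooth|exact: smooth_onC_cst].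
exists L.
  apply: lower_symbolD.
    apply: lower_symbol_sum => a am; apply: lower_symbolM => //.
    by apply: lower_symbol1 => //; rewrite size_mi_seq.
  apply: lower_symbol_sum => a am; apply: lower_symbolM => //.
  exact: lower_symbol_leq (hLa a).
move=> xi y iy.
have sF : smooth_onC (img c) (fun z => b z * wave xi z).
  by apply: smooth_onCM => //; [exact: hb.1|exact: smooth_wave].
have F0 z : ~ K z -> b z * wave xi z = 0 by move=> /hb.2 ->; rewrite mul0r.
have sE := smooth_ext_fun cS Mh Kc KU sF F0.
rewrite (dopE P cS sE iy).
transitivity (\sum_(a : @multi_index n m | (mi_length a <= m)%N)
   (T a xi y + coef P c a y * k a * La a xi y) * wave xi y).
  apply: eq_bigr => a _; rewrite /mi_D /mi_partialC.
  rewrite (foldr_partialC_ext (g := fun z => b z * wave xi z) _ oU iy); last first.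
    by move=> z iz; exact: (ext_fun_psi _ cS iz).
  rewrite -/(mi_partialC a (fun z => b z * wave xi z)) Ea// /T /k; ring.
rewrite -mulr_suml big_split/=; congr (_ * _).
rewrite /L addrA; congr (_ + _).
rewrite (bigID (fun a => mi_length a == m))/=; congr (_ + _); last first.
  by apply: eq_bigl => a; rewrite ltn_neqAle andbC.
rewrite /principal_symbol /symbol mulr_suml.
rewrite (eq_bigl (fun a => mi_length a == m)); last first.
  by move=> a; case: eqP => [->|]; rewrite ?leqnn ?andbF.
apply: eq_bigr => a /eqP am; rewrite /T /k mi_monomial_ximono am -!mulrA.
congr (_ * _); rewrite !mulrA -exprMn.
have -> : - 'i%C * 'i%C = 1 :> C by rewrite mulNr -expr2 sqr_i opprK.
by rewrite expr1n mul1r.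
Qed.

End OperatorOnWaves.

(** * Bounded measurable functions and the volume of boxes *)

Section BoundedMeasurable.
Context d {T : measurableType d} {R : realType} (mu : {measure set T -> \bar R}).
Hypothesis mufin : (mu setT < +oo)%E.
Implicit Types f g : T -> R.

(** On a finite measure space these functions are integrable, and they are
    stable under products. *)
Definition bmeas f : Prop :=
  measurable_fun [set: T] f /\ exists K : R, forall x, `|f x| <= K.

Definition Int f : R := Rintegral mu setT f.

Lemma bmeas_integrable f : bmeas f -> mu.-integrable setT (EFin \o f).
Proof.
move=> [mf [K hK]]; apply: measurable_bounded_integrable => //.
exists K; split; first exact: num_real.
by move=> M KM x _; apply: le_trans (hK x) _; exact: ltW.
Qed.

Lemma bmeas_cst a : bmeas (fun=> a).
Proof. by split; [exact: measurable_cst|exists `|a|]. Qed.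

Lemma bmeasD f g : bmeas f -> bmeas g -> bmeas (fun x => f x + g x).
Proof.
move=> [mf [K hK]] [mg [L hL]]; split; first exact: measurable_funD.
by exists (K + L) => x; apply: le_trans (ler_normD _ _) _; exact: lerD.
Qed.

Lemma bmeasM f g : bmeas f -> bmeas g -> bmeas (fun x => f x * g x).
Proof.
move=> [mf [K hK]] [mg [L hL]]; split; first exact: measurable_funM.
by exists (K * L) => x; rewrite normrM; exact: ler_pM.
Qed.

Lemma bmeasZ a f : bmeas f -> bmeas (fun x => a * f x).
Proof. by move=> hf; apply: bmeasM => //; exact: bmeas_cst. Qed.

Lemma bmeas_indic (A : set T) : measurable A -> bmeas \1_A.
Proof.
move=> mA; split; first exact: measurable_indic.
exists 1 => x; rewrite indicE; by case: (_ \in _); rewrite ?normr1 ?normr0.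
Qed.

Lemma bmeas_sum I (s : seq I) (P : pred I) (F : I -> T -> R) :
  (forall i, P i -> bmeas (F i)) -> bmeas (fun x => \sum_(i <- s | P i) F i x).
Proof.
move=> h; elim: s => [|i s IH].
  have -> : (fun x => \sum_(i <- [::] | P i) F i x) = fun=> 0.
    by apply/funext => x; rewrite big_nil.
  exact: bmeas_cst.
have [Pi|Pi] := boolP (P i).
  have -> : (fun x => \sum_(i <- i :: s | P i) F i x) =
      fun x => F i x + \sum_(i <- s | P i) F i x.
    by apply/funext => x; rewrite big_cons Pi.
  by apply: bmeasD => //; exact: h.
have -> : (fun x => \sum_(i <- i :: s | P i) F i x) =
    fun x => \sum_(i <- s | P i) F i x => //.
by apply/funext => x; rewrite big_cons (negbTE Pi).
Qed.

Lemma IntD f g : bmeas f -> bmeas g -> Int (fun x => f x + g x) = Int f + Int g.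
Proof. by move=> hf hg; apply: RintegralD => //; exact: bmeas_integrable. Qed.

Lemma IntZ a f : bmeas f -> Int (fun x => a * f x) = a * Int f.
Proof. by move=> hf; apply: RintegralZl => //; exact: bmeas_integrable. Qed.

Lemma Int_le f g : bmeas f -> bmeas g -> (forall x, f x <= g x) -> Int f <= Int g.
Proof. by move=> hf hg fg; apply: le_Rintegral => //; exact: bmeas_integrable. Qed.

Lemma Int_ge0 f : (forall x, 0 <= f x) -> 0 <= Int f.
Proof. by move=> f0; apply: Rintegral_ge0. Qed.

Lemma Int_cst a : Int (fun=> a) = a * fine (mu setT).
Proof. exact: Rintegral_cst. Qed.

Lemma Int_indic (A : set T) : measurable A -> Int \1_A = fine (mu A).
Proof.
by move=> mA; rewrite /Int /Rintegral integral_indic// setIT.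
Qed.

Lemma Int_sum I (s : seq I) (P : pred I) (F : I -> T -> R) :
  (forall i, P i -> bmeas (F i)) ->
  Int (fun x => \sum_(i <- s | P i) F i x) = \sum_(i <- s | P i) Int (F i).
Proof.
move=> h; elim: s => [|i s IH].
  rewrite big_nil (_ : (fun _ => _) = fun=> 0); first by rewrite Int_cst mul0r.
  by apply/funext => x; rewrite big_nil.
rewrite big_cons; case: ifPn => Pi.
  rewrite -IH -IntD; [|exact: h|exact: bmeas_sum].
  by congr Int; apply/funext => x; rewrite big_cons Pi.
by rewrite -IH; congr Int; apply/funext => x; rewrite big_cons (negbTE Pi).
Qed.
End BoundedMeasurable.

Section LebesgueInt.
Context {R : realType}.

(** Stated for arbitrary nonnegative functions, because the inner integrals of
    an iterated integral are not known to be measurable. *)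
Lemma le_integral_nonneg d (T : measurableType d) (mu : {measure set T -> \bar R})
    (f g : T -> \bar R) : (forall x, 0 <= f x)%E -> (forall x, f x <= g x)%E ->
  (\int[mu]_x f x <= \int[mu]_x g x)%E.
Proof.
move=> f0 fg; have g0 x : (0 <= g x)%E by exact: le_trans (f0 x) (fg x).
rewrite (ge0_integralTE _ f0) (ge0_integralTE _ g0).
by apply: le_ereal_sup => _ /= [h hf <-]; exists h => // x; exact: le_trans (hf x) (fg x).
Qed.

Lemma lebesgue_int_ge0 n (f : 'rV[R]_n -> \bar R) :
  (forall y, 0 <= f y)%E -> (0 <= lebesgue_int f)%E.
Proof.
elim: n f => [|n IH] f f0 /=; first exact: f0.
by apply: integral_ge0 => t _; apply: IH => v; exact: f0.
Qed.

Lemma le_lebesgue_int n (f g : 'rV[R]_n -> \bar R) :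
  (forall y, 0 <= f y)%E -> (forall y, f y <= g y)%E ->
  (lebesgue_int f <= lebesgue_int g)%E.
Proof.
elim: n f g => [|n IH] f g f0 fg /=; first exact: fg.
apply: le_integral_nonneg => t.
  by apply: lebesgue_int_ge0 => v; exact: f0.
by apply: IH => v; [exact: f0|exact: fg].
Qed.

(** Half-open, so that the cells of a grid are disjoint. *)
Definition cell n (a b : 'rV[R]_n) : set 'rV[R]_n :=
  [set y | forall j, a 0 j <= y 0 j < b 0 j].

Definition cell_vol n (a b : 'rV[R]_n) : R := \prod_j (b 0 j - a 0 j).

Lemma lebesgue_int_cell n (K : R) (a b : 'rV[R]_n) : 0 <= K ->
  (forall j, a 0 j <= b 0 j) ->
  lebesgue_int (fun y => (K * \1_(cell a b) y)%:E) = (K * cell_vol a b)%:E.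
Proof.
elim: n K a b => [|n IH] K a b K0 ab.
  rewrite /= /cell_vol big_ord0 indicE mem_set//.
  by move=> -[].
pose a' : 'rV[R]_n := \row_j a 0 (lift ord0 j).
pose b' : 'rV[R]_n := \row_j b 0 (lift ord0 j).
have aE j : a' 0 j = a 0 (lift ord0 j) by rewrite mxE.
have bE j : b' 0 j = b 0 (lift ord0 j) by rewrite mxE.
have ab' j : a' 0 j <= b' 0 j by rewrite aE bE.
pose rr (t : R) (v : 'rV[R]_n) : 'rV[R]_n.+1 := row_mx (t%:M : 'rV[R]_1) v.
have row0 t v : rr t v 0 ord0 = t.
  have -> : ord0 = lshift n (0 : 'I_1) :> 'I_n.+1 by apply/val_inj.
  by apply: etrans (row_mxEl _ _ _ _) _; rewrite mxE eqxx.
have rowS t v j : rr t v 0 (lift ord0 j) = v 0 j.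
  have -> : lift ord0 j = rshift 1 j :> 'I_n.+1 by apply/val_inj.
  exact: row_mxEr.
have E t v : \1_(cell a b) (rr t v) =
    \1_(`[a 0 ord0, b 0 ord0[%classic) t * \1_(cell a' b') v :> R.
  rewrite !indicE -natrM mulnb; congr (_%:R); congr nat_of_bool.
  apply/idP/andP; rewrite !inE /cell /=.
    move=> h; split; first by rewrite in_itv/=; have := h ord0; rewrite row0.
    by move=> j; rewrite aE bE; have := h (lift ord0 j); rewrite rowS.
  move=> [h1 h2] j; move: h1; rewrite in_itv/= => h1.
  have [k ->|->] := unliftP ord0 j; last by rewrite row0.
  by have := h2 k; rewrite rowS aE bE.
have vE : cell_vol a b = (b 0 ord0 - a 0 ord0) * cell_vol a' b'.
  rewrite /cell_vol big_ord_recl; congr (_ * _).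
  by apply: eq_bigr => j _; rewrite !mxE.
have v0 : 0 <= cell_vol a' b' by apply: prodr_ge0 => j _; rewrite subr_ge0.
transitivity (\int[@lebesgue_measure R]_t
    (K * cell_vol a' b' * \1_(`[a 0 ord0, b 0 ord0[%classic) t)%:E)%E.
  apply: eq_integral => t _ /=.
  rewrite -[X in _ = X](_ : (K * \1_(`[a 0 ord0, b 0 ord0[%classic) t *
    cell_vol a' b')%:E = _); last by rewrite mulrAC.
  rewrite -(IH _ a' b')//; last by rewrite mulr_ge0// indicE.
  by congr lebesgue_int; apply/funext => v; rewrite -/(rr t v) E mulrA.
have Kv0 : 0 <= K * cell_vol a' b' by rewrite mulr_ge0.
have := integralZl_indic (m := @lebesgue_measure R) measurableT
  (fun=> `[a 0 ord0, b 0 ord0[%classic) (K * cell_vol a' b').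
move=> /(_ _ (measurable_itv _)) -> /=; last by rewrite ltNge Kv0.
have L : @lebesgue_measure R `[a 0 ord0, b 0 ord0[%classic =
    (b 0 ord0 - a 0 ord0)%:E.
  rewrite lebesgue_measure_itv/= lte_fin; case: ltrP => // h.
  have -> : b 0 ord0 = a 0 ord0 by apply/eqP; rewrite eq_le h ab.
  by rewrite subrr.
rewrite integral_indic// setIT [X in (_ * X)%E]L -EFinM vE.
by congr (_%:E); rewrite -mulrA (mulrC (cell_vol a' b')).
Qed.
End LebesgueInt.

Section Volume.
Context {R : realType} {n : nat} {M : ptopologicalType}.
Context (S : smooth_structure R n M) (mu : volume_density S).
Local Notation V := 'rV[R]_n.

Lemma open_measurable_borel (O : set M) : open O -> measurable (O : set (@borel M)).
Proof. by move=> oO; exact: sub_sigma_algebra. Qed.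

Lemma continuous_measurable_borel (f : M -> R) : continuous f ->
  measurable_fun [set: @borel M] (f : @borel M -> R).
Proof.
move=> cf; apply: (measurability _ (RGenOpens.measurableE R)).
move=> _ [_ [a [b ->] <-]]; rewrite setTI; apply: open_measurable_borel.
have /continuousP := cf; apply; exact: interval_open.
Qed.

Definition chart_set (c : chart R n M) (A : set V) : set (@borel M) :=
  [set x | dom c x /\ A (phi c x)].

Lemma chart_set_cell_measurable c (a b : V) : charts S c ->
  measurable (chart_set c (cell a b)).
Proof.
move=> cS.
have mopen (O : set V) : open O -> measurable (chart_set c O).
  by move=> oO; apply: open_measurable_borel; exact: (open_phi_preimage cS).
have -> : chart_set c (cell a b) = chart_set c setT `&`
   \bigcap_(j in [set: 'I_n]) (chart_set c [set y | y 0 j < b 0 j] `\`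
                           chart_set c [set y | y 0 j < a 0 j]).
  apply/seteqP; split=> [x [dx hx]|x [[dx _]] hx].
    split => // j _; split; first by split => //=; have /andP[] := hx j.
    by move=> [_ /=]; have /andP[h _] := hx j; rewrite ltNge h.
  split => // j; have [[_ /= ->] hn] := hx j I.
  by rewrite andbT leNgt; apply/negP => h; apply: hn.
have oj (r : R) j : open [set y : V | y 0 j < r].
  have -> : [set y : V | y 0 j < r] = (fun y : V => y 0 j) @^-1` [set t | t < r] by [].
  by apply: open_comp; [move=> y _; exact: coord_continuous|exact: open_lt].
apply: measurableI; first by apply: mopen; exact: openT.
by apply: fin_bigcap_measurable => // j _; apply: measurableD; apply: mopen; exact: oj.
Qed.

(** The only property of the measure that the estimates use: on a box it is
    Lebesgue measure up to the bounds of the density. *)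
Lemma vol_cell_bounds c (a b : V) (lo hi : R) : charts S c ->
  cell a b `<=` img c -> (forall j, a 0 j <= b 0 j) -> 0 <= lo ->
  (forall y, cell a b y -> lo <= density mu c y <= hi) ->
  ((lo * cell_vol a b)%:E <= vol mu (chart_set c (cell a b)) <= (hi * cell_vol a b)%:E)%E.
Proof.
move=> cS sub ab lo0 hd.
have [[y cy]|ne] := pselect (exists y, cell a b y); last first.
  have -> : cell a b = set0 by rewrite -subset0 => y hy; apply: ne; exists y.
  have -> : chart_set c set0 = set0 by rewrite -subset0 => x [].
  rewrite measure0.
  have -> : cell_vol a b = 0.
    apply/eqP; apply/negPn/negP => v0; apply: ne; exists a => j.
    rewrite lexx lt_neqAle ab andbT; apply: contra v0 => /eqP e.
    by rewrite /cell_vol (bigD1 j)//= e subrr mul0r.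
  by rewrite !mulr0 !lexx.
have hi0 : 0 <= hi by have /andP[h1 h2] := hd y cy; exact: le_trans lo0 (le_trans h1 h2).
rewrite (volE mu cS (chart_set_cell_measurable _ _ cS)); last by move=> x [].
have -> : phi c @` (chart_set c (cell a b) : set M) = cell a b.
  apply/seteqP; split=> [_ [x [_ h] <-]//|z hz].
  have iz := sub z hz; exists (psi c z); last exact: (chart_psiK cS).
  by split; [exact: (dom_psi cS)|rewrite (chart_psiK cS)].
rewrite -!lebesgue_int_cell//; apply/andP; split.
- apply: le_lebesgue_int => z; rewrite lee_fin ?mulr_ge0// indicE.
  have [/set_mem/hd/andP[h _]|_] := boolP (z \in _); first by rewrite ler_wpM2r.
  by rewrite !mulr0.
- apply: le_lebesgue_int => z; rewrite lee_fin indicE.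
    have [/set_mem/hd/andP[h _]|_] := boolP (z \in _); last by rewrite mulr0.
    by rewrite mulr1 (le_trans lo0).
  have [/set_mem/hd/andP[_ h]|_] := boolP (z \in _); first by rewrite ler_wpM2r.
  by rewrite !mulr0.
Qed.
End Volume.

(** * Discrete Fourier analysis on a grid *)

Section Expi.
Context {R : realType}.
Local Notation C := R[i].
Implicit Types x y : R.

Lemma expi0 : expi 0 = 1 :> C.
Proof. by rewrite /expi cos0 sin0. Qed.

Lemma expiD x y : expi (x + y) = expi x * expi y :> C.
Proof.
rewrite /expi cosD sinD; apply/eqP; rewrite eq_complex /=; apply/andP.
by split; apply/eqP; ring.
Qed.

Lemma expiN x : expi (- x) = (expi x)^*%C :> C.
Proof. by rewrite /expi cosN sinN. Qed.

Lemma expiM_nat x k : expi (x * k%:R) = expi x ^+ k :> C.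
Proof.
elim: k => [|k IH]; first by rewrite mulr0 expi0 expr0.
by rewrite -natr1 mulrDr mulr1 expiD IH exprSr.
Qed.

Lemma expi2pi : expi (2 * pi) = 1 :> C.
Proof. by rewrite /expi mulr_natl cos2pi sin2pi. Qed.

Lemma expi_sum I (s : seq I) (P : pred I) (F : I -> R) :
  expi (\sum_(i <- s | P i) F i) = \prod_(i <- s | P i) expi (F i) :> C.
Proof. by apply: big_morph; [exact: expiD|exact: expi0]. Qed.

Lemma expi_neq1 x : 0 < `|x| < 2 * pi -> expi x != 1 :> C.
Proof.
move=> /andP[x0 x2]; apply/eqP => e.
have h : expi `|x| = 1 :> C.
  have [p|p] := leP 0 x; first by rewrite ger0_norm.
  by rewrite ltr0_norm// expiN e conjc1.
have s0 : 0 < sin (`|x| / 2).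
  by apply: sin_gt0_pi; rewrite divr_gt0//= ltr_pdivrMr// mulrC.
have := congr1 (@complex.Re R) h; rewrite /expi /= [in cos _](splitr `|x|) cosD.
move=> c1; have := cos2Dsin2 (`|x| / 2); rewrite !expr2.
have : 0 < sin (`|x| / 2) * sin (`|x| / 2) by rewrite mulr_gt0.
lra.
Qed.

(** The squared modulus as an element of R, the norm of R[i] having its values
    in R[i]. *)
Definition sqn (z : C) : R := complex.Re z ^+ 2 + complex.Im z ^+ 2.

Lemma sqn_ge0 z : 0 <= sqn z. Proof. by rewrite addr_ge0 ?sqr_ge0. Qed.

Lemma sqnE z : (sqn z)%:C%C = z * z^*%C.
Proof.
case: z => a b; apply/eqP; rewrite eq_complex /sqn /=; apply/andP.
by split; apply/eqP; ring.
Qed.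

Lemma sqnM z w : sqn (z * w) = sqn z * sqn w.
Proof. by rewrite /sqn cReM cImM; ring. Qed.

Lemma sqn_expi x : sqn (expi x) = 1.
Proof. by rewrite /sqn /expi /= cos2Dsin2. Qed.

Lemma sqn_real x : sqn (x%:C%C) = x ^+ 2.
Proof. by rewrite /sqn /= expr0n addr0. Qed.

Lemma sqn_wave n (xi y : 'rV[R]_n) : sqn (wave xi y) = 1.
Proof. exact: sqn_expi. Qed.

Lemma normcE_sqn (z : C) : ComplexField.Normc.normc z = Num.sqrt (sqn z).
Proof. by case: z. Qed.
End Expi.

Section DiscreteFourier.
Context {R : realType}.
Local Notation C := R[i].

(** A geometric sum of powers of a root of unity of order dividing G, which
    differs from 1 if k and k' do because their difference is less than G in
    absolute value. *)
Lemma root_sum (G k k' : nat) : (k < G)%N -> (k' < G)%N ->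
  \sum_(l < G) expi (2 * pi * ((k%:R - k'%:R) * (l%:R / G%:R))) =
  (if k == k' then G%:R else 0) :> C.
Proof.
move=> kG k'G; have G0 : (0 < G)%N by exact: leq_ltn_trans kG.
have Gr : 0 < G%:R :> R by rewrite ltr0n.
have [->|kk'] := eqVneq k k'.
  rewrite (eq_bigr (fun=> 1)) ?sumr_const ?card_ord// => l _.
  by rewrite subrr mul0r mulr0 expi0.
pose th : R := 2 * pi * ((k%:R - k'%:R) / G%:R).
rewrite (eq_bigr (fun l : 'I_G => expi th ^+ l)); last first.
  move=> l _; rewrite -expiM_nat /th; congr expi; ring.
have z1 : expi th ^+ G = 1 :> C.
  rewrite -expiM_nat /th; have -> : 2 * pi * ((k%:R - k'%:R) / G%:R) * G%:R =
      2 * pi * k%:R + - (2 * pi * k'%:R) :> R by field; rewrite gt_eqF.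
  by rewrite expiD expiN !expiM_nat expi2pi !expr1n conjc1 mulr1.
have zn : expi th != 1 :> C.
  apply: expi_neq1; rewrite /th !normrM (ger0_norm (pi_ge0 R)) normfV.
  rewrite (ger0_norm (ltW Gr)) (ger0_norm (_ : 0 <= 2))//.
  have p2 : 0 < 2 * pi :> R by rewrite mulr_gt0 ?pi_gt0.
  rewrite pmulr_rgt0// divr_gt0//=; last first.
    by rewrite normr_gt0 subr_eq0 eqr_nat.
  rewrite gtr_pMr// ltr_pdivrMr// mul1r ltr_norml; apply/andP; split.
    rewrite ltrBrDl; apply: (@lt_le_trans _ _ 0).
      by rewrite subr_lt0 ltr_nat.
    by [].
  rewrite ltrBlDr; apply: (@lt_le_trans _ _ G%:R); first by rewrite ltr_nat.
  by rewrite lerDl.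
have := subrX1 (expi th : C) G; rewrite z1 subrr => /esym/eqP.
by rewrite mulf_eq0 subr_eq0 (negbTE zn)/= => /eqP.
Qed.
End DiscreteFourier.

Section TrigPoly.
Context {R : realType} {n : nat} (y0 : 'rV[R]_n) (r : R).
Hypothesis r0 : 0 < r.
Local Notation C := R[i].
Local Notation V := 'rV[R]_n.

(** The frequencies of functions of period 2 r in each variable; the shift by
    s produces negative ones. *)
Definition freq N (s : nat) (k : {ffun 'I_n -> 'I_N}) : V :=
  \row_j (pi / r * ((k j)%:R - s%:R)).

Definition grid_node G (j : 'I_n) (l : nat) : R := y0 0 j - r + 2 * r * (l%:R / G%:R).

Definition grid G (l : {ffun 'I_n -> 'I_G}) : V := \row_j grid_node G j (l j).

Definition trig N s (c : {ffun 'I_n -> 'I_N} -> C) (y : V) : C :=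
  \sum_k c k * wave (freq s k) y.

Lemma waveE (xi y : V) : wave xi y = \prod_j expi (xi 0 j * y 0 j).
Proof. by rewrite /wave /dotp expi_sum. Qed.

Lemma conj_prod I (s : seq I) (F : I -> C) :
  (\prod_(i <- s) F i)^*%C = \prod_(i <- s) (F i)^*%C.
Proof. exact: rmorph_prod. Qed.

Lemma sum_prod_ffun (T : comNzRingType) G (F : 'I_n -> 'I_G -> T) :
  \sum_(l : {ffun 'I_n -> 'I_G}) \prod_j F j (l j) = \prod_j \sum_(l < G) F j l.
Proof. by rewrite bigA_distr_bigA. Qed.

Lemma grid_orthogonal N G s (k k' : {ffun 'I_n -> 'I_N}) : (N <= G)%N ->
  \sum_(l : {ffun 'I_n -> 'I_G}) wave (freq s k) (grid l) *
     (wave (freq s k') (grid l))^*%C = (if k == k' then (G ^ n)%:R else 0) :> C.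
Proof.
move=> NG; have r0' : r != 0 by rewrite gt_eqF.
pose F j (l : 'I_G) : C := expi (pi / r * ((k j)%:R - (k' j)%:R) * (y0 0 j - r)) *
   expi (2 * pi * (((k j)%:R - (k' j)%:R) * (l%:R / G%:R))).
transitivity (\sum_(l : {ffun 'I_n -> 'I_G}) \prod_j F j (l j)).
  apply: eq_bigr => l _; rewrite !waveE conj_prod -big_split.
  apply: eq_bigr => j _.
  change (expi (freq s k 0 j * grid l 0 j) *
    (expi (freq s k' 0 j * grid l 0 j))^*%C = F j (l j)).
  rewrite -[(expi _)^*%C]expiN -expiD /F -expiD !mxE /grid_node.
  by congr expi; field; rewrite r0' pnatr_eq0 -lt0n (leq_trans _ NG)// (leq_trans _ (ltn_ord (k j))).
rewrite sum_prod_ffun.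
have E j : \sum_(l < G) F j l = if k j == k' j then G%:R else 0 :> C.
  rewrite -mulr_sumr root_sum ?(leq_trans (ltn_ord _) NG)// val_eqE.
  case: eqP => [->|_]; last by rewrite mulr0.
  by rewrite subrr mulr0 mul0r expi0 mul1r.
have [kk|kk'] := eqVneq k k'.
  rewrite (eq_bigr (fun=> G%:R)); last by move=> j _; rewrite E kk eqxx.
  by rewrite prodr_const card_ord natrX.
have [j kj] : exists j, k j != k' j.
  apply/existsP; rewrite -negb_forall; apply: contra kk' => /forallP h.
  by apply/eqP/ffunP => j; apply/eqP.
by rewrite (bigD1 j)//= E (negbTE kj) mul0r.
Qed.

Lemma conjcM (z w : C) : (z * w)^*%C = z^*%C * w^*%C.
Proof. exact: rmorphM. Qed.

Lemma conjc_sum I (s : seq I) (F : I -> C) :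
  (\sum_(i <- s) F i)^*%C = \sum_(i <- s) (F i)^*%C.
Proof. exact: rmorph_sum. Qed.

(** Parseval's identity for sampling: the waves are orthogonal on every grid
    that has at least as many nodes per coordinate as there are frequencies.
    *)
Lemma grid_mean_square N G s (c : {ffun 'I_n -> 'I_N} -> C) : (N <= G)%N ->
  \sum_(l : {ffun 'I_n -> 'I_G}) sqn (trig s c (grid l)) =
  (G ^ n)%:R * \sum_k sqn (c k).
Proof.
move=> NG; apply: (@complexI R).
rewrite rmorphM/= !rmorph_sum/= rmorph_nat.
rewrite (eq_bigr (fun l : {ffun 'I_n -> 'I_G} => \sum_k \sum_k' c k * (c k')^*%C *
  (wave (freq s k) (grid l) * (wave (freq s k') (grid l))^*%C))); last first.
  move=> l _; rewrite sqnE /trig conjc_sum mulr_suml; apply: eq_bigr => k _.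
  rewrite mulr_sumr; apply: eq_bigr => k' _; rewrite conjcM; ring.
rewrite exchange_big mulr_sumr/=; apply: eq_bigr => k _.
rewrite exchange_big (bigD1 k)//= -mulr_sumr grid_orthogonal// eqxx big1 => [|k' kk'].
  by rewrite addr0 sqnE mulrC.
by rewrite -mulr_sumr grid_orthogonal// eq_sym (negbTE kk') mulr0.
Qed.

(** The mean value of cos^(2N), which normalizes the kernel below. *)
Definition cos_mean (N : nat) : R := 'C(N.*2, N)%:R / 4 ^+ N.

(** An approximate identity of period 2 r that is nonnegative, is a
    trigonometric polynomial, and has moments that are computed exactly by
    sums over the grid. *)
Definition cos_kernel N G (t : R) : R :=
  (G%:R * cos_mean N)^-1 * cos (pi / r / 2 * t) ^+ N.*2.

Lemma cos_mean_gt0 N : 0 < cos_mean N.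
Proof. by rewrite divr_gt0 ?exprn_gt0// ltr0n bin_gt0 -addnn leq_addr. Qed.

Lemma cos_mean_ratio N : cos_mean N.+1 = (1 - (N.*2.+2)%:R^-1) * cos_mean N.
Proof.
have e1 : ('C(N.*2.+2, N.+1) * N.+1 = N.*2.+2 * 'C(N.*2.+1, N))%N.
  by rewrite mulnC -mul_bin_diag.
have e2 : ('C(N.*2.+1, N) * N.+1 = N.*2.+1 * 'C(N.*2, N))%N.
  have := mul_bin_down N.*2.+1 N; rewrite /= => ->.
  by rewrite mulnC; congr (_ * _)%N; rewrite -addnn -addSn addnK.
rewrite /cos_mean doubleS exprS.
have h1 := congr1 (fun k => k%:R : R) e1; have h2 := congr1 (fun k => k%:R : R) e2.
rewrite !natrM in h1 h2.
have N1 : N.+1%:R != 0 :> R by rewrite pnatr_eq0.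
have f0 : 4 ^+ N != 0 :> R by rewrite expf_neq0.
have N2 : N.*2.+2%:R = 2 * N.+1%:R :> R by rewrite -natrM; congr (_%:R); rewrite mul2n doubleS.
have N3 : N.*2.+1%:R = 2 * N.+1%:R - 1 :> R by rewrite -N2 -[in RHS]natr1 addrK.
have -> : 'C(N.*2.+2, N.+1)%:R = N.*2.+2%:R * (N.*2.+1%:R * 'C(N.*2, N)%:R) / N.+1%:R ^+ 2 :> R.
  by rewrite -h2 mulrA -h1 expr2; field.
rewrite N3 N2; move: N1 f0; set a := N.+1%:R; set b := 4 ^+ N.
by clearbody a b => N1 f0; field; rewrite N1 f0.
Qed.

Lemma cos_kernel_ge0 N G t : 0 <= cos_kernel N G t.
Proof.
rewrite mulr_ge0 ?invr_ge0 ?mulr_ge0 ?(ltW (cos_mean_gt0 N))//.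
by rewrite -muln2 mulnC exprM exprn_ge0// sqr_ge0.
Qed.

Definition kernel_coef N G (i : nat) : R :=
  'C(N.*2, i)%:R / (G%:R * cos_mean N * 4 ^+ N).

Lemma cos_kernelE N G t : (cos_kernel N G t)%:C%C =
  \sum_(i < N.*2.+1) (kernel_coef N G i)%:C%C * expi (pi / r * (i%:R - N%:R) * t) :> C.
Proof.
set x := pi / r / 2 * t.
have ce : (cos x)%:C%C = (expi (- x) + expi x) / 2 :> C.
  have -> : (2 : C)^-1 = (2^-1)%:C%C by rewrite fmorphV/= rmorph_nat.
  rewrite expiN /expi; apply/eqP; rewrite eq_complex cReM cImM /=.
  by apply/andP; split; apply/eqP; field.
rewrite /cos_kernel -/x rmorphM rmorphXn/= ce expr_div_n exprDn.
rewrite mulr_suml mulr_sumr; apply: eq_bigr => i _.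
have -> : expi (pi / r * (i%:R - N%:R) * t) = expi (- x) ^+ (N.*2 - i) * expi x ^+ i :> C.
  rewrite -!expiM_nat -expiD; congr expi.
  have iN : (i <= N.*2)%N by rewrite -ltnS.
  have d2 : N.*2%:R = 2 * N%:R :> R by rewrite -mul2n natrM.
  by rewrite natrB// d2 /x; field; rewrite gt_eqF.
rewrite -[_ *+ 'C(_, _)]mulr_natl.
have -> : (2 : C) ^+ N.*2 = (4 ^+ N)%:C%C.
  have e4 : (2 : C) ^+ 2 = 4%:C%C.
    rewrite -(rmorph_nat (real_complex R) 2) -rmorphXn /=; congr (_%:C)%C.
    by rewrite -natrX.
  by rewrite rmorphXn/= -e4 -exprM mul2n.
set E1 := expi (- x) ^+ (_ - _) * _; set b := 'C(_, _).
have -> : b%:R = (b%:R : R)%:C%C :> C by rewrite rmorph_nat.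
have -> : ((4 ^+ N)%:C%C)^-1 = ((4 ^+ N)^-1)%:C%C :> C by rewrite fmorphV.
have -> : kernel_coef N G i = (G%:R * cos_mean N)^-1 * (b%:R * (4 ^+ N)^-1).
  by rewrite /kernel_coef invfM mulrCA.
move: (_ ^-1) (b%:R : R) ((4 ^+ N)^-1) E1 => p q s E1.
by rewrite !rmorphM/=; move: (p%:C)%C (q%:C)%C (s%:C)%C => p' q' s'; ring.
Qed.

Lemma cos_kernel_sum N G j t : (N < G)%N ->
  \sum_(l < G) cos_kernel N G (t - grid_node G j l) = 1.
Proof.
move=> NG; have G0 : (0 < G)%N by exact: leq_ltn_trans NG.
have Gr : G%:R != 0 :> R by rewrite pnatr_eq0 -lt0n.
have r0' : r != 0 by rewrite gt_eqF.
apply: (@complexI R); rewrite rmorph_sum/=.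
rewrite (eq_bigr (fun l : 'I_G => \sum_(i < N.*2.+1) (kernel_coef N G i)%:C%C *
   expi (pi / r * (i%:R - N%:R) * (t - y0 0 j + r)) *
   expi (2 * pi * ((N%:R - i%:R) * (l%:R / G%:R))))); last first.
  move=> l _; rewrite cos_kernelE; apply: eq_bigr => i _; rewrite -[RHS]mulrA -expiD.
  by congr (_ * expi _); rewrite /grid_node; field; rewrite r0' Gr.
rewrite exchange_big/=.
have NN : (N < N.*2.+1)%N by rewrite ltnS -addnn leq_addr.
rewrite (bigD1 (Ordinal NN))//= -mulr_sumr root_sum// eqxx subrr mulr0 mul0r expi0.
rewrite mulr1 big1 ?addr0 => [|i iN].
  rewrite /kernel_coef -(rmorph_nat (real_complex R)) -rmorphM; congr (_%:C)%C.
  have bN : 'C(N.*2, N)%:R != 0 :> R.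
    by rewrite pnatr_eq0 -lt0n bin_gt0 -addnn leq_addr.
  rewrite /cos_mean; field; by rewrite bN Gr expf_neq0.
have iN' : (i != N :> nat) by apply: contra iN => /eqP e; apply/eqP/val_inj.
rewrite -mulr_sumr.
suff -> : \sum_(l < G) expi (2 * pi * ((N%:R - i%:R) * (l%:R / G%:R))) = 0 :> C.
  by rewrite mulr0.
have -> : N%:R - i%:R = (N - i)%:R - (i - N)%:R :> R.
  have [h|h] := leqP i N; first by rewrite natrB// (eqP h) subr0.
  by rewrite (natrB _ (ltnW h)) (eqP (ltnW h)) sub0r opprB.
have iN2 : (i <= N + N)%N by rewrite addnn -ltnS.
rewrite root_sum ?(leq_ltn_trans (leq_subr _ _) NG)//; last first.
  by apply: leq_ltn_trans NG; rewrite leq_subLR.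
case: eqP => // e; exfalso; move: iN'; rewrite eqn_leq -!subn_eq0.
by have [h|h] := leqP i N; [move: e; rewrite (eqP h) => ->|move: e; rewrite (eqP (ltnW h)) => <-]; rewrite ?eqxx ?h ?(ltnW h).
Qed.

(** Since sin^2 = 1 - cos^2, the sum is the difference of the total masses of
    the kernels of orders N and N + 1, and the ratio of the normalizations
    gives the value. *)
Lemma cos_kernel_second_moment N G j t : (N.+1 < G)%N ->
  \sum_(l < G) cos_kernel N G (t - grid_node G j l) *
    sin (pi / r / 2 * (t - grid_node G j l)) ^+ 2 = (N.*2.+2)%:R^-1.
Proof.
move=> NG; have m0 := cos_mean_gt0 N; have m1 := cos_mean_gt0 N.+1.
have G0 : (0 < G)%N by exact: leq_ltn_trans NG.
have Gr : G%:R != 0 :> R by rewrite pnatr_eq0 -lt0n.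
rewrite (eq_bigr (fun l : 'I_G => cos_kernel N G (t - grid_node G j l) -
  (1 - (N.*2.+2)%:R^-1) * cos_kernel N.+1 G (t - grid_node G j l))).
  rewrite sumrB cos_kernel_sum; last by exact: ltnW.
  by rewrite -mulr_sumr cos_kernel_sum//; ring.
move=> l _; rewrite sin2cos2 mulrBr mulr1; congr (_ - _).
rewrite /cos_kernel doubleS cos_mean_ratio.
have q0 : 1 - (N.*2.+2)%:R^-1 != 0 :> R.
  apply/eqP => q0; move: m1; rewrite cos_mean_ratio q0 mul0r ltxx//.
move: (cos _) => x.
rewrite (_ : x ^+ N.*2.+2 = x ^+ N.*2 * x ^+ 2); last by rewrite -exprD addn2.
move: q0 m0 Gr; move: (1 - (N.*2.+2)%:R^-1) (cos_mean N) (G%:R) (x ^+ N.*2) => q mN g w q0 m0 Gr.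
by field; rewrite q0 Gr gt_eqF.
Qed.

Definition cube : set V := [set y | forall j, `|y 0 j - y0 0 j| <= r].

Lemma node_cube G j l : (l < G)%N -> `|grid_node G j l - y0 0 j| <= r.
Proof.
move=> lG; have G0 : (0 < G)%N by exact: leq_ltn_trans lG.
have Gr : 0 < G%:R :> R by rewrite ltr0n.
have q0 : 0 <= l%:R / G%:R :> R by rewrite divr_ge0.
have q1 : l%:R / G%:R <= 1 :> R by rewrite ler_pdivrMr// mul1r ler_nat ltnW.
rewrite /grid_node ler_norml; have := mulr_ge0 (ltW r0) q0.
have := ler_wpM2l (ltW r0) q1; move: (_ / _) => q; lra.
Qed.

Lemma grid_cube G (l : {ffun 'I_n -> 'I_G}) : cube (grid l).
Proof. by move=> j; rewrite mxE; exact: node_cube. Qed.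

Definition kernel N G (y a : V) : R := \prod_j cos_kernel N G (y 0 j - a 0 j).

Lemma kernel_ge0 N G y a : 0 <= kernel N G y a.
Proof. by apply: prodr_ge0 => j _; exact: cos_kernel_ge0. Qed.

Lemma kernel_trig N G y a : (kernel N G y a)%:C%C =
  \sum_(k : {ffun 'I_n -> 'I_N.*2.+1})
    (\prod_j ((kernel_coef N G (k j))%:C%C *
        expi (- (pi / r * ((k j)%:R - N%:R) * a 0 j)))) *
    wave (freq N k) y :> C.
Proof.
rewrite /kernel rmorph_prod/=.
rewrite (eq_bigr (fun j => \sum_(i < N.*2.+1) (kernel_coef N G i)%:C%C *
   expi (- (pi / r * (i%:R - N%:R) * a 0 j)) *
   expi (pi / r * (i%:R - N%:R) * y 0 j))); last first.
  move=> j _; rewrite cos_kernelE; apply: eq_bigr => i _.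
  by rewrite -[RHS]mulrA -expiD; congr (_ * expi _); ring.
rewrite bigA_distr_bigA/=; apply: eq_bigr => k _.
rewrite big_split/=; congr (_ * _); rewrite waveE.
by apply: eq_bigr => j _; rewrite mxE.
Qed.

Lemma kernel_sum N G y : (N < G)%N ->
  \sum_(l : {ffun 'I_n -> 'I_G}) kernel N G y (grid l) = 1.
Proof.
move=> NG.
rewrite (eq_bigr (fun l : {ffun 'I_n -> 'I_G} =>
   \prod_j cos_kernel N G (y 0 j - grid_node G j (l j)))); last first.
  by move=> l _; apply: eq_bigr => j _; rewrite mxE.
rewrite (sum_prod_ffun (fun j i => cos_kernel N G (y 0 j - grid_node G j i))).
by rewrite big1// => j _; exact: cos_kernel_sum.
Qed.

Lemma kernel_second_moment N G y j : (N.+1 < G)%N ->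
  \sum_(l : {ffun 'I_n -> 'I_G}) kernel N G y (grid l) *
    sin (pi / r / 2 * (y 0 j - grid l 0 j)) ^+ 2 = (N.*2.+2)%:R^-1.
Proof.
move=> NG.
pose F i (k : 'I_G) := cos_kernel N G (y 0 i - grid_node G i k) *
  (if i == j then sin (pi / r / 2 * (y 0 i - grid_node G i k)) ^+ 2 else 1).
rewrite (eq_bigr (fun l : {ffun 'I_n -> 'I_G} => \prod_i F i (l i))); last first.
  move=> l _; rewrite /kernel (bigD1 j)//= [in RHS](bigD1 j)//= /F eqxx mxE.
  rewrite mulrAC; congr (_ * _); apply: eq_bigr => i /negbTE ij.
  by rewrite ij mulr1 mxE.
rewrite sum_prod_ffun (bigD1 j)//= [X in _ * X]big1 => [|i /negbTE ij].
  by rewrite mulr1 /F eqxx; exact: cos_kernel_second_moment.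
rewrite /F ij (eq_bigr (fun k : 'I_G => cos_kernel N G (y 0 i - grid_node G i k))).
  by apply: cos_kernel_sum; exact: ltnW.
by move=> k _; rewrite mulr1.
Qed.

Local Notation normc := ComplexField.Normc.normc.

Lemma normc_sum I (s : seq I) (F : I -> C) :
  normc (\sum_(i <- s) F i) <= \sum_(i <- s) normc (F i).
Proof.
elim: s => [|i s IH]; first by rewrite !big_nil ComplexField.Normc.normc0.
by rewrite !big_cons; apply: le_trans (le_normcD _ _) _; rewrite lerD2l.
Qed.

(** Bernstein's method: the sum of F over the grid against the kernel is a
    trigonometric polynomial. The hypothesis bounds the oscillation of F by e
    plus a multiple of the quantity whose average against the kernel is the
    second moment, which tends to 0. *)
Lemma trig_approximation (F : V -> C) (e c : R) : 0 < e -> 0 <= c ->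
  (forall y a, cube y -> cube a ->
     normc (F y - F a) <= e + c * \sum_j sin (pi / r / 2 * (y 0 j - a 0 j)) ^+ 2) ->
  exists N s (k : {ffun 'I_n -> 'I_N} -> C),
    forall y, cube y -> normc (F y - trig s k y) <= 2 * e.
Proof.
move=> e0 c0 hF.
have [N hN] : exists N, c * n%:R * (N.*2.+2)%:R^-1 <= e.
  have q0 : 0 <= c * n%:R / e by rewrite divr_ge0 ?mulr_ge0// ltW.
  exists (Num.trunc (c * n%:R / e)).
  rewrite ler_pdivrMr// [leRHS]mulrC -ler_pdivrMr//.
  have /andP[_ /ltW h] := Num.Theory.truncn_itv q0.
  by apply: le_trans h _; rewrite ler_nat -addnn; lia.
pose G := N.+2; pose g y := \sum_(l : {ffun 'I_n -> 'I_G}) F (grid l) * (kernel N G y (grid l))%:C%C.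
pose k (f : {ffun 'I_n -> 'I_N.*2.+1}) : C :=
  \sum_(l : {ffun 'I_n -> 'I_G}) F (grid l) *
    (\prod_j ((kernel_coef N G (f j))%:C%C *
        expi (- (pi / r * ((f j)%:R - N%:R) * grid l 0 j)))).
exists N.*2.+1, N, k => y hy.
have -> : trig N k y = g y.
  rewrite /trig /g (eq_bigr _ (fun l _ => congr1 (fun z => F (grid l) * z) (kernel_trig N G y (grid l)))).
  under [RHS]eq_bigr do rewrite mulr_sumr.
  rewrite exchange_big/=; apply: eq_bigr => f _; rewrite mulr_suml.
  by apply: eq_bigr => l _; rewrite mulrA.
have -> : F y - g y = \sum_(l : {ffun 'I_n -> 'I_G})
    (F y - F (grid l)) * (kernel N G y (grid l))%:C%C.
  under [RHS]eq_bigr do rewrite mulrBl.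
  rewrite sumrB -mulr_sumr; congr (_ - _).
  by rewrite -rmorph_sum/= kernel_sum ?mulr1.
apply: le_trans (normc_sum _ _) _.
apply: (@le_trans _ _ (\sum_(l : {ffun 'I_n -> 'I_G}) (kernel N G y (grid l) * e +
   c * \sum_j (kernel N G y (grid l) *
       sin (pi / r / 2 * (y 0 j - grid l 0 j)) ^+ 2)))).
  apply: ler_sum => l _; rewrite ComplexField.Normc.normcM.
  have -> : normc (kernel N G y (grid l))%:C%C = kernel N G y (grid l).
    by rewrite /= expr0n addr0 sqrtr_sqr ger0_norm// kernel_ge0.
  rewrite mulrC; apply: le_trans (ler_wpM2l (kernel_ge0 _ _ _ _) (hF _ _ hy (grid_cube l))) _.
  by rewrite mulrDr -mulr_sumr mulrCA.
rewrite big_split/= -mulr_suml kernel_sum// mul1r -mulr_sumr exchange_big/=.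
rewrite (eq_bigr (fun=> (N.*2.+2)%:R^-1)); last first.
  by move=> j _; exact: kernel_second_moment.
rewrite sumr_const card_ord; move: hN; rewrite -mulrA mulr_natl.
by move: (c * _) => w; lra.
Qed.
End TrigPoly.

(** * Cubes and finite volume *)

Section Cubes.
Context {R : realType} {n : nat}.
Local Notation V := 'rV[R]_n.

Lemma cubeP (y0 : V) (r : R) y : 0 <= r -> cube y0 r y <-> `|y - y0| <= r.
Proof.
move=> r0; split=> [h|h j].
  by apply: norm_le_coord => // j; rewrite !mxE; exact: h.
by apply: le_trans h; have := le_coord_norm (y - y0) j; rewrite !mxE.
Qed.

Lemma cube_compact (y0 : V) (r : R) : compact (cube y0 r).
Proof.
have -> : cube y0 r = [set y | forall j, `[y0 0 j - r, y0 0 j + r]%classic (y 0 j)].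
  by apply/seteqP; split=> y h j; have := h j; rewrite /= in_itv/= ler_distl.
by apply: (@rV_compact _ _ (fun j => `[y0 0 j - r, y0 0 j + r]%classic)) => j; exact: segment_compact.
Qed.

Lemma near_cube (y0 : V) (Q : set V) : (\forall y \near y0, Q y) ->
  exists2 r, 0 < r & cube y0 r `<=` Q.
Proof.
move=> /nbhs_ballP[d /= d0 hd]; exists (d / 2); first by rewrite divr_gt0.
move=> y hy; apply: hd; rewrite -ball_normE/= distrC.
have /cubeP : cube y0 (d / 2) y by []; rewrite ?divr_ge0 ?(ltW d0)// => /(_ isT).
by move=> h; apply: le_lt_trans h _; rewrite ltr_pdivrMr// mulr_natr mulr2n ltrDr.
Qed.

Lemma cube_near (y0 : V) (r : R) : 0 < r -> \forall y \near y0, cube y0 r y.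
Proof.
move=> r0; apply/nbhs_ballP; exists r => //= y; rewrite -ball_normE/= => h.
by apply/cubeP; [exact: ltW|rewrite distrC ltW].
Qed.

Lemma cubeS (y0 : V) (r s : R) : r <= s -> cube y0 r `<=` cube y0 s.
Proof. by move=> rs y h j; exact: le_trans (h j) rs. Qed.

Lemma bigmin_seq_le (T : eqType) (s : seq T) (f : T -> R) (x : R) p : p \in s ->
  \big[Num.min/x]_(i <- s) f i <= f p.
Proof.
elim: s => //= q s IH; rewrite inE big_cons => /predU1P[->|/IH h].
  by rewrite ge_min lexx.
by rewrite ge_min h orbT.
Qed.

(** Heine's theorem; the cubes are the closed balls of the sup norm. *)
Lemma cube_uniform (F : V -> R) (y0 : V) (r e : R) : 0 < e ->
  (forall y, cube y0 r y -> {for y, continuous F}) ->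
  exists2 d, 0 < d & forall y a, cube y0 r y -> cube y0 r a ->
    (forall j, `|y 0 j - a 0 j| <= d) -> `|F y - F a| <= e.
Proof.
move=> e0 cF.
have e2 : 0 < e / 2 by rewrite divr_gt0.
have loc (p : V) : exists d, 0 < d /\ (cube y0 r p -> forall y, cube p d y -> `|F p - F y| <= e / 2).
  have [hp|hp] := pselect (cube y0 r p); last by exists 1.
  have /cvgrPdist_le/(_ _ e2) h := cF p hp.
  by have [d d0 hd] := near_cube h; exists d; split => // _ y /hd.
pose d p := projT1 (cid (loc p)).
have d0 p : 0 < d p by rewrite /d; case: cid => ? [].
have hd p : cube y0 r p -> forall y, cube p (d p) y -> `|F p - F y| <= e / 2.
  by rewrite /d; case: cid => ? [].
have := @cube_compact y0 r; rewrite compact_cover.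
move=> /(_ V (cube y0 r) (fun p => (cube p (d p / 2))°)).
case=> [p _|p hp|D' D'sub hD'].
- exact: open_interior.
- exists p => //; apply: cube_near; by rewrite divr_gt0.
exists (\big[Num.min/1]_(p <- enum_fset D') (d p / 2)).
  by apply: lt_bigmin => // p _; rewrite divr_gt0.
move=> y a hy ha hya.
have [p pD hpy] := hD' y hy.
have /set_mem hp : p \in cube y0 r by exact: D'sub.
have {}hpy : cube p (d p / 2) y by exact: interior_subset hpy.
have hpy' : cube p (d p) y.
  by apply: cubeS hpy; rewrite ler_pdivrMr// ler_pMr ?ler1n.
have hpa : cube p (d p) a.
  move=> j; have := hpy j; have := hya j => h1 h2.
  have h3 : `|y 0 j - a 0 j| <= d p / 2.
    by apply: le_trans h1 _; exact: (bigmin_seq_le (fun p => d p / 2) 1 pD).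
  have := ler_normB (y 0 j - p 0 j) (y 0 j - a 0 j).
  have -> : y 0 j - p 0 j - (y 0 j - a 0 j) = a 0 j - p 0 j by ring.
  lra.
have h1 := hd p hp y hpy'; have h2 := hd p hp a hpa.
have := ler_normB (F p - F a) (F p - F y).
have -> : F p - F a - (F p - F y) = F y - F a by ring.
lra.
Qed.
End Cubes.

Section FiniteVolume.
Context {R : realType} {n : nat} {M : ptopologicalType}.
Context (S : smooth_structure R n M) (mu : volume_density S).
Local Notation V := 'rV[R]_n.

Definition lower_corner (y0 : V) (r : R) : V := \row_j (y0 0 j - r).
Definition upper_corner (y0 : V) (r : R) : V := \row_j (y0 0 j + r).
Definition half_cube (y0 : V) (r : R) : set V :=
  cell (lower_corner y0 r) (upper_corner y0 r).

Lemma half_cubeP (y0 : V) (r : R) y :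
  half_cube y0 r y <-> forall j, y0 0 j - r <= y 0 j < y0 0 j + r.
Proof. by split=> h j; have := h j; rewrite !mxE. Qed.

Lemma half_cube_sub (y0 : V) (r : R) : half_cube y0 r `<=` cube y0 r.
Proof.
by move=> y /half_cubeP h j; have /andP[h1 h2] := h j; rewrite ler_distl h1 ltW.
Qed.

Lemma sub_half_cube (y0 : V) (r s : R) : s < r -> cube y0 s `<=` half_cube y0 r.
Proof.
move=> sr y h; apply/half_cubeP => j; have := h j; rewrite ler_distl => /andP[h1 h2].
by apply/andP; split; lra.
Qed.

Lemma half_cube_vol (y0 : V) (r : R) :
  cell_vol (lower_corner y0 r) (upper_corner y0 r) = (2 * r) ^+ n.
Proof.
rewrite /cell_vol (eq_bigr (fun=> 2 * r)) ?prodr_const ?card_ord// => j _.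
by rewrite !mxE; ring.
Qed.

Lemma density_near c (y0 : V) (e : R) : charts S c -> img c y0 -> 0 < e ->
  exists2 r, 0 < r & cube y0 r `<=` img c /\
    forall y, cube y0 r y -> `|density mu c y - density mu c y0| <= e.
Proof.
move=> cS iy e0.
have cd : {for y0, continuous (density mu c)}.
  exact: smooth_on_continuous (density_smooth mu cS) iy.
have /cvgrPdist_le/(_ _ e0) h1 := cd.
have h2 := open_near (chart_open_img cS) iy.
have [r r0 hr] := near_cube (filterI h2 h1).
exists r => //; split=> [y /hr[]//|y /hr[_]].
by rewrite distrC.
Qed.

(** By compactness M is covered by finitely many boxes on which the density is
    bounded. *)
Lemma finite_volume : compact [set: M] -> (vol mu setT < +oo)%E.
Proof.
rewrite compact_cover => cM.
have loc (x : M) : exists O : set M, [/\ open O, O x & exists2 A : set (@borel M),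
    measurable A & O `<=` (A : set M) /\ (vol mu A < +oo)%E].
  have [c cS dx] := charts_cover S x; have iy := img_phi dx.
  have [r r0 [sub hd]] := density_near cS iy (@ltr01 R).
  set y0 := phi c x in iy sub hd.
  exists [set z | dom c z /\ (cube y0 (r / 2))° (phi c z)]; split.
  - by apply: (open_phi_preimage cS); exact: open_interior.
  - by split => //; apply: cube_near; rewrite divr_gt0.
  exists (chart_set c (half_cube y0 r)); first exact: (chart_set_cell_measurable _ _ cS).
  split.
    move=> z [dz hz]; split => //; apply: (@sub_half_cube _ _ (r / 2)).
      by rewrite ltr_pdivrMr// mulr_natr mulr2n ltrDr.
    exact: interior_subset hz.
  have h1 : half_cube y0 r `<=` img c by move=> y /half_cube_sub/sub.
  have h2 j : lower_corner y0 r 0 j <= upper_corner y0 r 0 j by rewrite !mxE; lra.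
  have h3 y : half_cube y0 r y -> 0 <= density mu c y <= density mu c y0 + 1.
    move=> /half_cube_sub hy; rewrite (ltW (density_gt0 mu cS (sub y hy)))/=.
    by have := hd y hy; rewrite ler_distl => /andP[].
  have /andP[_ h] := vol_cell_bounds cS h1 h2 (lexx 0) h3.
  by apply: le_lt_trans h _; exact: ltry.
pose O x := projT1 (cid (loc x)).
have hO x : [/\ open (O x), O x x & exists2 A : set (@borel M),
    measurable A & O x `<=` (A : set M) /\ (vol mu A < +oo)%E].
  by rewrite /O; case: cid.
have [x _|x _|D' _ hD'] := cM M setT O.
- by have [] := hO x.
- by exists x => //; have [] := hO x.
have hA x := let: And3 _ _ h := hO x in h.
pose A x := s2val (cid2 (hA x)).
have mA x : measurable (A x) by rewrite /A; case: cid2.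
have OA x : O x `<=` (A x : set M) by rewrite /A; case: cid2 => ? ? [].
have vA x : (vol mu (A x) < +oo)%E by rewrite /A; case: cid2 => ? ? [].
have -> : setT = \big[setU/set0]_(x <- D') A x.
  rewrite -bigcup_seq; apply/seteqP; split=> // z _; have [x xD Oz] := hD' z I.
  by exists x => //; exact: OA.
elim: (finmap.enum_fset D') => [|x s IH]; first by rewrite big_nil measure0.
rewrite big_cons; apply: le_lt_trans (measureU2 _ _ _) _ => //.
  by elim: s {IH} => [|z s IH]; rewrite ?big_nil ?big_cons//; exact: measurableU.
by apply: lte_add_pinfty; [exact: vA|exact: IH].
Qed.
End FiniteVolume.

(** * Mean squares over a cube *)

Section Riemann.
Context {R : realType} {n : nat} {M : ptopologicalType}.
Context (S : smooth_structure R n M) (mu : volume_density S).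
Local Notation V := 'rV[R]_n.
Local Notation C := R[i].
Hypothesis fin : (vol mu setT < +oo)%E.
Context (c : chart R n M) (cS : charts S c) (y0 : V) (r lo hi : R).
Hypothesis r0 : 0 < r.
Hypothesis sub : cube y0 r `<=` img c.
Hypothesis lo0 : 0 < lo.
Hypothesis hd : forall y, cube y0 r y -> lo <= density mu c y <= hi.

(** The half-open cube is the disjoint union of the cells of each grid. *)
Definition cubeX : set (@borel M) := chart_set c (half_cube y0 r).

Lemma cubeX_measurable : measurable cubeX.
Proof. exact: (chart_set_cell_measurable _ _ cS). Qed.

Definition cutoff (F : V -> R) (x : @borel M) : R :=
  if `[< cubeX x >] then F (phi c x) else 0.

Lemma cutoffE F x : cubeX x -> cutoff F x = F (phi c x).
Proof. by rewrite /cutoff; case: asboolP. Qed.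

Lemma cutoff_out F x : ~ cubeX x -> cutoff F x = 0.
Proof. by rewrite /cutoff; case: asboolP. Qed.

Lemma cube_bounded (F : V -> R) : (forall y, img c y -> {for y, continuous F}) ->
  exists K : R, forall y, cube y0 r y -> `|F y| <= K.
Proof.
move=> cF.
have h : compact (F @` cube y0 r).
  apply: continuous_compact; last exact: cube_compact.
  by apply: continuous_in_subspaceT => y; rewrite inE => /sub; exact: cF.
have [K [_ hK]] := compact_bounded h.
exists (K + 1) => y hy; apply: (hK (K + 1)); first by rewrite ltrDl.
by exists y.
Qed.

Lemma bmeas_cutoff (F : V -> R) : (forall y, img c y -> {for y, continuous F}) ->
  bmeas (cutoff F).
Proof.
move=> cF; split; last first.
  have [K hK] := cube_bounded cF.
  exists (`|K|) => x; have [hx|hx] := pselect (cubeX x); last by rewrite cutoff_out// normr0.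
  rewrite cutoffE//; apply: le_trans (ler_norm K).
  by apply: hK; apply: half_cube_sub; case: hx.
have md : measurable (dom c : set (@borel M)).
  by apply: open_measurable_borel; exact: (chart_open_dom cS).
have mF : measurable_fun (dom c : set (@borel M)) (fun x : @borel M => F (phi c x)).
  apply: (measurability _ (RGenOpens.measurableE R)).
  move=> _ [_ [a [b ->] <-]]; apply: open_measurable_borel.
  rewrite openE => x [dx hx].
  have cx : {for (x : M), continuous (fun x : M => F (phi c x))}.
    apply: (@continuous_comp _ _ _ (phi c) F).
      exact: (chart_phi_continuous cS).
    by apply: cF; exact: img_phi.
  apply: filterI.
    by apply: open_nbhs_nbhs; split => //; exact: (chart_open_dom cS).
  by apply: cx; apply: open_nbhs_nbhs; split; [exact: interval_open|exact: hx].
have mX : measurable_fun cubeX (fun x : @borel M => F (phi c x)).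
  by apply: measurable_funS mF => // x [].
have -> : cutoff F = (fun x => F (phi c x)) \_ cubeX.
  apply/funext => x; rewrite /cutoff /patch; case: asboolP => hx.
    by rewrite mem_set.
  by rewrite memNset.
by apply/(measurable_restrictT _ cubeX_measurable).
Qed.

Section Grid.
Context (G : nat) (G0 : (0 < G)%N).
Local Notation node := (grid_node y0 r G).

Definition node_next (l : {ffun 'I_n -> 'I_G}) : V := \row_j node j (l j).+1.
Definition grid_cell (l : {ffun 'I_n -> 'I_G}) : set V := cell (grid y0 r l) (node_next l).

Let Gr : 0 < G%:R :> R. Proof. by rewrite ltr0n. Qed.

Lemma node_le j k l : (k <= l)%N -> node j k <= node j l.
Proof.
move=> kl; rewrite /grid_node lerD2l ler_pM2l ?mulr_gt0// ler_pM2r ?invr_gt0//.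
by rewrite ler_nat.
Qed.

Lemma node0 j : node j 0 = y0 0 j - r.
Proof. by rewrite /grid_node mul0r mulr0 addr0. Qed.

Lemma nodeG j : node j G = y0 0 j + r.
Proof. by rewrite /grid_node divff ?gt_eqF// mulr1; ring. Qed.

Lemma grid_cellP l y : grid_cell l y <-> forall j, node j (l j) <= y 0 j < node j (l j).+1.
Proof. by split=> h j; have := h j; rewrite !mxE. Qed.

Lemma grid_cell_sub l : grid_cell l `<=` half_cube y0 r.
Proof.
move=> y /grid_cellP h; apply/half_cubeP => j; have /andP[h1 h2] := h j.
rewrite -node0 -nodeG (le_trans (node_le j (leq0n _)) h1)/=.
by apply: lt_le_trans h2 _; apply: node_le.
Qed.

Lemma grid_cell_vol l : cell_vol (grid y0 r l) (node_next l) = (2 * r / G%:R) ^+ n.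
Proof.
rewrite /cell_vol (eq_bigr (fun=> 2 * r / G%:R)) ?prodr_const ?card_ord// => j _.
rewrite !mxE /grid_node -natr1; field; by rewrite gt_eqF.
Qed.

Let u (y : V) j : R := (y 0 j - (y0 0 j - r)) / (2 * r) * G%:R.

Let nodeP (y : V) j k : (node j k <= y 0 j < node j k.+1) = (k%:R <= u y j < k.+1%:R).
Proof.
have r2 : 0 < 2 * r by rewrite mulr_gt0.
have E (q : nat) : node j q = y0 0 j - r + 2 * r / G%:R * q%:R.
  by rewrite /grid_node; ring.
have w0 : 0 < 2 * r / G%:R by rewrite divr_gt0.
have uE : y 0 j = y0 0 j - r + 2 * r / G%:R * u y j.
  rewrite /u; field; by rewrite !gt_eqF.
by rewrite !E [in LHS]uE lerD2l ltrD2l ler_pM2l// ltr_pM2l.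
Qed.

Lemma grid_cell_ex y : half_cube y0 r y -> exists l, grid_cell l y.
Proof.
move=> /half_cubeP hy.
have r2 : 0 < 2 * r by rewrite mulr_gt0.
have u0 j : 0 <= u y j.
  have /andP[h _] := hy j; by rewrite /u mulr_ge0 ?divr_ge0 ?subr_ge0// ltW.
have uG j : (Num.trunc (u y j) < G)%N.
  rewrite truncn_lt_nat// /u gtr_pMl// ltr_pdivrMr// mul1r.
  have /andP[_ h] := hy j; lra.
exists [ffun j => Ordinal (uG j)]; apply/grid_cellP => j.
by rewrite nodeP ffunE/=; exact: truncn_itv.
Qed.

Lemma grid_cell_uniq y l l' : grid_cell l y -> grid_cell l' y -> l = l'.
Proof.
move=> /grid_cellP h /grid_cellP h'; apply/ffunP => j; apply/val_inj => /=.
have := h j; have := h' j; rewrite !nodeP => /truncn_def <- /truncn_def <-.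
by [].
Qed.

Lemma grid_cell_diam y l j : grid_cell l y -> `|y 0 j - grid y0 r l 0 j| <= 2 * r / G%:R.
Proof.
move=> /grid_cellP/(_ j)/andP[h1 h2]; rewrite mxE ger0_norm ?subr_ge0//.
rewrite lerBlDl; apply: ltW; apply: lt_le_trans h2 _.
by rewrite le_eqVlt /grid_node -natr1; apply/orP; left; apply/eqP; ring.
Qed.

Definition stepX (w : {ffun 'I_n -> 'I_G} -> R) (x : @borel M) : R :=
  \sum_l w l * \1_(chart_set c (grid_cell l)) x.

Lemma stepXE w x l : dom c x -> grid_cell l (phi c x) -> stepX w x = w l.
Proof.
move=> dx hl; rewrite /stepX (bigD1 l)//= indicE mem_set// mulr1 big1 ?addr0// => k kl.
rewrite indicE memNset ?mulr0// => -[_ hk]; move/eqP: kl; apply.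
exact: grid_cell_uniq hk hl.
Qed.

Lemma stepX_out w x : ~ cubeX x -> stepX w x = 0.
Proof.
move=> hx; rewrite /stepX big1// => k _; rewrite indicE memNset ?mulr0// => -[dx hk].
by apply: hx; split => //; exact: grid_cell_sub hk.
Qed.

Lemma grid_cell_measurable l : measurable (chart_set c (grid_cell l)).
Proof. exact: (chart_set_cell_measurable _ _ cS). Qed.

Lemma bmeas_stepX w : bmeas (stepX w).
Proof.
apply: bmeas_sum => l _; apply: bmeasZ; apply: bmeas_indic.
exact: grid_cell_measurable.
Qed.

Definition grid_vol l : R := fine (vol mu (chart_set c (grid_cell l))).

Lemma Int_stepX w : Int (vol mu) (stepX w) = \sum_l w l * grid_vol l.
Proof.
rewrite /stepX Int_sum//; last first.
  by move=> l _; apply: bmeasZ; apply: bmeas_indic; exact: grid_cell_measurable.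
apply: eq_bigr => l _; rewrite IntZ//; last by apply: bmeas_indic; exact: grid_cell_measurable.
by rewrite Int_indic//; exact: grid_cell_measurable.
Qed.

Lemma grid_vol_bounds l :
  lo * (2 * r / G%:R) ^+ n <= grid_vol l <= hi * (2 * r / G%:R) ^+ n.
Proof.
have h1 : grid_cell l `<=` img c by move=> y /grid_cell_sub/half_cube_sub/sub.
have h2 j : grid y0 r l 0 j <= node_next l 0 j by rewrite !mxE; exact: node_le.
have h3 y : grid_cell l y -> lo <= density mu c y <= hi.
  by move=> /grid_cell_sub/half_cube_sub/hd.
have /andP[v1 v2] := vol_cell_bounds cS h1 h2 (ltW lo0) h3.
rewrite !grid_cell_vol in v1 v2.
have vf : vol mu (chart_set c (grid_cell l)) \is a fin_num.
  rewrite ge0_fin_numE// ; apply: le_lt_trans v2 _; exact: ltry.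
by rewrite -!lee_fin /grid_vol fineK// v1 v2.
Qed.
End Grid.

(** The cells of a fine grid have their volume pinched between lo and hi times
    the Lebesgue measure, and F is almost constant on each of them. The
    averages of F over the grids are given as a hypothesis because Parseval's
    identity makes them independent of the grid. *)
Lemma riemann (F : V -> R) (A : R) (G1 : nat) :
  (forall y, img c y -> {for y, continuous F}) -> (forall y, 0 <= F y) ->
  (forall G, (G1 <= G)%N -> \sum_(l : {ffun 'I_n -> 'I_G}) F (grid y0 r l) = (G ^ n)%:R * A) ->
  lo * (2 * r) ^+ n * A <= Int (vol mu) (cutoff F) <= hi * (2 * r) ^+ n * A.
Proof.
move=> cF F0 hA; set L := (2 * r) ^+ n.
have lohi : lo <= hi.
  have h : cube y0 r y0 by move=> j; rewrite subrr normr0 ltW.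
  by have /andP[h1 h2] := hd h; exact: le_trans h1 h2.
have hi0 : 0 < hi := lt_le_trans lo0 lohi.
have L0 : 0 < L by rewrite exprn_gt0// mulr_gt0.
have key e : 0 < e -> lo * L * A - e <= Int (vol mu) (cutoff F) <= hi * L * A + e.
  move=> e0; pose d := e / (hi * L).
  have hL : 0 < hi * L by rewrite mulr_gt0.
  have d0 : 0 < d by rewrite divr_gt0.
  have [s s0 hs] := cube_uniform d0 (fun y hy => cF y (sub hy)).
  pose G := maxn G1 (Num.trunc (2 * r / s)).+1.
  have G0 : (0 < G)%N by rewrite leq_max orbT.
  have Gr : 0 < G%:R :> R by rewrite ltr0n.
  have Gs : 2 * r / G%:R <= s.
    rewrite ler_pdivrMr// [leRHS]mulrC -ler_pdivrMr//.
    have q0 : 0 <= 2 * r / s by rewrite divr_ge0 ?mulr_ge0// ltW.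
    have /andP[_ /ltW h] := truncn_itv q0; apply: le_trans h _.
    by rewrite ler_nat leq_max leqnn orbT.
  have hG := hA G (leq_maxl _ _).
  pose v := (2 * r / G%:R) ^+ n.
  have v0 : 0 < v by rewrite exprn_gt0// divr_gt0// mulr_gt0.
  have vG : v * (G ^ n)%:R = L by rewrite /v natrX -exprMn divfK// gt_eqF.
  have near x (l : {ffun 'I_n -> 'I_G}) : dom c x -> grid_cell l (phi c x) ->
      `|F (phi c x) - F (grid y0 r l)| <= d.
    move=> dx hl; apply: hs.
    - exact: half_cube_sub (grid_cell_sub G0 hl).
    - exact: grid_cube.
    - by move=> j; exact: le_trans (grid_cell_diam j hl) Gs.
  have svol : \sum_(l : {ffun 'I_n -> 'I_G}) grid_vol l <= hi * L.
    apply: (@le_trans _ _ (\sum_(l : {ffun 'I_n -> 'I_G}) hi * v)).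
      by apply: ler_sum => l _; have /andP[] := grid_vol_bounds G0 l.
    by rewrite sumr_const card_ffun !card_ord -mulr_natr -mulrA vG.
  have dv : d * \sum_l grid_vol (G := G) l <= e.
    apply: le_trans (ler_wpM2l (ltW d0) svol) _.
    by rewrite /d divfK// gt_eqF.
  apply/andP; split.
  - apply: (@le_trans _ _ (Int (vol mu) (stepX (fun l : {ffun 'I_n -> 'I_G} => F (grid y0 r l) - d)))).
      rewrite Int_stepX (eq_bigr (fun l => F (grid y0 r l) * grid_vol l - d * grid_vol l)); last first.
        by move=> l _; rewrite mulrBl.
      rewrite sumrB -mulr_sumr lerB//.
      apply: (@le_trans _ _ (\sum_(l : {ffun 'I_n -> 'I_G}) F (grid y0 r l) * (lo * v))).
        by rewrite -mulr_suml hG -vG le_eqVlt; apply/orP; left; apply/eqP; ring.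
      apply: ler_sum => l _; rewrite ler_wpM2l//.
      by have /andP[] := grid_vol_bounds G0 l.
    apply: Int_le => //; [exact: bmeas_stepX|exact: bmeas_cutoff|move=> x].
    have [hx|hx] := pselect (cubeX x); last by rewrite stepX_out// cutoff_out.
    have [dx hx'] := hx; have [l hl] := grid_cell_ex G0 hx'.
    rewrite (stepXE G0 _ dx hl) cutoffE//; have := near x l dx hl.
    by rewrite ler_distl => /andP[]; lra.
  - apply: (@le_trans _ _ (Int (vol mu) (stepX (fun l : {ffun 'I_n -> 'I_G} => F (grid y0 r l) + d)))); last first.
      rewrite Int_stepX (eq_bigr (fun l => F (grid y0 r l) * grid_vol l + d * grid_vol l)); last first.
        by move=> l _; rewrite mulrDl.
      rewrite big_split/= -mulr_sumr lerD//.
      apply: (@le_trans _ _ (\sum_(l : {ffun 'I_n -> 'I_G}) F (grid y0 r l) * (hi * v))).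
        apply: ler_sum => l _; rewrite ler_wpM2l//.
        by have /andP[] := grid_vol_bounds G0 l.
      by rewrite -mulr_suml hG -vG le_eqVlt; apply/orP; left; apply/eqP; ring.
    apply: Int_le => //; [exact: bmeas_cutoff|exact: bmeas_stepX|move=> x].
    have [hx|hx] := pselect (cubeX x); last by rewrite stepX_out// cutoff_out.
    have [dx hx'] := hx; have [l hl] := grid_cell_ex G0 hx'.
    rewrite (stepXE G0 _ dx hl) cutoffE//; have := near x l dx hl.
    by rewrite ler_distl => /andP[]; lra.
apply/andP; split; apply/ler_addgt0Pr => e e0; have /andP[h1 h2] := key e e0; lra.
Qed.

(** Up to the distortion of the density, the waves are orthogonal on the cube.
    *)
Lemma trig_norm N s (k : {ffun 'I_n -> 'I_N} -> C) :
  lo * (2 * r) ^+ n * (\sum_f sqn (k f)) <= Int (vol mu) (cutoff (fun y => sqn (trig r s k y)))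
    <= hi * (2 * r) ^+ n * (\sum_f sqn (k f)).
Proof.
apply: (riemann (G1 := N)).
- move=> y _.
  have [h1 h2] : smooth_onC [set: V] (trig r s k).
    apply: smooth_onC_sum; first exact: openT.
    move=> f _; apply: smooth_onCM; first exact: openT.
      exact: smooth_onC_cst.
    by apply: smooth_wave; exact: openT.
  have c1 := smooth_on_continuous h1 (I : setT y).
  have c2 := smooth_on_continuous h2 (I : setT y).
  by apply: continuousD; apply: continuousM.
- by move=> y; exact: sqn_ge0.
- by move=> G NG; rewrite grid_mean_square.
Qed.
End Riemann.

(** * The real inner product of L^2 *)

Section Dot.
Context {R : realType}.
Local Notation C := R[i].

(** The real part of z times the conjugate of w. *)
Definition dot2 (z w : C) : R :=
  complex.Re z * complex.Re w + complex.Im z * complex.Im w.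

Lemma dot2E (z w : C) : dot2 z w = complex.Re (z * w^*%C).
Proof. by case: z => a b; case: w => c d; rewrite /dot2 /= mulrN opprK. Qed.

Lemma dot2_sqn (z : C) : dot2 z z = sqn z.
Proof. by rewrite /dot2 /sqn !expr2. Qed.
End Dot.

Section InnerProduct.
Context {R : realType} {n : nat} {M : ptopologicalType}.
Context (S : smooth_structure R n M) (mu : volume_density S).
Local Notation C := R[i].
Hypothesis fin : (vol mu setT < +oo)%E.

(** Complex functions as a vector space over R. *)
Definition cfun : Type := M -> Rcomplex R.
HB.instance Definition _ := GRing.Lmodule.on cfun.

Definition cbm (u : cfun) : Prop :=
  bmeas (fun x : @borel M => complex.Re (u x)) /\
  bmeas (fun x : @borel M => complex.Im (u x)).

Definition l2dot (u v : cfun) : R := Int (vol mu) (fun x => dot2 (u x) (v x)).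

Lemma cbm_dot u v : cbm u -> cbm v -> bmeas (fun x : @borel M => dot2 (u x) (v x)).
Proof. by move=> [u1 u2] [v1 v2]; apply: bmeasD; apply: bmeasM. Qed.

Lemma cbmD u v : cbm u -> cbm v -> cbm (u + v).
Proof.
move=> [u1 u2] [v1 v2]; split.
- have -> : (fun x : @borel M => complex.Re ((u + v) x)) =
     fun x => complex.Re (u x) + complex.Re (v x).
    by apply/funext => x; rewrite -cReD.
  exact: bmeasD.
- have -> : (fun x : @borel M => complex.Im ((u + v) x)) =
     fun x => complex.Im (u x) + complex.Im (v x).
    by apply/funext => x; rewrite -cImD.
  exact: bmeasD.
Qed.

Lemma cfun_scaleE (a : R) (u : cfun) x :
  (complex.Re ((a *: u) x) = a * complex.Re (u x)) *
  (complex.Im ((a *: u) x) = a * complex.Im (u x)).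
Proof. by rewrite /GRing.scale/=; case: (u x). Qed.

Lemma cbmZ (a : R) u : cbm u -> cbm (a *: u).
Proof.
move=> [u1 u2]; split.
- have -> : (fun x : @borel M => complex.Re ((a *: u) x)) = fun x => a * complex.Re (u x).
    by apply/funext => x; rewrite cfun_scaleE.
  exact: bmeasZ.
- have -> : (fun x : @borel M => complex.Im ((a *: u) x)) = fun x => a * complex.Im (u x).
    by apply/funext => x; rewrite cfun_scaleE.
  exact: bmeasZ.
Qed.

Lemma cbm0 : cbm 0.
Proof. by split; apply: bmeas_cst. Qed.

Lemma l2dot_semi_inner : semi_inner cbm l2dot.
Proof.
split.
- exact: cbm0.
- exact: cbmD.
- exact: cbmZ.
- move=> u v w hu hv hw; rewrite /l2dot -IntD//; try exact: cbm_dot.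
  congr Int; apply/funext => x; rewrite /dot2.
  have -> : complex.Re ((u + v) x) = complex.Re (u x) + complex.Re (v x) by rewrite -cReD.
  have -> : complex.Im ((u + v) x) = complex.Im (u x) + complex.Im (v x) by rewrite -cImD.
  ring.
- move=> a u w hu hw; rewrite /l2dot -IntZ//; last exact: cbm_dot.
  by congr Int; apply/funext => x; rewrite /dot2 !cfun_scaleE; ring.
- move=> u v hu hv; rewrite /l2dot; congr Int; apply/funext => x; rewrite /dot2; ring.
- by move=> u hu; apply: Int_ge0 => x; rewrite dot2_sqn sqn_ge0.
Qed.

Lemma l2dot_sqn u : l2dot u u = Int (vol mu) (fun x => sqn (u x)).
Proof. by congr Int; apply/funext => x; rewrite dot2_sqn. Qed.

Lemma cbm_sqn u : cbm u -> bmeas (fun x : @borel M => sqn (u x)).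
Proof.
move=> hu; have := cbm_dot hu hu.
by congr (bmeas _); apply/funext => x; rewrite dot2_sqn.
Qed.

Lemma l2_le u v : cbm u -> cbm v -> (forall x, sqn (u x) <= sqn (v x)) ->
  l2dot u u <= l2dot v v.
Proof.
by move=> hu hv h; rewrite !l2dot_sqn; apply: Int_le => //; exact: cbm_sqn.
Qed.

Section Compact.
Hypothesis cM : compact [set: M].

Lemma continuous_bmeas (f : M -> R) : continuous f -> bmeas (f : @borel M -> R).
Proof.
move=> cf; split; first exact: continuous_measurable_borel.
have h : compact (f @` [set: M]).
  by apply: continuous_compact => //; apply: continuous_subspaceT.
have [K [_ hK]] := compact_bounded h.
by exists (K + 1) => x; apply: (hK (K + 1)); [rewrite ltrDl|exists x].
Qed.

Lemma smooth_cbm (u : M -> C) : smooth_fun S u -> cbm u.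
Proof.
by move=> su; split; apply: continuous_bmeas => x; have [] := smooth_fun_continuous x su.
Qed.
End Compact.

Section Cut.
Context (c : chart R n M) (cS : charts S c) (y0 : 'rV[R]_n) (r : R).
Hypothesis r0 : 0 < r.
Hypothesis sub : cube y0 r `<=` img c.

(** The sharp cutoff turns mean squares over the cube into norms on M; as it
    leaves the class of continuous functions, the estimates take place in
    bounded measurable ones. *)
Definition mcut (h : 'rV[R]_n -> C) : cfun := fun x =>
  if `[< cubeX c y0 r x >] then h (phi c x) else 0.

Lemma mcutE h x : cubeX c y0 r x -> mcut h x = h (phi c x).
Proof. by rewrite /mcut; case: asboolP. Qed.

Lemma mcut_out h x : ~ cubeX c y0 r x -> mcut h x = 0.
Proof. by rewrite /mcut; case: asboolP. Qed.

Definition ccont (h : 'rV[R]_n -> C) : Prop := forall y, img c y ->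
  {for y, continuous (fun z => complex.Re (h z))} /\
  {for y, continuous (fun z => complex.Im (h z))}.

Lemma smooth_onC_ccont h : smooth_onC (img c) h -> ccont h.
Proof.
by move=> [h1 h2] y iy; split; [exact: smooth_on_continuous h1 iy|exact: smooth_on_continuous h2 iy].
Qed.

Lemma mcut_cbm h : ccont h -> cbm (mcut h).
Proof.
move=> ch; split.
- have -> : (fun x : @borel M => complex.Re (mcut h x)) = cutoff c y0 r (fun z => complex.Re (h z)).
    apply/funext => x; have [hx|hx] := pselect (cubeX c y0 r x);
      [by rewrite mcutE// cutoffE|by rewrite mcut_out// cutoff_out].
  by apply: (bmeas_cutoff cS sub) => y iy; have [] := ch y iy.
- have -> : (fun x : @borel M => complex.Im (mcut h x)) = cutoff c y0 r (fun z => complex.Im (h z)).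
    apply/funext => x; have [hx|hx] := pselect (cubeX c y0 r x);
      [by rewrite mcutE// cutoffE|by rewrite mcut_out// cutoff_out].
  by apply: (bmeas_cutoff cS sub) => y iy; have [] := ch y iy.
Qed.

Lemma mcut_sqn h x : sqn (mcut h x) = cutoff c y0 r (fun z => sqn (h z)) x.
Proof.
have [hx|hx] := pselect (cubeX c y0 r x); first by rewrite mcutE// cutoffE.
by rewrite mcut_out// cutoff_out// /sqn /= expr0n addr0.
Qed.

Lemma l2_mcut h : l2dot (mcut h) (mcut h) = Int (vol mu) (cutoff c y0 r (fun z => sqn (h z))).
Proof. by rewrite l2dot_sqn; congr Int; apply/funext => x; rewrite mcut_sqn. Qed.

Lemma mcutD h k : mcut (fun z => h z + k z) = mcut h + mcut k.
Proof.
apply/funext => x; have [hx|hx] := pselect (cubeX c y0 r x).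
  by rewrite mcutE// /GRing.add/= !mcutE.
rewrite mcut_out// /GRing.add/= !mcut_out//.
by rewrite -[RHS]/((0 : C) + 0) addr0.
Qed.

Lemma mcutB h k : mcut (fun z => h z - k z) = mcut h - mcut k.
Proof.
rewrite mcutD; congr (_ + _); apply/funext => x.
have [hx|hx] := pselect (cubeX c y0 r x); first by rewrite /GRing.opp/= !mcutE.
rewrite /GRing.opp/= !mcut_out//; exact/esym/(@oppr0 C).
Qed.

Lemma mcut_le (K : R) h k : 0 <= K -> ccont h -> ccont k ->
  (forall y, cube y0 r y -> sqn (h y) <= K ^+ 2 * sqn (k y)) ->
  Num.sqrt (l2dot (mcut h) (mcut h)) <= K * Num.sqrt (l2dot (mcut k) (mcut k)).
Proof.
move=> K0 ch ck hk.
have ckm := mcut_cbm ck.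
have -> : K * Num.sqrt (l2dot (mcut k) (mcut k)) =
  Num.sqrt (l2dot (K *: mcut k) (K *: mcut k)).
  by rewrite (gi_NZ l2dot_semi_inner)// sqrtrM ?sqr_ge0// sqrtr_sqr ger0_norm.
apply: ler_wsqrtr; apply: l2_le; [exact: mcut_cbm|exact: cbmZ|move=> x].
rewrite /sqn !cfun_scaleE !exprMn -mulrDr -/(sqn (mcut h x)) -/(sqn (mcut k x)).
rewrite !mcut_sqn; have [hx|hx] := pselect (cubeX c y0 r x); last by rewrite !cutoff_out// mulr0.
by rewrite !cutoffE//; apply: hk; apply: half_cube_sub; case: hx.
Qed.
End Cut.
End InnerProduct.

(** * Ellipticity of the principal symbol *)

Section SymbolBounds.
Context {R : realType} {n : nat}.
Local Notation C := R[i].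
Local Notation V := 'rV[R]_n.

Lemma sqn_prod I (s : seq I) (F : I -> C) :
  sqn (\prod_(i <- s) F i) = \prod_(i <- s) sqn (F i).
Proof.
elim: s => [|i s IH]; first by rewrite !big_nil /sqn /= expr1n expr0n addr0.
by rewrite !big_cons sqnM IH.
Qed.

Lemma sqn_ximono (t : seq 'I_n) (xi : V) : sqn (ximono t xi) <= (`|xi| ^+ size t) ^+ 2.
Proof.
rewrite /ximono sqn_prod; elim: t => [|j t IH]; first by rewrite big_nil expr1n.
rewrite big_cons /= [ `|xi| ^+ _.+1]exprS exprMn; apply: ler_pM => //; first exact: sqn_ge0.
  by apply: prodr_ge0 => i _; exact: sqn_ge0.
rewrite sqnM sqn_real /sqn /= expr0n add0r expr1n mul1r.
by rewrite -real_normK ?num_real// lerXn2r ?nnegrE ?le_coord_norm.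
Qed.

Lemma sqn_i_exp k : sqn ('i%C ^+ k : C) = 1.
Proof.
elim: k => [|k IH]; first by rewrite expr0 /sqn /= expr1n expr0n addr0.
by rewrite exprS sqnM IH mulr1 /sqn /= expr0n add0r expr1n.
Qed.

Lemma sqn_mi_monomial m (a : @multi_index n m) (xi : V) :
  sqn (mi_monomial a xi) <= (`|xi| ^+ mi_length a) ^+ 2.
Proof.
have := sqn_ximono (mi_seq a) xi.
by rewrite size_mi_seq mi_monomial_ximono sqnM sqn_i_exp mul1r.
Qed.

Lemma mi_monomialZ m (a : @multi_index n m) (s : R) (xi : V) :
  mi_monomial a (s *: xi) = (s ^+ mi_length a)%:C%C * mi_monomial a xi.
Proof.
rewrite /mi_monomial -rmorphM/= /mi_length -prodrXr -big_split/=.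
by congr (_%:C)%C; apply: eq_bigr => j _; rewrite mxE exprMn.
Qed.

Lemma smooth_mi_monomial m (a : @multi_index n m) :
  smooth_onC [set: V] (mi_monomial a).
Proof.
apply: smooth_onC_real; apply: smooth_on_prod; first exact: openT.
move=> j _; elim: (nat_of_ord _) => [|k IH].
  apply: (@smooth_on_ext _ _ setT (fun=> 1)) => //; [exact: openT|exact: smooth_on_cst].
apply: (@smooth_on_ext _ _ setT (fun x : V => x 0 j * x 0 j ^+ k)) => //.
- exact: openT.
- by move=> x _; rewrite exprS.
- by apply: smooth_onM => //; [exact: openT|exact: smooth_on_coord].
Qed.

Context {M : ptopologicalType} (S : smooth_structure R n M).
Context (m : nat) (P : diffop S m) (c : chart R n M) (cS : charts S c) (y0 : V).
Hypothesis m0 : (0 < m)%N.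
Hypothesis iy : img c y0.
Hypothesis P_pos : positive_principal_symbol P.

Let q : V -> R := real_symbol P c y0.

Lemma principal_symbolZ (s : R) xi y :
  principal_symbol P c y (s *: xi) = (s ^+ m)%:C%C * principal_symbol P c y xi.
Proof.
rewrite /principal_symbol /symbol mulr_sumr; apply: eq_bigr => a /eqP am.
by rewrite mi_monomialZ am mulrCA.
Qed.

Lemma principal_symbol0 y : principal_symbol P c y 0 = 0.
Proof.
by rewrite -(scale0r 0) principal_symbolZ expr0n (gtn_eqF m0) mul0r.
Qed.

Lemma principal_symbol_real xi : principal_symbol P c y0 xi = (q xi)%:C%C.
Proof.
have [->|xi0] := eqVneq xi 0; first by rewrite /q /real_symbol principal_symbol0.
have := P_pos cS iy xi0; rewrite ltcE => /andP[/eqP /= h _].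
by rewrite /q /real_symbol; case: (principal_symbol _ _ _ _) h => a b /= ->.
Qed.

Lemma real_symbol_gt0 xi : xi != 0 -> 0 < q xi.
Proof. by move=> /(P_pos cS iy); rewrite ltcE => /andP[_]. Qed.

Lemma real_symbolZ s xi : q (s *: xi) = s ^+ m * q xi.
Proof.
apply: (@complexI R); rewrite rmorphM/= -!principal_symbol_real.
exact: principal_symbolZ.
Qed.

Lemma real_symbol_continuous : continuous q.
Proof.
have [h _] : smooth_onC [set: V] (principal_symbol P c y0).
  apply: smooth_onC_sum; first exact: openT.
  move=> a _; apply: smooth_onCM; first exact: openT.
    exact: smooth_onC_cst.
  exact: smooth_mi_monomial.
by move=> xi; exact: (smooth_on_continuous h (I : setT xi)).
Qed.

(** Homogeneity reduces this to the unit sphere, where the positive continuous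
    symbol has a positive minimum. *)
Lemma symbol_elliptic_bound : exists2 c0, 0 < c0 & forall xi, c0 * `|xi| ^+ m <= q xi.
Proof.
pose Sph := [set xi : V | `|xi| = 1].
have [[xi1 hxi1]|ne] := pselect (exists xi, Sph xi); last first.
  exists 1 => // xi; have [->|x0] := eqVneq xi 0.
    rewrite normr0 expr0n gtn_eqF// mulr0.
    by rewrite /q /real_symbol principal_symbol0.
  exfalso; apply: ne; exists (`|xi|^-1 *: xi).
  by rewrite /Sph /= normrZ normfV normr_id mulVf// normr_eq0.
have Sc : compact Sph.
  apply: bounded_closed_compact.
    exists 1; split; first exact: num_real.
    by move=> K K1 x /= ->; exact: ltW.
  have -> : Sph = (fun x : V => `|x|) @^-1` [set 1] by [].
  by apply: closed_comp; [move=> x _; exact: norm_continuous|exact: closed_eq].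
have [xm hm hmin] : exists2 x, x \in Sph & forall t, t \in Sph -> q x <= q t.
  apply: EVT_min_rV => //; first by exists xi1.
  by apply: continuous_subspaceT; exact: real_symbol_continuous.
have xm0 : xm != 0.
  by rewrite -normr_eq0; move: hm; rewrite inE /Sph /= => ->; exact: oner_neq0.
exists (q xm); first exact: real_symbol_gt0.
move=> xi; have [->|x0] := eqVneq xi 0.
  rewrite normr0 expr0n gtn_eqF// mulr0.
  by rewrite /q /real_symbol principal_symbol0.
have nx : `|xi| != 0 by rewrite normr_eq0.
have -> : q xi = q (`|xi| *: (`|xi|^-1 *: xi)) by rewrite scalerA mulfV// scale1r.
rewrite real_symbolZ mulrC ler_wpM2l ?exprn_ge0//; apply: hmin.
by rewrite inE /Sph /= normrZ normfV normr_id mulVf.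
Qed.

(** Ellipticity bounds the Fourier multipliers xi^a / (q xi - i t) of order m
    uniformly in t. *)
Lemma top_multiplier c0 (a : @multi_index n m) t xi : 0 < c0 ->
  (forall xi, c0 * `|xi| ^+ m <= q xi) -> mi_length a = m ->
  sqn (mi_monomial a xi) <= (c0^-1) ^+ 2 * (q xi ^+ 2 + t ^+ 2).
Proof.
move=> c00 hc am; apply: le_trans (sqn_mi_monomial a xi) _; rewrite am.
rewrite mulrDr; apply: ler_wpDr; first by rewrite mulr_ge0 ?sqr_ge0.
rewrite -exprMn lerXn2r ?nnegrE ?exprn_ge0//.
  by rewrite mulr_ge0 ?invr_ge0 ?(ltW c00)// (le_trans _ (hc xi))// mulr_ge0 ?exprn_ge0// ltW.
by rewrite mulrC ler_pdivlMr// mulrC.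
Qed.

(** For monomials of degree less than m the multipliers become small for large
    t: small frequencies are beaten by t, large ones by the missing power of
    xi. *)
Lemma lower_multiplier c0 e : 0 < c0 -> 0 < e ->
  (forall xi, c0 * `|xi| ^+ m <= q xi) ->
  exists2 t0, 0 < t0 & forall t, t0 <= t -> forall (s : seq 'I_n) xi, (size s < m)%N ->
    sqn (ximono s xi) <= e ^+ 2 * (q xi ^+ 2 + t ^+ 2).
Proof.
move=> c00 e0 hc.
pose A := 1 + (e * c0)^-1.
have ec : 0 < e * c0 by rewrite mulr_gt0.
have A1 : 1 <= A by rewrite lerDl invr_ge0 ltW.
have A0 : 0 < A := lt_le_trans ltr01 A1.
exists (A ^+ m.-1 / e); first by rewrite divr_gt0// exprn_gt0.
move=> t ht s xi sm; apply: le_trans (sqn_ximono s xi) _.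
have sm' : (size s <= m.-1)%N by rewrite -ltnS prednK.
have t0 : 0 <= t by apply: le_trans ht; rewrite divr_ge0 ?exprn_ge0// ltW.
have q0 : 0 <= q xi by apply: le_trans (hc xi); rewrite mulr_ge0 ?exprn_ge0// ltW.
have [xA|Ax] := leP `|xi| A.
- rewrite mulrDr; apply: ler_wpDl; first by rewrite mulr_ge0 ?sqr_ge0.
  rewrite -exprMn lerXn2r ?nnegrE ?exprn_ge0 ?mulr_ge0 ?(ltW e0)//.
  apply: (@le_trans _ _ (A ^+ m.-1)); last by rewrite mulrC -ler_pdivrMr.
  apply: (@le_trans _ _ (A ^+ size s)); first by rewrite lerXn2r ?nnegrE// ltW.
  exact: ler_weXn2l.
- rewrite mulrDr; apply: ler_wpDr; first by rewrite mulr_ge0 ?sqr_ge0.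
  rewrite -exprMn lerXn2r ?nnegrE ?exprn_ge0 ?mulr_ge0 ?(ltW e0)//.
  have x1 : 1 <= `|xi| by exact: le_trans A1 (ltW Ax).
  apply: (@le_trans _ _ (`|xi| ^+ m.-1)); first exact: ler_weXn2l.
  apply: le_trans (ler_wpM2l (ltW e0) (hc xi)).
  rewrite -[in leRHS](prednK m0) exprS !mulrA ler_peMl ?exprn_ge0//.
  have : (e * c0)^-1 <= `|xi| by apply: le_trans (ltW Ax); rewrite lerDr.
  by move=> h; have := ler_wpM2l (ltW ec) h; rewrite mulfV ?gt_eqF.
Qed.
End SymbolBounds.

(** * Trigonometric approximation on a cube *)

Section CubeApprox.
Context {R : realType} {n : nat}.
Local Notation C := R[i].
Local Notation V := 'rV[R]_n.
Local Notation normc := ComplexField.Normc.normc.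

Lemma sin_sqr_ge (d u r : R) : 0 < r -> 0 < d -> d <= u -> u <= 2 * r - d ->
  sin (pi / r / 2 * d) ^+ 2 <= sin (pi / r / 2 * u) ^+ 2.
Proof.
move=> r0 d0 du ur.
have k0 : 0 < pi / r / 2 by rewrite !divr_gt0 ?pi_gt0.
set k := pi / r / 2 in k0 *.
have kr : k * (2 * r) = pi by rewrite /k; field; rewrite gt_eqF.
have h1 : k * d <= k * u by rewrite ler_pM2l.
have h2 : k * u <= pi - k * d by rewrite -kr -mulrBr ler_pM2l.
have h0 : 0 < k * d by rewrite mulr_gt0.
have half : k * d <= pi / 2 by lra.
have sd : 0 <= sin (k * d) by apply: sin_ge0_pi; apply/andP; split; have := pi_ge0 R; lra.
have mono x : k * d <= x <= pi / 2 -> sin (k * d) <= sin x.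
  move=> /andP[x1 x2]; have [->//|ne] := eqVneq (k * d) x.
  apply: ltW; rewrite ltr_sin ?in_itv/=; first by rewrite lt_neqAle ne.
    by apply/andP; split; have := pi_ge0 R; lra.
  by apply/andP; split; have := pi_ge0 R; lra.
suff h : sin (k * d) <= sin (k * u).
  by rewrite lerXn2r ?nnegrE// (le_trans sd).
have [ku|ku] := leP (k * u) (pi / 2).
  by apply: mono; rewrite h1.
have -> : sin (k * u) = sin (pi - k * u) by rewrite sinB sinpi cospi mul0r sub0r mulN1r opprK.
by apply: mono; apply/andP; split; lra.
Qed.

Lemma normc_le_parts (z : C) e : `|complex.Re z| <= e / 2 -> `|complex.Im z| <= e / 2 ->
  normc z <= e.
Proof.
move=> h1 h2; have e0 : 0 <= e by have := normr_ge0 (complex.Re z); lra.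
rewrite normcE_sqn -[leRHS]ger0_norm// -sqrtr_sqr; apply: ler_wsqrtr.
rewrite /sqn -(real_normK (num_real (complex.Re z))) -(real_normK (num_real (complex.Im z))).
have := normr_ge0 (complex.Re z); have := normr_ge0 (complex.Im z).
by move: `|complex.Re z| `|complex.Im z| h1 h2 => a b *; nra.
Qed.

(** A function vanishing near the boundary of the cube extends periodically.
    Two points where its values differ are then either close to each other, or
    at a distance for which the periodic function sin^2 of the half angle is
    bounded below, or both near opposite faces, where the values vanish. *)
Lemma cube_trig_approx (F : V -> C) (y0 : V) (r e : R) : 0 < r -> 0 < e ->
  (forall y, cube y0 r y -> {for y, continuous (fun z => complex.Re (F z))} /\
                            {for y, continuous (fun z => complex.Im (F z))}) ->
  (forall (y : V) j, r / 2 <= `|y 0 j - y0 0 j| -> F y = 0) ->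
  exists N s (k : {ffun 'I_n -> 'I_N} -> C),
    forall y, cube y0 r y -> normc (F y - trig r s k y) <= e.
Proof.
move=> r0 e0 cF F0.
have e4 : 0 < e / 2 / 2 by rewrite !divr_gt0.
have [d1 d10 h1] := cube_uniform e4 (fun y hy => (cF y hy).1).
have [d2 d20 h2] := cube_uniform e4 (fun y hy => (cF y hy).2).
pose d := Num.min (r / 2) (Num.min d1 d2).
have d0 : 0 < d by rewrite !lt_min divr_gt0//= d10.
have dr : d <= r / 2 by rewrite ge_min lexx.
have dd1 : d <= d1 by rewrite !ge_min lexx !orbT.
have dd2 : d <= d2 by rewrite !ge_min lexx !orbT.
have near y a : cube y0 r y -> cube y0 r a -> (forall j, `|y 0 j - a 0 j| <= d) ->
    normc (F y - F a) <= e / 2.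
  move=> hy ha hd; apply: normc_le_parts.
    have -> : complex.Re (F y - F a) = complex.Re (F y) - complex.Re (F a).
      by case: (F y) => ? ?; case: (F a).
    by apply: h1 => // j; exact: le_trans (hd j) dd1.
  have -> : complex.Im (F y - F a) = complex.Im (F y) - complex.Im (F a).
    by case: (F y) => ? ?; case: (F a).
  by apply: h2 => // j; exact: le_trans (hd j) dd2.
have [B B0 hB] : exists2 B, 0 <= B & forall y, cube y0 r y -> normc (F y) <= B.
  have bd (f : V -> R) : (forall y, cube y0 r y -> {for y, continuous f}) ->
      exists K : R, forall y, cube y0 r y -> `|f y| <= K.
    move=> cf; have h : compact (f @` cube y0 r).
      apply: continuous_compact; last exact: cube_compact.
      by apply: continuous_in_subspaceT => y; rewrite inE => /cf.
    have [K [_ hK]] := compact_bounded h.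
    by exists (K + 1) => y hy; apply: (hK (K + 1)); [rewrite ltrDl|exists y].
  have [K1 hK1] := bd _ (fun y hy => (cF y hy).1).
  have [K2 hK2] := bd _ (fun y hy => (cF y hy).2).
  exists (2 * (`|K1| + `|K2|)); first by rewrite mulr_ge0// addr_ge0.
  move=> y hy; apply: normc_le_parts.
    have := hK1 y hy; have := ler_norm K1; have := normr_ge0 K2; lra.
  have := hK2 y hy; have := ler_norm K2; have := normr_ge0 K1; lra.
pose s1 := sin (pi / r / 2 * d) ^+ 2.
have s10 : 0 < s1.
  rewrite exprn_gt0//; apply: sin_gt0_pi; rewrite mulr_gt0 ?divr_gt0 ?pi_gt0//=.
  have kr : pi / r / 2 * (2 * r) = pi :> R by field; rewrite gt_eqF.
  by rewrite -[ltRHS]kr ltr_pM2l ?divr_gt0 ?pi_gt0//; lra.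
have e2 : 0 < e / 2 by rewrite divr_gt0.
have c0 : 0 <= 2 * B / s1 by apply: divr_ge0; [exact: mulr_ge0|exact: ltW].
have [] := @trig_approximation _ _ y0 r r0 F (e / 2) (2 * B / s1) e2 c0.
  move=> y a hy ha.
  have sum0 : 0 <= \sum_j sin (pi / r / 2 * (y 0 j - a 0 j)) ^+ 2.
    by apply: sumr_ge0 => j _; exact: sqr_ge0.
  have [hd|hd] := pselect (forall j, `|y 0 j - a 0 j| <= d).
    apply: le_trans (near y a hy ha hd) _; by rewrite lerDl; exact: mulr_ge0.
  have [j hj] : exists j, d < `|y 0 j - a 0 j|.
    by move: hd => /existsNP[j /negP]; rewrite -ltNge => hj; exists j.
  have [hj2|hj2] := leP `|y 0 j - a 0 j| (2 * r - d); last first.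
    have ya : F y = 0 /\ F a = 0.
      have := hy j; have := ha j; rewrite !ler_distl => /andP[a1 a2] /andP[y1 y2].
      move: hj2; rewrite lter_normr => /orP hj2.
      split; apply: (F0 _ j); rewrite ler_normr; case: hj2 => hj2; apply/orP.
      - by left; lra.
      - by right; lra.
      - by right; lra.
      - by left; lra.
    have [-> ->] := ya; rewrite subrr ComplexField.Normc.normc0.
    by apply: addr_ge0; [exact: ltW|exact: mulr_ge0].
  have hs : s1 <= \sum_j sin (pi / r / 2 * (y 0 j - a 0 j)) ^+ 2.
    apply: (@le_trans _ _ (sin (pi / r / 2 * (y 0 j - a 0 j)) ^+ 2)).
      have -> : sin (pi / r / 2 * (y 0 j - a 0 j)) ^+ 2 =
                sin (pi / r / 2 * `|y 0 j - a 0 j|) ^+ 2.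
        have [p|p] := leP 0 (y 0 j - a 0 j); first by rewrite ger0_norm.
        by rewrite ltr0_norm// mulrN sinN sqrrN.
      exact: (sin_sqr_ge r0 d0 (ltW hj) hj2).
    by rewrite [leRHS](bigD1 j)//= lerDl; apply: sumr_ge0 => i _; exact: sqr_ge0.
  apply: (@le_trans _ _ (2 * B)).
    apply: le_trans (le_normcD _ _) _; rewrite normcN.
    have := hB y hy; have := hB a ha; lra.
  apply: (@le_trans _ _ (2 * B / s1 * s1)); first by rewrite divfK// gt_eqF.
  apply: (@le_trans _ _ (2 * B / s1 * \sum_j sin (pi / r / 2 * (y 0 j - a 0 j)) ^+ 2)).
    by rewrite ler_wpM2l.
  by rewrite lerDr; exact: ltW.
move=> N [s [k hk]]; exists N, s, k => y hy.
by apply: le_trans (hk y hy) _; lra.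
Qed.
End CubeApprox.

(** * Fourier multipliers on a cube *)

Section Packets.
Context {R : realType} {n : nat} {M : ptopologicalType}.
Context (S : smooth_structure R n M) (mu : volume_density S).
Context (m : nat) (P : diffop S m).
Local Notation C := R[i].
Local Notation V := 'rV[R]_n.
Hypothesis m0 : (0 < m)%N.
Hypothesis Mh : hausdorff_space M.
Hypothesis P_pos : positive_principal_symbol P.
Hypothesis fin : (vol mu setT < +oo)%E.
Local Notation si := (l2dot_semi_inner fin).
Local Notation norm u := (Num.sqrt (l2dot mu u u)).

Definition multI (u : @cfun R M) : @cfun R M := fun x => 'i%C * u x.

Lemma l2dot_multI (u : @cfun R M) : l2dot mu (multI u) u = 0.
Proof.
rewrite /l2dot.
have -> : (fun x => dot2 (multI u x) (u x)) = fun=> 0.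
  by apply/funext => x; rewrite /dot2 /multI cReM cImM /=; ring.
by rewrite Int_cst mul0r.
Qed.

Lemma cfun_scaleC (a : R) (u : @cfun R M) x : (a *: u) x = a%:C%C * u x :> C.
Proof.
rewrite /GRing.scale/=; case: (u x) => b d /=; apply/eqP; rewrite eq_complex /=.
by apply/andP; split; apply/eqP; ring.
Qed.

Lemma smooth_fun_sum I (s : seq I) (F : I -> M -> C) :
  (forall i, smooth_fun S (F i)) -> smooth_fun S (fun x => \sum_(i <- s) F i x).
Proof.
by move=> h c cS; apply: smooth_onC_sum; [exact: (chart_open_img cS)|move=> i _; exact: h].
Qed.

Lemma dop_sum I (s : seq I) (a : I -> C) (u : I -> M -> C) x :
  (forall i, smooth_fun S (u i)) ->
  P (fun x => \sum_(i <- s) a i * u i x) x = \sum_(i <- s) a i * P (u i) x.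
Proof.
move=> su; elim: s => [|i s IH].
  rewrite big_nil -[RHS](dop0 P x); congr (P _ x).
  by apply/funext => z; rewrite big_nil.
rewrite big_cons -IH -dop_lin//; last first.
  by apply: smooth_fun_sum => j; exact: smooth_funZ.
by congr (P _ x); apply/funext => z; rewrite big_cons.
Qed.

Section OneCube.
Context (c : chart R n M) (cS : charts S c) (y0 : V) (r lo hi : R).
Hypothesis r0 : 0 < r.
Hypothesis sub : cube y0 r `<=` img c.
Hypothesis lo0 : 0 < lo.
Hypothesis hd : forall y, cube y0 r y -> lo <= density mu c y <= hi.
Hypothesis hilo : hi <= 4 * lo.

Lemma smooth_trig N s (k : {ffun 'I_n -> 'I_N} -> C) U : open U -> smooth_onC U (trig r s k).
Proof.
move=> oU; apply: smooth_onC_sum => // f _; apply: smooth_onCM => //.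
  exact: smooth_onC_cst.
exact: smooth_wave.
Qed.

Lemma ccont_trig N s (k : {ffun 'I_n -> 'I_N} -> C) : ccont c (trig r s k).
Proof. by apply: smooth_onC_ccont; apply: smooth_trig; exact: (chart_open_img cS). Qed.

(** The norms are compared with the sums of squares of the coefficients; the
    factor 2 is the square root of the bound 4 on hi / lo. *)
Lemma multiplier_bound N s (k e : {ffun 'I_n -> 'I_N} -> C) (b : R) : 0 <= b ->
  (forall f, sqn (e f) <= b ^+ 2 * sqn (k f)) ->
  norm (mcut c y0 r (trig r s e)) <= 2 * b * norm (mcut c y0 r (trig r s k)).
Proof.
move=> b0 he.
have b2 : 0 <= 2 * b by rewrite mulr_ge0.
rewrite -[X in X * norm _](ger0_norm b2) -sqrtr_sqr -sqrtrM ?sqr_ge0//.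
apply: ler_wsqrtr; rewrite !l2_mcut.
have /andP[_ h1] := trig_norm fin cS r0 sub lo0 hd s e.
have /andP[h2 _] := trig_norm fin cS r0 sub lo0 hd s k.
apply: le_trans h1 _.
have L0 : 0 <= (2 * r) ^+ n by rewrite exprn_ge0// mulr_ge0// ltW.
have hs : \sum_f sqn (e f) <= b ^+ 2 * \sum_f sqn (k f).
  by rewrite mulr_sumr; apply: ler_sum => f _; exact: he.
have k0 : 0 <= \sum_f sqn (k f) by apply: sumr_ge0 => f _; exact: sqn_ge0.
have e0 : 0 <= \sum_f sqn (e f) by apply: sumr_ge0 => f _; exact: sqn_ge0.
apply: (@le_trans _ _ (4 * lo * (2 * r) ^+ n * (b ^+ 2 * \sum_f sqn (k f)))).
  have hi0 : 0 <= hi.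
    have hy : cube y0 r y0 by move=> j; rewrite subrr normr0 ltW.
    by have /andP[h3 h4] := hd hy; exact: le_trans (ltW lo0) (le_trans h3 h4).
  by apply: ler_pM => //; [exact: mulr_ge0|exact: ler_wpM2r].
have := ler_wpM2l (sqr_ge0 (2 * b)) h2.
by apply: le_trans; rewrite le_eqVlt; apply/orP; left; apply/eqP; ring.
Qed.

Lemma ccont_bounded (b : V -> C) : ccont c b ->
  exists2 K, 0 < K & forall y, cube y0 r y -> sqn (b y) <= K ^+ 2.
Proof.
move=> cb.
have cs y : img c y -> {for y, continuous (fun z => sqn (b z))}.
  by move=> iy; have [h1 h2] := cb y iy; apply: continuousD; apply: continuousM.
have [K hK] := cube_bounded sub cs.
exists (1 + `|K|); first by rewrite ltr_wpDr.
move=> y hy; apply: le_trans (ler_norm _) _; apply: le_trans (hK y hy) _.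
apply: le_trans (ler_norm K) _; have := normr_ge0 K; nra.
Qed.

Lemma ccontM (b h : V -> C) : ccont c b -> ccont c h -> ccont c (fun y => b y * h y).
Proof.
move=> cb ch y iy; have [b1 b2] := cb y iy; have [h1 h2] := ch y iy; split.
- have -> : (fun z => complex.Re (b z * h z)) = fun z =>
     complex.Re (b z) * complex.Re (h z) - complex.Im (b z) * complex.Im (h z).
    by apply/funext => z; rewrite cReM.
  by apply: continuousB; apply: continuousM.
- have -> : (fun z => complex.Im (b z * h z)) = fun z =>
     complex.Re (b z) * complex.Im (h z) + complex.Im (b z) * complex.Re (h z).
    by apply/funext => z; rewrite cImM.
  by apply: continuousD; apply: continuousM.
Qed.

Lemma ccontD (b h : V -> C) : ccont c b -> ccont c h -> ccont c (fun y => b y + h y).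
Proof.
move=> cb ch y iy; have [b1 b2] := cb y iy; have [h1 h2] := ch y iy; split.
- have -> : (fun z => complex.Re (b z + h z)) = fun z => complex.Re (b z) + complex.Re (h z).
    by apply/funext => z; rewrite cReD.
  exact: continuousD.
- have -> : (fun z => complex.Im (b z + h z)) = fun z => complex.Im (b z) + complex.Im (h z).
    by apply/funext => z; rewrite cImD.
  exact: continuousD.
Qed.

Lemma ccont_sum I (s : seq I) (Q : pred I) (F : I -> V -> C) :
  (forall i, ccont c (F i)) -> ccont c (fun y => \sum_(i <- s | Q i) F i y).
Proof.
move=> h; elim: s => [|i s IH].
  have -> : (fun y => \sum_(i <- [::] | Q i) F i y) = fun=> 0.
    by apply/funext => y; rewrite big_nil.
  by move=> y _; split; exact: cst_continuous.
have -> : (fun y => \sum_(j <- i :: s | Q j) F j y) =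
    if Q i then (fun y => F i y + \sum_(j <- s | Q j) F j y)
    else (fun y => \sum_(j <- s | Q j) F j y).
  by apply/funext => y; rewrite big_cons; case: (Q i).
by case: (Q i) => //; apply: ccontD.
Qed.

Lemma mcut_norm_mul (b : V -> C) h K : 0 <= K -> ccont c b -> ccont c h ->
  (forall y, cube y0 r y -> sqn (b y) <= K ^+ 2) ->
  norm (mcut c y0 r (fun y => b y * h y)) <= K * norm (mcut c y0 r h).
Proof.
move=> K0 cb ch hb; apply: (mcut_le fin cS sub K0) => //; first exact: ccontM.
by move=> y hy; rewrite sqnM ler_wpM2r ?sqn_ge0//; exact: hb.
Qed.

Let iy0 : img c y0.
Proof. by apply: sub => j; rewrite subrr normr0 ltW. Qed.

Let q : V -> R := real_symbol P c y0.

(** The coefficients of the parametrix: the symbol is frozen at the center of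
    the cube. *)
Definition divided N s (t : R) (k : {ffun 'I_n -> 'I_N} -> C) (f : {ffun 'I_n -> 'I_N}) : C :=
  k f / ((q (freq r s f))%:C%C - 'i%C * t%:C%C).

Lemma sqn_symbol (x t : R) : sqn (x%:C%C - 'i%C * t%:C%C) = x ^+ 2 + t ^+ 2.
Proof. by rewrite /sqn /= ; ring. Qed.

Lemma divided_bound N s t k (f : {ffun 'I_n -> 'I_N}) (z : C) b : 0 < t ->
  sqn z <= b ^+ 2 * (q (freq r s f) ^+ 2 + t ^+ 2) ->
  sqn (divided s t k f * z) <= b ^+ 2 * sqn (k f).
Proof.
move=> t0 hz; rewrite /divided.
set w := (q _)%:C%C - _.
have w2 : sqn w = q (freq r s f) ^+ 2 + t ^+ 2 by exact: sqn_symbol.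
have wp : 0 < sqn w by rewrite w2 ltr_wpDl ?sqr_ge0// exprn_gt0.
have wi : sqn w^-1 = (sqn w)^-1.
  have wn : w != 0 by apply/eqP => w0; move: wp; rewrite w0 /sqn /= expr0n addr0 ltxx.
  apply: (mulIf (x := sqn w)); first by rewrite gt_eqF.
  rewrite -sqnM (mulVf wn) mulVf; last by rewrite gt_eqF.
  by rewrite /sqn /= expr1n expr0n addr0.
rewrite -w2 in hz; rewrite !sqnM wi.
have -> : sqn (k f) * (sqn w)^-1 * sqn z = sqn z / sqn w * sqn (k f) by ring.
by rewrite ler_wpM2r ?sqn_ge0// ler_pdivrMr.
Qed.

(** Each term is a bounded function times a multiplier of degree less than m,
    whose norm is small for large t. *)
Lemma lower_small K L e : lower_symbol (img c) K m L -> 0 < e ->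
  exists2 t0, 0 < t0 & forall t, t0 <= t -> forall N s (k : {ffun 'I_n -> 'I_N} -> C),
    norm (mcut c y0 r (fun y => \sum_f divided s t k f * L (freq r s f) y * wave (freq r s f) y))
    <= e * norm (mcut c y0 r (trig r s k)).
Proof.
move=> hL; elim: hL e => [|p b L0 pm hb hL IH] e e0.
  exists 1 => // t _ N s k.
  have -> : mcut c y0 r (fun y => \sum_f divided s t k f * 0 * wave (freq r s f) y) = 0.
    apply/funext => x; have [hx|hx] := pselect (cubeX c y0 r x); last by rewrite mcut_out.
    by rewrite mcutE// big1// => f _; rewrite mulr0 mul0r.
  by rewrite (gi_0l si cbm0) sqrtr0 mulr_ge0 ?sqrtr_ge0// ltW.
have cb := smooth_onC_ccont hb.1.
have [B B0 hB] := ccont_bounded cb.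
have e2 : 0 < e / 2 by rewrite divr_gt0.
have [t1 t10 h1] := IH _ e2.
have [c0 c00 hc] := symbol_elliptic_bound cS m0 iy0 P_pos.
have eta0 : 0 < e / 2 / (2 * B) by rewrite !divr_gt0// mulr_gt0.
have [t2 t20 h2] := lower_multiplier m0 c00 eta0 hc.
(* The leading monomial of L uses t2, the remaining ones t1. *)
exists (Num.max t1 t2); first by rewrite lt_max t10.
move=> t; rewrite ge_max => /andP[t1t t2t] N s k.
have tp : 0 < t := lt_le_trans t10 t1t.
pose d f := divided s t k f * ximono p (freq r s f).
have -> : (fun y => \sum_f divided s t k f *
      (ximono p (freq r s f) * b y + L0 (freq r s f) y) * wave (freq r s f) y) =
   fun y => b y * trig r s d y +
     \sum_f divided s t k f * L0 (freq r s f) y * wave (freq r s f) y.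
  apply/funext => y; rewrite /trig mulr_sumr -big_split/=; apply: eq_bigr => f _.
  by rewrite /d; ring.
have cL : ccont c (fun y => \sum_f divided s t k f * L0 (freq r s f) y * wave (freq r s f) y).
  apply: ccont_sum => f; apply: smooth_onC_ccont; have oU := chart_open_img cS.
  apply: smooth_onCM => //; last exact: smooth_wave.
  apply: smooth_onCM => //; first exact: smooth_onC_cst.
  exact: lower_symbol_smooth hL.
have cd := ccont_trig s d.
rewrite mcutD; apply: le_trans (gi_triangle si _ _) _.
- by apply: (mcut_cbm cS sub); exact: ccontM.
- exact: (mcut_cbm cS sub).
rewrite [in leRHS](splitr e) mulrDl; apply: lerD; last exact: h1.
apply: le_trans (mcut_norm_mul (ltW B0) cb cd hB) _.
have hm : norm (mcut c y0 r (trig r s d)) <=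
    2 * (e / 2 / (2 * B)) * norm (mcut c y0 r (trig r s k)).
  apply: multiplier_bound; first exact: ltW.
  by move=> f; apply: divided_bound => //; exact: h2.
apply: le_trans (ler_wpM2l (ltW B0) hm) _.
rewrite le_eqVlt; apply/orP; left; apply/eqP; field; by rewrite gt_eqF.
Qed.
End OneCube.
End Packets.

(** * Local parametrix *)

Section Local.
Context {R : realType} {n : nat} {M : ptopologicalType}.
Context (S : smooth_structure R n M) (mu : volume_density S).
Context (m : nat) (P : diffop S m).
Local Notation C := R[i].
Local Notation V := 'rV[R]_n.
Hypothesis m0 : (0 < m)%N.
Hypothesis Mh : hausdorff_space M.
Hypothesis P_pos : positive_principal_symbol P.
Hypothesis fin : (vol mu setT < +oo)%E.
Local Notation si := (l2dot_semi_inner fin).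
Local Notation norm u := (Num.sqrt (l2dot mu u u)).

Section OneCube.
Context (c : chart R n M) (cS : charts S c) (y0 : V) (r : R).
Hypothesis r0 : 0 < r.
Hypothesis sub : cube y0 r `<=` img c.

Definition cbump (y : V) : C := (bump_fun y0 (r / 2) y)%:C%C.

Let r2 : 0 < r / 2. Proof. by rewrite divr_gt0. Qed.
Let Kc : compact (cube y0 (r / 2)). Proof. exact: cube_compact. Qed.
Let Krr : r / 2 < r. Proof. by rewrite ltr_pdivrMr// mulr_natr mulr2n ltrDr. Qed.
Let KU : cube y0 (r / 2) `<=` img c.
Proof. by move=> y hy; apply: sub; apply: cubeS hy; exact: ltW. Qed.

Lemma cbump_out y : ~ cube y0 (r / 2) y -> cbump y = 0.
Proof.
move=> /existsNP[j /negP]; rewrite -ltNge => hj.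
by rewrite /cbump (bump_eq0 r2 (ltW hj)).
Qed.

Lemma coefficient_cbump : coefficient (img c) (cube y0 (r / 2)) cbump.
Proof.
split; last exact: cbump_out.
by apply: smooth_onC_real; apply: smooth_onS (smooth_bump _ _).
Qed.

Lemma notin_cubeX x : ~ cubeX c y0 r x -> ~ (dom c x /\ cube y0 (r / 2) (phi c x)).
Proof. by move=> h [dx hx]; apply: h; split => //; exact: sub_half_cube Krr _ hx. Qed.

Lemma ext_fun_mcut (h : V -> C) : ext_fun c (fun y => cbump y * h y) =
  mcut c y0 r (fun y => cbump y * h y).
Proof.
apply/funext => x; have [hx|hx] := pselect (cubeX c y0 r x).
  by rewrite mcutE// ext_fun_dom//; case: hx.
rewrite mcut_out//; apply: (@ext_fun_out _ _ _ c _ (cube y0 (r / 2))).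
  by move=> y hy; rewrite cbump_out// mul0r.
exact: notin_cubeX.
Qed.

(** What remains of the leading part when its coefficients are frozen at the
    center. *)
Definition top_error N s (k : {ffun 'I_n -> 'I_N} -> C) (y : V) : C :=
  \sum_(a : @multi_index n m | mi_length a == m)
    (coef P c a y - coef P c a y0) *
    (cbump y * trig r s (fun f => k f * mi_monomial a (freq r s f)) y).

Definition packet N s (t : R) (k : {ffun 'I_n -> 'I_N} -> C) : M -> C :=
  ext_fun c (fun y => cbump y * trig r s (divided P c y0 r s t k) y).

Lemma smooth_packet N s t k : smooth_fun S (@packet N s t k).
Proof.
apply: (smooth_ext_fun cS Mh Kc KU); have oU := chart_open_img cS.
  apply: smooth_onCM => //; first exact: coefficient_cbump.1.
  exact: smooth_trig.
by move=> y hy; rewrite cbump_out// mul0r.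
Qed.

(** The division by the frozen symbol undoes the leading part of P - i t,
    which returns the trigonometric polynomial times the cutoff. The shift by
    l counts among the lower-order terms. *)
Lemma shifted_packet (l : R) : exists2 L, lower_symbol (img c) (cube y0 (r / 2)) m L &
  forall t N s (k : {ffun 'I_n -> 'I_N} -> C), 0 < t ->
    shifted (P : @cfun R M -> @cfun R M) (@multI R M) l t (packet s t k) =
    mcut c y0 r (fun y => cbump y * trig r s k y) +
    mcut c y0 r (top_error s (divided P c y0 r s t k)) +
    mcut c y0 r (fun y => \sum_f divided P c y0 r s t k f * L (freq r s f) y * wave (freq r s f) y).
Proof.
have iy0 : img c y0 by apply: sub => j; rewrite subrr normr0 ltW.
have hb := coefficient_cbump; have oU := chart_open_img cS.
have [L hL EL] := dop_wave P cS Mh Kc KU hb.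
have hlb : coefficient (img c) (cube y0 (r / 2)) (fun y => (- l)%:C%C * cbump y).
  by apply: coefficientM => //; exact: smooth_onC_cst.
exists (fun xi y => ximono [::] xi * ((- l)%:C%C * cbump y) + L xi y).
  exact: lower_cons.
move=> t N s k t0; set d := divided P c y0 r s t k.
pose E (f : {ffun 'I_n -> 'I_N}) := ext_fun c (fun z => cbump z * wave (freq r s f) z).
have sE f : smooth_fun S (E f).
  apply: (smooth_ext_fun cS Mh Kc KU).
    by apply: smooth_onCM => //; [exact: hb.1|exact: smooth_wave].
  by move=> y hy; rewrite cbump_out// mul0r.
have pE : packet s t k = fun x => \sum_f d f * E f x.
  apply/funext => x; rewrite /packet /E /ext_fun; case: asboolP => dx.
    by rewrite /trig mulr_sumr; apply: eq_bigr => f _; rewrite mulrCA.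
  by rewrite big1// => f _; rewrite mulr0.
have PE x : P (packet s t k) x = \sum_f d f * P (E f) x by rewrite pE dop_sum.
apply/funext => x.
have -> : shifted (P : @cfun R M -> @cfun R M) (@multI R M) l t (packet s t k) x =
   P (packet s t k) x - l%:C%C * packet s t k x - t%:C%C * ('i%C * packet s t k x) :> C.
  by rewrite /shifted -(cfun_scaleC l (packet s t k) x)
    -(cfun_scaleC t (multI (packet s t k)) x).
rewrite PE [in LHS]pE.
have -> (u v w : @cfun R M) : (u + v + w) x = (u x : C) + v x + w x by [].
have [hx|hx] := pselect (cubeX c y0 r x); last first.
  have nx := notin_cubeX hx.
  have F0 (f : {ffun 'I_n -> 'I_N}) y : ~ cube y0 (r / 2) y -> cbump y * wave (freq r s f) y = 0 :> C.
    by move=> hy; rewrite cbump_out// mul0r.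
  rewrite !mcut_out//.
  have -> : \sum_f d f * P (E f) x = 0.
    rewrite big1// => f _; have hF : smooth_onC (img c) (fun z => cbump z * wave (freq r s f) z).
      by apply: smooth_onCM => //; [exact: hb.1|exact: smooth_wave].
    by rewrite (dop_ext_fun_out P cS Mh Kc KU hF (F0 f) nx) mulr0.
  have -> : \sum_f d f * E f x = 0.
    by rewrite big1// => f _; rewrite /E (ext_fun_out (F0 f) nx) mulr0.
  by rewrite !mulr0 !subr0 !addr0.
have dx : dom c x by case: hx.
have iy := img_phi dx; rewrite !mcutE//; set y := phi c x in iy *.
have EE f : E f x = cbump y * wave (freq r s f) y by rewrite /E ext_fun_dom.
have PEE f : P (E f) x = (principal_symbol P c y (freq r s f) * cbump y + L (freq r s f) y) *
     wave (freq r s f) y.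
  by rewrite -[in LHS](chart_phiK cS dx) EL.
rewrite /top_error.
have -> : \sum_(a : @multi_index n m | mi_length a == m)
    (coef P c a y - coef P c a y0) *
    (cbump y * trig r s (fun f => d f * mi_monomial a (freq r s f)) y) =
  \sum_f d f * (principal_symbol P c y (freq r s f) - principal_symbol P c y0 (freq r s f)) *
     cbump y * wave (freq r s f) y.
  under eq_bigr do rewrite /trig !mulr_sumr.
  rewrite exchange_big/=; apply: eq_bigr => f _.
  rewrite /principal_symbol /symbol -sumrB mulr_sumr !mulr_suml.
  by apply: eq_bigr => a _; ring.
rewrite /trig !mulr_sumr -!sumrB -!big_split/=; apply: eq_bigr => f _.
rewrite EE PEE /ximono big_nil rmorphN/=.
have -> : k f = d f * (principal_symbol P c y0 (freq r s f) - 'i%C * t%:C%C).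
  rewrite (principal_symbol_real cS m0 iy0 P_pos) /d /divided divfK//.
  apply/eqP => w0; have := sqn_symbol (real_symbol P c y0 (freq r s f)) t.
  rewrite w0 /sqn /= expr0n addr0 => /esym/eqP; rewrite gt_eqF//.
  by rewrite ltr_wpDl ?sqr_ge0// exprn_gt0.
ring.
Qed.

Lemma cbump_sqn y : sqn (cbump y) <= 1.
Proof. by rewrite sqn_real expr_le1// ?bump_ge0 ?bump_le1. Qed.

Lemma ccont_cbump : ccont c cbump.
Proof. by apply: smooth_onC_ccont; exact: coefficient_cbump.1. Qed.

Lemma mcut_norm_sum I (s : seq I) (Q : pred I) (F : I -> V -> C) :
  (forall i, ccont c (F i)) ->
  norm (mcut c y0 r (fun y => \sum_(i <- s | Q i) F i y)) <=
  \sum_(i <- s | Q i) norm (mcut c y0 r (F i)).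
Proof.
move=> cF; elim: s => [|i s IH].
  have -> : mcut c y0 r (fun y => \sum_(i <- [::] | Q i) F i y) = 0.
    apply/funext => x; have [hx|hx] := pselect (cubeX c y0 r x); last by rewrite mcut_out.
    by rewrite mcutE// big_nil.
  by rewrite big_nil (gi_0l si cbm0) sqrtr0.
rewrite big_cons; case Qi: (Q i); last first.
  have -> : (fun y => \sum_(j <- i :: s | Q j) F j y) = fun y => \sum_(j <- s | Q j) F j y.
    by apply/funext => y; rewrite big_cons Qi.
  exact: IH.
have -> : (fun y => \sum_(j <- i :: s | Q j) F j y) = fun y => F i y + \sum_(j <- s | Q j) F j y.
  by apply/funext => y; rewrite big_cons Qi.
rewrite mcutD; apply: le_trans (gi_triangle si _ _) _; try apply: (mcut_cbm cS sub) => //.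
  exact: ccont_sum.
by rewrite lerD2l.
Qed.

Lemma sqn_mcut_cbump (f : M -> C) x :
  sqn (mcut c y0 r (fun y => cbump y * f (psi c y)) x) =
  complex.Re (ext_fun c cbump x) ^+ 2 * sqn (f x).
Proof.
have [hx|hx] := pselect (cubeX c y0 r x).
  have dx : dom c x by case: hx.
  by rewrite mcutE// ext_fun_dom// sqnM (chart_phiK cS dx) sqn_real.
rewrite mcut_out// (ext_fun_out cbump_out (notin_cubeX hx)).
by rewrite /sqn /= expr0n addr0 mul0r.
Qed.

Lemma dot_mcut_cbump (h : V -> C) (f : M -> C) :
  l2dot mu (mcut c y0 r (fun y => cbump y * h y)) f =
  l2dot mu (mcut c y0 r h) (mcut c y0 r (fun y => cbump y * f (psi c y))).
Proof.
congr Int; apply/funext => x; have [hx|hx] := pselect (cubeX c y0 r x); last first.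
  by rewrite !mcut_out// /dot2 /= !mul0r.
rewrite !mcutE//; have dx : dom c x by case: hx.
rewrite (chart_phiK cS dx) /cbump /dot2 !cReM !cImM /=; ring.
Qed.

Context (lo hi : R).
Hypothesis lo0 : 0 < lo.
Hypothesis hd : forall y, cube y0 r y -> lo <= density mu c y <= hi.
Hypothesis hilo : hi <= 4 * lo.
Context (c0 : R).
Hypothesis c00 : 0 < c0.
Hypothesis hc : forall xi, c0 * `|xi| ^+ m <= real_symbol P c y0 xi.
Let Q : R := #|{: @multi_index n m}|%:R + 1.
Hypothesis osc : forall (a : @multi_index n m) y, cube y0 r y ->
  sqn (coef P c a y - coef P c a y0) <= (c0 / (8 * Q)) ^+ 2.

Let Q0 : 0 < Q. Proof. by rewrite ltr_wpDl. Qed.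

(** The same error without the cutoff, which can then be moved onto the other
    factor of an inner product. *)
Definition frozen_error N s (k : {ffun 'I_n -> 'I_N} -> C) (y : V) : C :=
  \sum_(a : @multi_index n m | mi_length a == m)
    (coef P c a y - coef P c a y0) *
    trig r s (fun f => k f * mi_monomial a (freq r s f)) y.

Lemma ccont_coef (a : @multi_index n m) : ccont c (fun y => coef P c a y - coef P c a y0).
Proof.
apply: smooth_onC_ccont; apply: smooth_onCD; first exact: (chart_open_img cS).
  exact: coef_smooth.
exact: smooth_onC_cst.
Qed.

Lemma ccont_frozen_error N s (k : {ffun 'I_n -> 'I_N} -> C) : ccont c (frozen_error s k).
Proof.
apply: ccont_sum => a; apply: ccontM; first exact: ccont_coef.
exact: (ccont_trig cS).
Qed.

Lemma top_errorE N s (k : {ffun 'I_n -> 'I_N} -> C) y :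
  top_error s k y = cbump y * frozen_error s k y.
Proof.
by rewrite /top_error /frozen_error mulr_sumr; apply: eq_bigr => a _; rewrite mulrCA.
Qed.

(** There are at most Q leading coefficients, each oscillates by at most
    c0/(8Q), and the corresponding multipliers have norm at most 2/c0. *)
Lemma frozen_error_bound N s t (k : {ffun 'I_n -> 'I_N} -> C) : 0 < t ->
  norm (mcut c y0 r (frozen_error s (divided P c y0 r s t k))) <=
  1 / 4 * norm (mcut c y0 r (trig r s k)).
Proof.
move=> t0; set g := norm (mcut c y0 r (trig r s k)).
have g0 : 0 <= g by exact: sqrtr_ge0.
have ct (a : @multi_index n m) := ccont_trig cS r s (fun f => divided P c y0 r s t k f * mi_monomial a (freq r s f)).
apply: le_trans (mcut_norm_sum _ _ _) _.
  by move=> a; apply: ccontM; [exact: ccont_coef|exact: ct].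
apply: (@le_trans _ _ (\sum_(a : @multi_index n m | mi_length a == m) g / (4 * Q))).
  apply: ler_sum => a /eqP am.
  have k0 : 0 <= c0 / (8 * Q) by rewrite divr_ge0 ?mulr_ge0// ltW.
  apply: le_trans (mcut_norm_mul fin cS sub k0 (ccont_coef a) (ct a) (osc a)) _.
  have hb : norm (mcut c y0 r (trig r s
      (fun f => divided P c y0 r s t k f * mi_monomial a (freq r s f)))) <= 2 * c0^-1 * g.
    apply: (multiplier_bound fin cS r0 sub lo0 hd hilo); first by rewrite invr_ge0 ltW.
    move=> f; apply: divided_bound => //.
    by apply: (top_multiplier _ _ c00 hc am).
  apply: le_trans (ler_wpM2l k0 hb) _.
  rewrite le_eqVlt; apply/orP; left; apply/eqP; field; by rewrite !gt_eqF.
rewrite sumr_const -[leLHS]mulr_natr.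
have cq : #|[pred a : @multi_index n m | mi_length a == m]|%:R <= Q.
  have := max_card [pred a : @multi_index n m | mi_length a == m].
  by rewrite -(ler_nat R) /Q => h; apply: le_trans h _; rewrite lerDl.
have -> : 1 / 4 * g = g / (4 * Q) * Q by field; rewrite gt_eqF.
by apply: ler_wpM2l => //; rewrite divr_ge0// mulr_ge0// ltW.
Qed.

(** The packet u comes from a trigonometric polynomial g close to F = chi f,
    where chi is the cutoff. In the inner product of (P - l - i t) u with f
    the factor chi can be moved onto f. The main term is then close to the
    squared norm of F. The frozen error costs a quarter of it: this error does
    not decrease as t grows, so it is essential to pair it with F, which is
    local, and not with f. The lower-order terms cost a small multiple of the
    squared norm of f. *)
Lemma local_estimate (l e : R) : 0 < e -> exists2 t0, 0 < t0 & forall t, t0 <= t ->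
  forall f : @cfun R M, cbm f -> smooth_fun S f -> exists2 u : @cfun R M, smooth_fun S u &
    2^-1 * Int (vol mu) (fun x : @borel M => complex.Re (ext_fun c cbump x) ^+ 2 * sqn (f x))
      - e * l2dot mu f f <=
    l2dot mu (shifted (P : @cfun R M -> @cfun R M) (@multI R M) l t u) f /\
    norm (shifted (P : @cfun R M -> @cfun R M) (@multI R M) l t u) <= 6 * norm f.
Proof.
move=> e0; pose d := Num.min 1 (e / 4).
have d0 : 0 < d by rewrite lt_min ltr01 divr_gt0.
have d1 : d <= 1 by rewrite ge_min lexx.
have de : 4 * d <= e.
  have : d <= e / 4 by rewrite ge_min lexx orbT.
  lra.
have [L hL EL] := shifted_packet l.
have [t0 t00 ht0] := lower_small m0 P_pos fin cS r0 sub lo0 hd hilo hL d0.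
exists t0 => // t tt f fb fs.
have tp : 0 < t := lt_le_trans t00 tt.
set F := fun y => cbump y * f (psi c y).
have cF : ccont c F.
  apply: ccontM; first exact: ccont_cbump.
  by apply: smooth_onC_ccont; exact: fs.
set Fm := mcut c y0 r F.
have bF : cbm Fm by exact: (mcut_cbm cS sub).
have NF : l2dot mu Fm Fm = Int (vol mu)
   (fun x : @borel M => complex.Re (ext_fun c cbump x) ^+ 2 * sqn (f x)).
  by rewrite l2dot_sqn; congr Int; apply/funext => x; exact: sqn_mcut_cbump.
have Fle : norm Fm <= norm f.
  apply: ler_wsqrtr; apply: (l2_le fin) => // x.
  have [hx|hx] := pselect (cubeX c y0 r x); last first.
    by rewrite /Fm mcut_out// {1}/sqn /= expr0n addr0 sqn_ge0.
  have dx : dom c x by case: hx.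
  rewrite /Fm mcutE// sqnM (chart_phiK cS dx) ler_piMl ?sqn_ge0//.
  exact: cbump_sqn.
rewrite -NF.
have [f0|f0] := eqVneq (l2dot mu f f) 0.
  exists 0; first exact: smooth_fun_cst.
  have P0 : (P : @cfun R M -> @cfun R M) 0 = 0 by apply/funext => x; exact: dop0.
  have J0 : multI (0 : @cfun R M) = 0 by apply/funext => x; exact: mulr0.
  have -> : shifted (P : @cfun R M -> @cfun R M) (@multI R M) l t 0 = 0.
    by rewrite /shifted P0 J0 !scaler0 !subr0.
  have N0 : l2dot mu Fm Fm = 0.
    apply/eqP; rewrite eq_le (gi_ge0 si)// andbT.
    have h : norm Fm <= 0 by rewrite (le_trans Fle)// f0 sqrtr0.
    by rewrite leNgt -sqrtr_gt0 -leNgt.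
  by rewrite !(gi_0l si)//; [rewrite N0 f0 !mulr0 subrr sqrtr0 mulr0|exact: cbm0].
have fp : 0 < l2dot mu f f by rewrite lt_def f0 (gi_ge0 si).
pose vM := fine (vol mu setT).
have vM0 : 0 <= vM by exact: fine_ge0.
(* A precision in the sup norm that gives an L^2 distance of at most d times
   the norm of f. *)
pose e' := d * Num.sqrt (l2dot mu f f / (vM + 1)).
have vM1 : 0 < vM + 1 by rewrite ltr_wpDl.
have e'0 : 0 < e' by rewrite mulr_gt0// sqrtr_gt0 divr_gt0.
have F0 (y : V) j : r / 2 <= `|y 0 j - y0 0 j| -> F y = 0.
  by move=> h; rewrite /F /cbump (bump_eq0 r2 h) mul0r.
have [N [s [k hk]]] := cube_trig_approx r0 e'0 (fun y hy => cF y (sub hy)) F0.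
exists (packet s t k); first exact: smooth_packet.
rewrite EL//; set Gm := mcut c y0 r (trig r s k).
have cg := ccont_trig cS r s k.
have bG : cbm Gm by exact: (mcut_cbm cS sub).
set T2 := mcut c y0 r (top_error _ _).
set T3 := mcut c y0 r (fun y => \sum_f0 _).
set T1 := mcut c y0 r (fun y => cbump y * trig r s k y).
have cE := ccont_frozen_error s (divided P c y0 r s t k).
have ET2 : T2 = mcut c y0 r (fun y => cbump y * frozen_error s (divided P c y0 r s t k) y).
  by congr mcut; apply/funext => y; exact: top_errorE.
have b1 : cbm T1 by apply: (mcut_cbm cS sub); apply: ccontM => //; exact: ccont_cbump.
have b2 : cbm T2.
  by rewrite ET2; apply: (mcut_cbm cS sub); apply: ccontM => //; exact: ccont_cbump.
have b3 : cbm T3.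
  apply: (mcut_cbm cS sub); apply: ccont_sum => f1; apply: smooth_onC_ccont.
  have oU := chart_open_img cS.
  apply: smooth_onCM => //; last exact: smooth_wave.
  apply: smooth_onCM => //; first exact: smooth_onC_cst.
  exact: lower_symbol_smooth hL.
have GF : norm (Gm - Fm) <= d * norm f.
  have -> : d * norm f = Num.sqrt (e' ^+ 2 * (vM + 1)).
    rewrite /e' exprMn sqr_sqrtr; last by rewrite divr_ge0 ?(ltW fp)// ltW.
    rewrite -mulrA divfK ?gt_eqF// sqrtrM ?sqr_ge0// sqrtr_sqr ger0_norm//.
    exact: ltW.
  apply: ler_wsqrtr; rewrite -mcutB l2_mcut.
  apply: (@le_trans _ _ (Int (vol mu) (fun _ : @borel M => e' ^+ 2))); last first.
    by rewrite Int_cst ler_wpM2l ?sqr_ge0// lerDl.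
  apply: Int_le => //.
  - apply: (bmeas_cutoff cS sub) => y iy; have [g1 g2] := cg y iy; have [h1 h2] := cF y iy.
    have h : {for y, continuous (fun z => complex.Re (trig r s k z) - complex.Re (F z))}.
      exact: continuousB.
    have h' : {for y, continuous (fun z => complex.Im (trig r s k z) - complex.Im (F z))}.
      exact: continuousB.
    have -> : (fun z => sqn (trig r s k z - F z)) = fun z =>
        (complex.Re (trig r s k z) - complex.Re (F z)) ^+ 2 +
        (complex.Im (trig r s k z) - complex.Im (F z)) ^+ 2.
      apply/funext => z; rewrite /sqn; by case: (trig r s k z) => ? ?; case: (F z).
    by apply: continuousD; apply: continuousM.
  - exact: bmeas_cst.
  - move=> x; have [hx|hx] := pselect (cubeX c y0 r x); last first.
      by rewrite cutoff_out// sqr_ge0.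
    rewrite cutoffE//; have := hk (phi c x) (half_cube_sub hx.2).
    rewrite normcE_sqn => h.
    have -> : sqn (trig r s k (phi c x) - F (phi c x)) = sqn (F (phi c x) - trig r s k (phi c x)).
      by rewrite /sqn; case: (trig r s k _) => ? ?; case: (F _) => ? ? /=; ring.
    rewrite -[leLHS]sqr_sqrtr ?sqn_ge0// lerXn2r ?nnegrE ?sqrtr_ge0//.
    exact: ltW.
have bGF : cbm (Gm - Fm) by exact: (siB si).
have Gle : norm Gm <= norm Fm + d * norm f.
  have -> : Gm = Fm + (Gm - Fm) by rewrite addrC subrK.
  apply: le_trans (gi_triangle si bF bGF) _; by rewrite lerD2l.
have D1 : l2dot mu Fm Fm - d * norm f * norm Fm <= l2dot mu T1 f.
  rewrite /T1 dot_mcut_cbump -/F -/Gm -/Fm.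
  have -> : Gm = Fm + (Gm - Fm) by rewrite addrC subrK.
  rewrite (giD si)// lerD2l lerNl.
  apply: le_trans (_ : norm (Gm - Fm) * norm Fm <= _); last first.
    by rewrite ler_wpM2r ?sqrtr_ge0.
  apply: le_trans (cauchy_schwarz_sqrt si bGF bF).
  by rewrite -normrN ler_norm.
have frb := frozen_error_bound s k tp; rewrite -/Gm in frb.
have D2 : - (1 / 4 * norm Gm * norm Fm) <= l2dot mu T2 f.
  rewrite ET2 dot_mcut_cbump -/F -/Fm lerNl.
  apply: le_trans (_ : norm (mcut c y0 r (frozen_error s (divided P c y0 r s t k))) * norm Fm <= _); last first.
    by rewrite ler_wpM2r ?sqrtr_ge0.
  apply: le_trans (cauchy_schwarz_sqrt si _ bF); last exact: (mcut_cbm cS sub).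
  by rewrite -normrN ler_norm.
have N3 : norm T3 <= d * norm Gm by exact: ht0.
have D3 : - (d * norm Gm * norm f) <= l2dot mu T3 f.
  rewrite lerNl; apply: le_trans (_ : norm T3 * norm f <= _); last first.
    by rewrite ler_wpM2r ?sqrtr_ge0.
  apply: le_trans (cauchy_schwarz_sqrt si b3 fb).
  by rewrite -normrN ler_norm.
have b1' y : cube y0 r y -> sqn (cbump y) <= 1 ^+ 2 by rewrite expr1n => _; exact: cbump_sqn.
have N1 : norm T1 <= norm Gm.
  by have := mcut_norm_mul fin cS sub ler01 ccont_cbump cg b1'; rewrite mul1r.
have N2 : norm T2 <= 1 / 4 * norm Gm.
  apply: le_trans frb; rewrite ET2.
  by have := mcut_norm_mul fin cS sub ler01 ccont_cbump cE b1'; rewrite mul1r.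
have a0 : 0 <= norm Fm by exact: sqrtr_ge0.
have g0 : 0 <= norm Gm by exact: sqrtr_ge0.
have p0 : 0 <= norm f by exact: sqrtr_ge0.
have EF : l2dot mu Fm Fm = norm Fm ^+ 2 by rewrite sqr_sqrtr// (gi_ge0 si).
have Ef : l2dot mu f f = norm f ^+ 2 by rewrite sqr_sqrtr// (gi_ge0 si).
have b12 : cbm (T1 + T2) by exact: (siD si).
split.
- rewrite (giD si)// (giD si)// EF Ef; rewrite {1}EF in D1.
  move: (l2dot mu T1 f) (l2dot mu T2 f) (l2dot mu T3 f) D1 D2 D3 => x1 x2 x3 D1 D2 D3.
  move: (norm Fm) (norm Gm) (norm f) a0 g0 p0 Gle Fle D1 D2 D3 => a g p a0 g0 p0 Gle Fle D1 D2 D3.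
  have h1 : g * a <= (a + d * p) * a by rewrite ler_wpM2r.
  have h2 : g * p <= (a + d * p) * p by rewrite ler_wpM2r.
  have h3 : d * (p * a) <= d * (p * p) by rewrite ler_wpM2l ?(ltW d0)// ler_wpM2l.
  have h4 : d * (g * p) <= d * ((a + d * p) * p) by rewrite ler_wpM2l// ltW.
  have h5 : d * (d * (p * p)) <= d * (p * p).
    by rewrite ler_wpM2l ?(ltW d0)// ler_piMl// mulr_ge0.
  have h6 : 4 * d * (p * p) <= e * (p * p) by rewrite ler_wpM2r// mulr_ge0.
  have h7 : 0 <= a * a by rewrite mulr_ge0.
  have h8 : 0 <= p * a by rewrite mulr_ge0.
  have h9 : 0 <= d * (p * p) by rewrite mulr_ge0 ?(ltW d0)// mulr_ge0.
  rewrite !mulrDl in h1 h4; rewrite !expr2 in D1 *; lra.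
- apply: le_trans (gi_triangle si b12 b3) _.
  have := gi_triangle si b1 b2.
  move: (norm (T1 + T2)) (norm T1) (norm T2) (norm T3) N1 N2 N3 => x x1 x2 x3 N1 N2 N3 h.
  move: (norm Fm) (norm Gm) (norm f) a0 g0 p0 Gle Fle N1 N2 N3 => a g p a0 g0 p0 Gle Fle N1 N2 N3.
  have h1 : d * g <= g by rewrite ler_piMl.
  have h2 : d * p <= p by rewrite ler_piMl.
  lra.
Qed.
End OneCube.
End Local.

(** * Functions of large energy *)

Section Energy.
Context {R : realType} {n : nat} {M : ptopologicalType}.
Context (S : smooth_structure R n M) (mu : volume_density S).
Context (m : nat) (P : diffop S m).
Local Notation C := R[i].
Local Notation V := 'rV[R]_n.
Hypothesis n0 : (0 < n)%N.
Hypothesis m0 : (0 < m)%N.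
Hypothesis Mh : hausdorff_space M.
Hypothesis cM : compact [set: M].
Hypothesis P_pos : positive_principal_symbol P.
Hypothesis fin : (vol mu setT < +oo)%E.
Local Notation si := (l2dot_semi_inner fin).
Local Notation norm u := (Num.sqrt (l2dot mu u u)).
Context (c : chart R n M) (cS : charts S c) (y0 : V) (r : R).
Hypothesis r0 : 0 < r.
Hypothesis sub : cube y0 r `<=` img c.
Context (lo hi : R).
Hypothesis lo0 : 0 < lo.
Hypothesis hd : forall y, cube y0 r y -> lo <= density mu c y <= hi.
Hypothesis hilo : hi <= 4 * lo.
Context (c0 : R).
Hypothesis c00 : 0 < c0.
Hypothesis hc : forall xi, c0 * `|xi| ^+ m <= real_symbol P c y0 xi.
Local Notation Q := (#|{: @multi_index n m}|%:R + 1 : R).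
Hypothesis osc : forall (a : @multi_index n m) y, cube y0 r y ->
  sqn (coef P c a y - coef P c a y0) <= (c0 / (8 * Q)) ^+ 2.

Local Notation X x := (complex.Re (ext_fun c (cbump y0 r) x)).

Lemma smooth_ext_cbump : smooth_fun S (ext_fun c (cbump y0 r)).
Proof.
have h : 0 < r / 2 by rewrite divr_gt0.
apply: (smooth_ext_fun cS Mh (K := cube y0 (r / 2))).
- exact: cube_compact.
- by move=> y hy; apply: sub; apply: cubeS hy; rewrite ler_pdivrMr// ler_peMr ?ler1n// ltW.
- exact: (coefficient_cbump c y0 r0).1.
- by move=> y; exact: cbump_out.
Qed.

Lemma bmeas_cbump_sqr : bmeas (fun x : @borel M => X x ^+ 2).
Proof.
by have [h _] := smooth_cbm cM smooth_ext_cbump; apply: bmeasM.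
Qed.

Lemma cbump_mass : 0 < Int (vol mu) (fun x : @borel M => X x ^+ 2).
Proof.
have r2 : 0 < r / 2 by rewrite divr_gt0.
have b0 := bump_gt0 y0 (r / 2).
set b := bump_fun y0 (r / 2) y0 in b0.
have cb : {for y0, continuous (bump_fun y0 (r / 2))}.
  exact: smooth_on_continuous (smooth_bump y0 (r / 2)) I.
have b2 : 0 < b / 2 by rewrite divr_gt0.
have /cvgrPdist_le/(_ _ b2) h1 := cb.
have [s s0 hs] := near_cube (filterI h1 (cube_near y0 r0)).
have hs' y : cube y0 s y -> cube y0 r y /\ b / 2 <= bump_fun y0 (r / 2) y.
  move=> /hs[]; rewrite -/b ler_distl => /andP[h h2] h'; split => //; lra.
have hcs : half_cube y0 s `<=` cube y0 s by exact: half_cube_sub.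
have hB : measurable (chart_set c (half_cube y0 s)) by exact: (chart_set_cell_measurable _ _ cS).
apply: (@lt_le_trans _ _ (Int (vol mu) (fun x : @borel M => (b / 2) ^+ 2 * \1_(chart_set c (half_cube y0 s)) x))).
  rewrite IntZ//; last exact: bmeas_indic.
  rewrite mulr_gt0 ?exprn_gt0// Int_indic//.
  have hab j : lower_corner y0 s 0 j <= upper_corner y0 s 0 j.
    by rewrite !mxE lerD2l ge0_cp// ltW.
  have sub' : half_cube y0 s `<=` img c by move=> y /hcs/hs'[/sub].
  have hd' y : half_cube y0 s y -> lo <= density mu c y <= hi by move=> /hcs/hs'[/hd].
  have := vol_cell_bounds cS sub' hab (ltW lo0) hd'; rewrite -/(half_cube y0 s) half_cube_vol.
  set v := vol mu _ => /andP[v1 v2].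
  have vf : v \is a fin_num.
    rewrite fin_numE; apply/andP; split.
      by apply/eqP => v0; rewrite v0 leeNy_eq in v1.
    by apply/eqP => v0; rewrite v0 leye_eq in v2.
  rewrite -lte_fin fineK//; apply: lt_le_trans v1.
  by rewrite lte_fin mulr_gt0// exprn_gt0// mulr_gt0.
apply: Int_le => //.
- by apply: bmeasZ; apply: bmeas_indic.
- exact: bmeas_cbump_sqr.
move=> x; rewrite indicE; case: (boolP (x \in _)) => [|_]; last by rewrite mulr0 sqr_ge0.
rewrite inE => -[dx hx]; rewrite mulr1 ext_fun_dom//= lerXn2r ?nnegrE ?(ltW b2) ?bump_ge0//.
by have [] := hs' _ (hcs _ hx).
Qed.

(** For a packet with the single frequency xi, the energy is q xi times the
    squared norm of u, which does not depend on xi, up to errors of at most a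
    fixed fraction of it. Here t is fixed, large enough for the lower-order
    terms to be small. *)
Lemma energy_unbounded (b : R) : exists2 u : @cfun R M, smooth_fun S u &
  0 < l2dot mu u u /\ b * l2dot mu u u < l2dot mu (P u) u.
Proof.
have w0 := cbump_mass; set w := Int _ _ in w0.
set v := norm (mcut c y0 r (fun=> 1)).
have v0 : 0 <= v by exact: sqrtr_ge0.
have [L hL EL] := shifted_packet m0 Mh P_pos cS r0 sub 0.
pose d := Num.sqrt w / (4 * (v + 1)).
have v1 : 0 < v + 1 by rewrite ltr_wpDl.
have d0 : 0 < d by rewrite divr_gt0 ?sqrtr_gt0// mulr_gt0.
have [t t0 ht] := lower_small m0 P_pos fin cS r0 sub lo0 hd hilo hL d0.
(* If the frequency exceeds B, then q xi >= 2 (|b| + t + 1), which outweighs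
   all the errors. *)
pose B := 1 + 2 * (`|b| + t + 1) / c0.
have B1 : 1 <= B.
  rewrite lerDl; apply: divr_ge0; last exact: ltW.
  by rewrite mulr_ge0// addr_ge0// addr_ge0// ltW.
have pr : 0 < pi / r by rewrite divr_gt0 ?pi_gt0.
pose K := Num.bound (B / (pi / r)).
have hK : B < pi / r * K%:R.
  rewrite [ltRHS]mulrC -ltr_pdivrMr//; apply: archi_boundP.
  by rewrite divr_ge0 ?(ltW pr)// (le_trans ler01).
pose f0 : {ffun 'I_n -> 'I_K.+1} := [ffun=> ord_max].
pose xi : V := freq r 0 f0.
have hxi : B <= `|xi|.
  apply: le_trans (ltW hK) _.
  have := le_coord_norm xi (Ordinal n0).
  by rewrite /xi mxE ffunE /= subr0 ger0_norm// mulr_ge0// ltW.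
pose q := real_symbol P c y0 xi.
have hq : 2 * (`|b| + t + 1) <= q.
  apply: le_trans (hc xi); rewrite [leRHS]mulrC -ler_pdivrMr//.
  apply: (@le_trans _ _ B); first by rewrite lerDr.
  apply: (le_trans hxi); rewrite -{1}(expr1 `|xi|); apply: ler_weXn2l => //.
  exact: (le_trans B1 hxi).
have q0 : 0 < q.
  by apply: lt_le_trans hq; rewrite mulr_gt0// ltr_wpDl// addr_ge0// ltW.
pose z : C := q%:C%C - 'i%C * t%:C%C.
pose k (f : {ffun 'I_n -> 'I_K.+1}) : C := if f == f0 then z else 0.
have sz : sqn z = q ^+ 2 + t ^+ 2 by exact: sqn_symbol.
have zn : z != 0.
  apply/eqP => z0; have := sz; rewrite z0 /sqn /= expr0n addr0 => /esym/eqP.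
  by rewrite gt_eqF// ltr_wpDl ?sqr_ge0// exprn_gt0.
have dk f : divided P c y0 r 0 t k f = (f == f0)%:R.
  rewrite /divided /k; case: eqP => [->|_]; last by rewrite mul0r.
  by rewrite -/xi -/q -/z mulfV.
have tr (e : {ffun 'I_n -> 'I_K.+1} -> C) y :
    trig r 0 (fun f => divided P c y0 r 0 t k f * e f) y = e f0 * wave xi y.
  rewrite /trig (bigD1 f0)//= dk eqxx mul1r big1 ?addr0// => f /negbTE nf.
  by rewrite dk nf !mul0r.
have trk y : trig r 0 k y = z * wave xi y.
  rewrite /trig (bigD1 f0)//= /k eqxx big1 ?addr0// => f /negbTE nf.
  by rewrite nf mul0r.
pose H (y : V) : C := cbump y0 r y * wave xi y.
have su := smooth_packet P Mh cS r0 sub 0 t k.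
set u : @cfun R M := packet P c y0 r 0 t k in su.
have uE : u = mcut c y0 r H.
  rewrite /u /packet (ext_fun_mcut c y0 r0); congr mcut; apply/funext => y.
  rewrite /H; congr (_ * _); have := tr (fun=> 1) y.
  by rewrite mul1r => <-; congr trig; apply/funext => f; rewrite mulr1.
exists u => //.
have bu : cbm u by exact: (smooth_cbm cM su).
have Nu : l2dot mu u u = w.
  rewrite l2dot_sqn /w; congr Int; apply/funext => x; rewrite /u /packet.
  have [dx|dx] := pselect (dom c x); last first.
    rewrite /ext_fun; case: asboolP => // _; by rewrite /sqn /= expr0n addr0.
  rewrite !ext_fun_dom// sqnM sqn_real.
  have -> : trig r 0 (divided P c y0 r 0 t k) (phi c x) = wave xi (phi c x).
    have := tr (fun=> 1) (phi c x); rewrite mul1r => <-.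
    by congr trig; apply/funext => f; rewrite mulr1.
  by rewrite sqn_wave mulr1.
rewrite Nu; split => //.
have oU := chart_open_img cS.
have cw : ccont c (wave xi) by apply: smooth_onC_ccont; exact: smooth_wave.
have ccb := ccont_cbump (c := c) y0 r0.
have cH : ccont c H by exact: ccontM.
have := EL t _ 0 k t0; rewrite -/u.
set T1 := mcut _ _ _ _; set T2 := mcut _ _ _ _; set T3 := mcut _ _ _ _ => E.
have b1 : cbm T1.
  by apply: (mcut_cbm cS sub); apply: ccontM => //; exact: (ccont_trig cS).
have ET2 : T2 = mcut c y0 r (fun y => \sum_(a : @multi_index n m | mi_length a == m)
    ((coef P c a y - coef P c a y0) * mi_monomial a xi) * H y).
  congr mcut; apply/funext => y; apply: eq_bigr => a _.
  by rewrite tr -/xi /H; ring.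
have cT2 (a : @multi_index n m) : ccont c (fun y => (coef P c a y - coef P c a y0) * mi_monomial a xi).
  apply: ccontM; first exact: ccont_coef.
  by move=> y _; split; exact: cst_continuous.
have b2 : cbm T2.
  rewrite ET2; apply: (mcut_cbm cS sub); apply: ccont_sum => a.
  exact: ccontM.
have b3 : cbm T3.
  apply: (mcut_cbm cS sub); apply: ccont_sum => f1; apply: smooth_onC_ccont.
  apply: smooth_onCM => //; last exact: smooth_wave.
  apply: smooth_onCM => //; first exact: smooth_onC_cst.
  exact: lower_symbol_smooth hL.
have D1 : l2dot mu T1 u = q * w.
  rewrite -Nu l2dot_sqn /l2dot -(IntZ fin); last exact: cbm_sqn.
  congr Int; apply/funext => x; rewrite uE /T1.
  have [hx|hx] := pselect (cubeX c y0 r x); last first.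
    by rewrite !mcut_out// /dot2 /sqn /= expr0n addr0 !mulr0 addr0.
  rewrite !mcutE// trk.
  have -> : cbump y0 r (phi c x) * (z * wave xi (phi c x)) = z * H (phi c x).
    by rewrite /H; ring.
  rewrite /dot2 cReM cImM /sqn /z /=; ring.
have su0 : 0 <= Num.sqrt w by exact: sqrtr_ge0.
have sw : Num.sqrt w * Num.sqrt w = w by rewrite -expr2 sqr_sqrtr// ltW.
have N2 : norm T2 <= q / 8 * Num.sqrt w.
  rewrite ET2; apply: le_trans (mcut_norm_sum fin cS sub _ _ _) _.
    by move=> a; apply: ccontM.
  have Q0 : 0 < Q by rewrite ltr_wpDl.
  apply: (@le_trans _ _ (\sum_(a : @multi_index n m | mi_length a == m) q / (8 * Q) * Num.sqrt w)).
    apply: ler_sum => a /eqP am.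
    have k0 : 0 <= q / (8 * Q) by apply: divr_ge0; [exact: ltW|rewrite mulr_ge0// ltW].
    rewrite -Nu uE; apply: (mcut_norm_mul fin cS sub k0 (cT2 a) cH) => y hy.
    rewrite sqnM; have h1 := osc a hy; have h2 := sqn_mi_monomial a xi.
    rewrite am in h2.
    apply: le_trans (ler_pM (sqn_ge0 _) (sqn_ge0 _) h1 h2) _.
    rewrite -exprMn lerXn2r ?nnegrE//.
      by rewrite mulr_ge0 ?exprn_ge0// divr_ge0 ?mulr_ge0// ltW.
    by rewrite mulrAC ler_wpM2r// invr_ge0 mulr_ge0// ltW.
  rewrite sumr_const -[leLHS]mulr_natr.
  have cq : #|[pred a : @multi_index n m | mi_length a == m]|%:R <= Q.
    have := max_card [pred a : @multi_index n m | mi_length a == m].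
    by rewrite -(ler_nat R) => h; apply: le_trans h _; rewrite lerDl.
  have -> : q / 8 * Num.sqrt w = q / (8 * Q) * Num.sqrt w * Q by field; rewrite gt_eqF.
  apply: ler_wpM2l => //; rewrite mulr_ge0//; apply: divr_ge0; first exact: ltW.
  by rewrite mulr_ge0// ltW.
have N3 : norm T3 <= (q + t) / 4 * Num.sqrt w.
  apply: le_trans (ht t (lexx _) _ 0 k) _.
  have hh : norm (mcut c y0 r (trig r 0 k)) <= (q + t) * v.
    apply: (mcut_le fin cS sub).
    - by rewrite addr_ge0// ltW.
    - exact: (ccont_trig cS).
    - by move=> y _; split; exact: cst_continuous.
    - move=> y hy; rewrite trk sqnM sqn_wave mulr1 sz.
      have -> : sqn (1 : C) = 1 by rewrite /sqn /= expr1n expr0n addr0.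
      rewrite mulr1; nra.
  apply: le_trans (ler_wpM2l (ltW d0) hh) _.
  have -> : d * ((q + t) * v) = (q + t) / 4 * Num.sqrt w * (v / (v + 1)).
    by rewrite /d; field; rewrite gt_eqF.
  rewrite ler_piMr//.
    by rewrite mulr_ge0// divr_ge0// addr_ge0// ltW.
  by rewrite ler_pdivrMr// mul1r lerDl.
have D2 : - (q / 8 * w) <= l2dot mu T2 u.
  rewrite lerNl -sw mulrA; apply: (@le_trans _ _ (norm T2 * norm u)).
    by apply: le_trans (cauchy_schwarz_sqrt si b2 bu); rewrite -normrN ler_norm.
  by rewrite Nu ler_wpM2r.
have D3 : - ((q + t) / 4 * w) <= l2dot mu T3 u.
  rewrite lerNl -sw mulrA; apply: (@le_trans _ _ (norm T3 * norm u)).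
    by apply: le_trans (cauchy_schwarz_sqrt si b3 bu); rewrite -normrN ler_norm.
  by rewrite Nu ler_wpM2r.
have PE : (P u : @cfun R M) = T1 + T2 + T3 + t *: multI u.
  rewrite -E /shifted scale0r subr0 subrK//.
have bJ : cbm (t *: multI u).
  apply: (siZ si); apply: (smooth_cbm cM (S := S)).
  exact: (smooth_funZ _ su).
have b12 : cbm (T1 + T2) by exact: (siD si).
have b123 : cbm (T1 + T2 + T3) by exact: (siD si).
have PEE : l2dot mu (P u : @cfun R M) u = l2dot mu T1 u + l2dot mu T2 u + l2dot mu T3 u.
  rewrite PE (giD si)// (giD si)// (giD si)// (giZ si)//; last first.
    apply: (smooth_cbm cM (S := S)).
    exact: (smooth_funZ _ su).
  by rewrite l2dot_multI mulr0 addr0.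
suff h : b * w < l2dot mu (P u : @cfun R M) u by exact: h.
rewrite PEE D1.
have h1 := ler_wpM2r (ltW w0) hq.
have h2 : b * w <= `|b| * w by rewrite ler_wpM2r ?(ltW w0)// ler_norm.
have h3 : 0 < t * w by rewrite mulr_gt0.
have h4 : 0 <= `|b| * w by rewrite mulr_ge0// ltW.
rewrite !mulrDr !mulrDl in h1; lra.
Qed.
End Energy.

(** * Dense range and approximate eigenfunctions *)

Section Global.
Context {R : realType} {n : nat} {M : ptopologicalType}.
Context (S : smooth_structure R n M) (mu : volume_density S).
Context (m : nat) (P : diffop S m).
Local Notation C := R[i].
Local Notation V := 'rV[R]_n.
Hypothesis n0 : (0 < n)%N.
Hypothesis m0 : (0 < m)%N.
Hypothesis Mh : hausdorff_space M.
Hypothesis cM : compact [set: M].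
Hypothesis P_pos : positive_principal_symbol P.
Hypothesis P_sa : formally_self_adjoint mu P.

Let fin : (vol mu setT < +oo)%E := finite_volume mu cM.
Local Notation si := (l2dot_semi_inner fin).
Local Notation norm u := (Num.sqrt (l2dot mu u u)).
Local Notation Pl := (P : @cfun R M -> @cfun R M).
Local Notation J := (@multI R M).
Local Notation smooth := (@smooth_fun R n M S).

Lemma smooth_cfunZ (a : R) (u : @cfun R M) : smooth u -> smooth (a *: u).
Proof.
move=> su; have -> : a *: u = (fun x => a%:C%C * u x) :> (M -> C).
  by apply/funext => x; exact: cfun_scaleC.
exact: (smooth_funZ _ su).
Qed.

Lemma smooth_semi_inner : semi_inner (V := @cfun R M) smooth (l2dot mu).
Proof.
have sc (u : @cfun R M) : smooth u -> cbm u by move=> su; exact: smooth_cbm su.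
split.
- exact: smooth_fun_cst.
- by move=> u v su sv; exact: smooth_funD.
- by move=> a u su; exact: smooth_cfunZ.
- move=> u v w su sv sw; by apply: (giD si); apply: sc.
- move=> a u w su sw; by apply: (giZ si); apply: sc.
- move=> u v su sv; by apply: (giC si); apply: sc.
- move=> u su; by apply: (gi_ge0 si); apply: sc.
Qed.
Local Notation ss := smooth_semi_inner.

Lemma smooth_multI (u : @cfun R M) : smooth u -> smooth (J u).
Proof. by move=> su; exact: (smooth_funZ 'i%C su). Qed.

Lemma dopD (u v : @cfun R M) : smooth u -> smooth v -> Pl (u + v) = Pl u + Pl v.
Proof.
move=> su sv; apply/funext => x; have h := dop_lin P 1 su sv x; rewrite mul1r in h.
by apply: etrans h; congr (P _ x); apply/funext => y; rewrite mul1r.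
Qed.

Lemma dopZC (a : C) (u : @cfun R M) x : smooth u -> P (fun x => a * u x) x = a * P u x.
Proof.
move=> su; have := dop_lin P a su (smooth_fun_cst 0) x; rewrite dop0 addr0 => <-.
by congr (P _ x); apply/funext => y; rewrite addr0.
Qed.

Lemma dopZ (a : R) (u : @cfun R M) : smooth u -> Pl (a *: u) = a *: Pl u.
Proof.
move=> su; apply/funext => x; rewrite cfun_scaleC -dopZC//.
by congr (P _ x); apply/funext => y; rewrite -cfun_scaleC.
Qed.

Lemma multID (u v : @cfun R M) : smooth u -> smooth v -> J (u + v) = J u + J v.
Proof. by move=> _ _; apply/funext => x; exact: (@mulrDr C). Qed.

Lemma multIZ (a : R) (u : @cfun R M) : smooth u -> J (a *: u) = a *: J u.
Proof.
move=> _; apply/funext => x; rewrite cfun_scaleC /multI.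
by rewrite (cfun_scaleC a u x) mulrCA.
Qed.

Lemma dop_multI (u : @cfun R M) : smooth u -> Pl (J u) = J (Pl u).
Proof. by move=> su; apply/funext => x; exact: dopZC. Qed.

Lemma l2dot_inner (u v : @cfun R M) : l2dot mu u v = complex.Re (inner mu u v).
Proof. by rewrite /l2dot /inner /=; congr Rintegral; apply/funext => x; rewrite dot2E. Qed.

Lemma dop_symmetric (u v : @cfun R M) : smooth u -> smooth v ->
  l2dot mu (Pl u) v = l2dot mu u (Pl v).
Proof. by move=> su sv; rewrite !l2dot_inner; congr complex.Re; exact: P_sa. Qed.

Lemma multI_skew (u v : @cfun R M) : smooth u -> smooth v ->
  l2dot mu (J u) v = - l2dot mu u (J v).
Proof.
move=> su sv; rewrite -mulN1r /l2dot -(IntZ fin).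
  by congr Int; apply/funext => x; rewrite /dot2 /multI !cReM !cImM /=; ring.
by apply: cbm_dot; [exact: (smooth_cbm cM su)|exact: (smooth_cbm cM (smooth_multI sv))].
Qed.

Lemma multI_isometry (u : @cfun R M) : smooth u -> l2dot mu (J u) (J u) = l2dot mu u u.
Proof.
move=> su; congr Int; apply/funext => x.
by rewrite /dot2 /multI !cReM !cImM /=; ring.
Qed.

(** Cubes on which the density is known up to a factor 4 and the coefficients
    oscillate little compared with the ellipticity constant. *)
Definition good_cube (c : chart R n M) (y0 : V) (r lo hi c0 : R) : Prop :=
  [/\ 0 < r /\ cube y0 r `<=` img c,
      0 < lo /\ hi <= 4 * lo,
      (forall y, cube y0 r y -> lo <= density mu c y <= hi),
      0 < c0 /\ (forall xi, c0 * `|xi| ^+ m <= real_symbol P c y0 xi) &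
      forall (a : @multi_index n m) y, cube y0 r y ->
        sqn (coef P c a y - coef P c a y0) <=
          (c0 / (8 * (#|{: @multi_index n m}|%:R + 1))) ^+ 2].

Lemma exists_good_cube c y0 : charts S c -> img c y0 ->
  exists r lo hi c0, good_cube c y0 r lo hi c0.
Proof.
move=> cS iy.
have [c0 c00 hc] := symbol_elliptic_bound cS m0 iy P_pos.
set kap := c0 / (8 * (#|{: @multi_index n m}|%:R + 1)).
have kap0 : 0 < kap by rewrite divr_gt0// mulr_gt0// ltr_wpDl.
have rho0 := density_gt0 mu cS iy; set rho := density mu c y0 in rho0.
have rho2 : 0 < rho / 2 by rewrite divr_gt0.
have [r1 r10 [sub1 hd1]] := density_near mu cS iy rho2.
have h : \forall y \near y0, forall a : @multi_index n m,
    sqn (coef P c a y - coef P c a y0) <= kap ^+ 2.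
  apply: (@filter_forall _ (@multi_index n m) (fun a y =>
    sqn (coef P c a y - coef P c a y0) <= kap ^+ 2) (nbhs y0) _) => a.
  have [h1 h2] := ccont_coef P cS y0 a iy.
  have cs : {for y0, continuous (fun y => sqn (coef P c a y - coef P c a y0))}.
    by apply: continuousD; apply: continuousM.
  have k2 : 0 < kap ^+ 2 by rewrite exprn_gt0.
  have := cs; move=> /cvgrPdist_le/(_ _ k2); apply: filterS => y.
  rewrite subrr /sqn /= expr0n addr0 sub0r normrN ger0_norm//.
  by rewrite addr_ge0 ?sqr_ge0.
have [r2 r20 hr2] := near_cube h.
have r0 : 0 < Num.min r1 r2 by rewrite lt_min r10.
exists (Num.min r1 r2), (rho / 2), (3 * rho / 2), c0.
have s1 : cube y0 (Num.min r1 r2) `<=` cube y0 r1 by apply: cubeS; rewrite ge_min lexx.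
have s2 : cube y0 (Num.min r1 r2) `<=` cube y0 r2 by apply: cubeS; rewrite ge_min lexx orbT.
split => //.
- by split => // y /s1/sub1.
- by split => //; lra.
- move=> y /s1/hd1; rewrite ler_distl -/rho => /andP[h1 h2].
  by apply/andP; split; lra.
- by move=> a y /s2/hr2/(_ a).
Qed.

(** What the local estimate says when the chart is forgotten; X is the cutoff.
    *)
Definition local_parametrix (X : M -> R) : Prop := forall l e, 0 < e ->
  exists2 t0, 0 < t0 & forall t, t0 <= t ->
  forall f : @cfun R M, smooth f -> exists2 u : @cfun R M, smooth u &
    2^-1 * Int (vol mu) (fun x : @borel M => X x ^+ 2 * sqn (f x))
      - e * l2dot mu f f <= l2dot mu (shifted Pl J l t u) f /\
    norm (shifted Pl J l t u) <= 6 * norm f.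

Lemma exists_local_parametrix (x0 : M) :
  exists X : M -> R, [/\ continuous X, 0 < X x0 & local_parametrix X].
Proof.
have [c cS dx] := charts_cover S x0; have iy := img_phi dx.
have [r [lo [hi [c0 [[r0 sub] [lo0 hilo] hd [c00 hc] osc]]]]] := exists_good_cube cS iy.
exists (fun x => complex.Re (ext_fun c (cbump (phi c x0) r) x)); split.
- move=> x; have sX := smooth_ext_cbump Mh cS r0 sub.
  by have [] := smooth_fun_continuous x sX.
- by rewrite ext_fun_dom//= bump_gt0.
move=> l e e0.
have [t0 t00 ht] := local_estimate m0 Mh P_pos fin cS r0 sub lo0 hd hilo c00 hc osc l e0.
exists t0 => // t tt f sf; exact: (ht t tt f (smooth_cbm cM sf) sf).
Qed.

Lemma shifted_lin l t : [/\ (forall u : @cfun R M, smooth u -> smooth (shifted Pl J l t u)),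
  (forall u v : @cfun R M, smooth u -> smooth v ->
     shifted Pl J l t (u - v) = shifted Pl J l t u - shifted Pl J l t v),
  (forall u v : @cfun R M, smooth u -> smooth v ->
     shifted Pl J l t (u + v) = shifted Pl J l t u + shifted Pl J l t v),
  (forall (a : R) (u : @cfun R M), smooth u -> shifted Pl J l t (a *: u) = a *: shifted Pl J l t u) &
  shifted Pl J l t 0 = 0].
Proof.
split.
- by move=> u; exact: (Dshift ss (smooth_dop P) smooth_multI).
- by move=> u v; exact: (shiftB ss dopD dopZ multID multIZ).
- by move=> u v; exact: (shiftD ss dopD dopZ multID multIZ).
- by move=> a u; exact: (shiftZ dopZ multIZ).
- exact: (shift0 ss dopZ multIZ).
Qed.

(** The inner product with f is additive, so that the parametrices of finitely
    many cutoffs can be added. *)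
Lemma sum_parametrix (I : Type) (s : seq I) (X : I -> M -> R) l e : 0 < e ->
  (forall i, continuous (X i)) -> (forall i, local_parametrix (X i)) ->
  exists2 t0, 0 < t0 & forall t, t0 <= t ->
  forall f : @cfun R M, smooth f -> exists2 u : @cfun R M, smooth u &
    2^-1 * Int (vol mu) (fun x : @borel M => (\sum_(i <- s) X i x ^+ 2) * sqn (f x))
      - e * (size s)%:R * l2dot mu f f <= l2dot mu (shifted Pl J l t u) f /\
    norm (shifted Pl J l t u) <= 6 * (size s)%:R * norm f.
Proof.
move=> e0 cX hX; elim: s => [|i s [t1 t10 h1]].
  exists 1 => // t _ f sf; exists 0; first exact: smooth_fun_cst.
  have [_ _ _ _ ->] := shifted_lin l t.
  rewrite (gi_0l ss sf) (gi_0l ss (si0 ss)).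
  rewrite sqrtr0 /= !mulr0 !mul0r subr0; split => //.
  have -> : (fun x : @borel M => (\sum_(i <- [::]) X i x ^+ 2) * sqn (f x)) = fun=> 0.
    by apply/funext => x; rewrite big_nil mul0r.
  by rewrite Int_cst mul0r mulr0.
have [t2 t20 h2] := hX i l e e0.
exists (Num.max t1 t2); first by rewrite lt_max t10.
move=> t; rewrite ge_max => /andP[t1t t2t] f sf.
have [u1 su1 [a1 b1]] := h1 t t1t f sf.
have [u2 su2 [a2 b2]] := h2 t t2t f sf.
have [sD _ sA _ _] := shifted_lin l t.
exists (u2 + u1); first exact: (siD ss).
have sL1 := sD _ su1; have sL2 := sD _ su2.
rewrite (sA _ _ su2 su1) (giD ss sL2 sL1 sf).
have bs j : bmeas (fun x : @borel M => X j x ^+ 2 * sqn (f x)).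
  apply: bmeasM; last by apply: cbm_sqn; exact: (smooth_cbm cM sf).
  by apply: bmeasM; exact: (continuous_bmeas cM).
split; last first.
  apply: le_trans (gi_triangle ss (sD _ su2) (sD _ su1)) _.
  by rewrite /= -(@natr1 R (size s)) mulrDr mulr1 mulrDl addrC; apply: lerD.
have -> : (fun x : @borel M => (\sum_(j <- i :: s) X j x ^+ 2) * sqn (f x)) =
    fun x => X i x ^+ 2 * sqn (f x) + (\sum_(j <- s) X j x ^+ 2) * sqn (f x).
  by apply/funext => x; rewrite big_cons mulrDl.
rewrite (IntD fin)//; last first.
  have -> : (fun x : @borel M => (\sum_(j <- s) X j x ^+ 2) * sqn (f x)) =
     fun x => \sum_(j <- s) X j x ^+ 2 * sqn (f x).
    by apply/funext => x; rewrite mulr_suml.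
  by apply: bmeas_sum => j _; exact: bs.
rewrite /= -(@natr1 R (size s)) [e * _]mulrDr mulr1 mulrDl; lra.
Qed.

Lemma finite_local_parametrices : exists (s : seq M) (X : M -> M -> R) (k : R),
  [/\ 0 < k, (forall p, continuous (X p)), (forall p, local_parametrix (X p)) &
      forall x, k <= \sum_(p <- s) X p x ^+ 2].
Proof.
pose X p := projT1 (cid (exists_local_parametrix p)).
have hX p : [/\ continuous (X p), 0 < X p p & local_parametrix (X p)].
  by rewrite /X; case: cid.
have := cM; rewrite compact_cover => /(_ M setT (fun p => [set x | X p p / 2 < X p x])).
case=> [p _|x _|D' _ hD'].
- have [cX _ _] := hX p.
  have -> : [set x | X p p / 2 < X p x] = X p @^-1` [set y | X p p / 2 < y] by [].
  by apply: open_comp; [move=> x _; exact: cX|exact: open_gt].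
- exists x => //=; have [_ h _] := hX x.
  by rewrite ltr_pdivrMr// mulr_natr mulr2n ltrDr.
exists (finmap.enum_fset D'), X, (\big[Num.min/1]_(p <- finmap.enum_fset D') (X p p / 2) ^+ 2); split.
- apply: lt_bigmin => // p _; rewrite exprn_gt0// divr_gt0//.
  by have [] := hX p.
- by move=> p; have [] := hX p.
- by move=> p; have [] := hX p.
move=> x; have [p pD /= hp] := hD' x I; have [_ Xp _] := hX p.
apply: (@le_trans _ _ ((X p p / 2) ^+ 2)); first exact: (bigmin_seq_le (fun p => (X p p / 2) ^+ 2) 1 pD).
have X2 : 0 <= X p p / 2 by rewrite divr_ge0// ltW.
apply: (@le_trans _ _ (X p x ^+ 2)).
  by rewrite lerXn2r ?nnegrE ?(ltW hp)// (le_trans X2)// ltW.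
rewrite (big_rem p)//= lerDl; apply: sumr_ge0 => q _; exact: sqr_ge0.
Qed.

(** On a finite cover the cutoffs satisfy sum X^2 >= k > 0, which makes the
    inner product of (P - l - i t) u with f at least a multiple of the squared
    norm of f. A small multiple of u therefore solves the equation up to a
    residual that is smaller than f by a fixed factor. *)
Lemma dense_shifted (l : R) : exists t, forall (f : @cfun R M) d, smooth f -> 0 < d ->
  exists2 u : @cfun R M, smooth u & l2dot mu (shifted Pl J l t u - f) (shifted Pl J l t u - f) <= d.
Proof.
have [s [X [k [k0 cX pX hk]]]] := finite_local_parametrices.
set N : R := (size s)%:R; have N0 : 0 <= N by exact: ler0n.
have N1 : 0 < N + 1 by rewrite ltr_wpDl.
pose e := k / (4 * (N + 1)).
have e0 : 0 < e by rewrite divr_gt0// mulr_gt0.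
have eN : e * N <= k / 4.
  have -> : e * N = k / 4 * (N / (N + 1)) by rewrite /e; field; rewrite gt_eqF.
  rewrite ler_piMr ?divr_ge0 ?(ltW k0)// ler_pdivrMr// mul1r lerDl//.
have [t t0 ht] := sum_parametrix s l e0 cX pX; exists t.
have [sD sB _ sZ s0] := shifted_lin l t.
set B := 6 * N + 1 + k.
have B0 : 0 < B by rewrite /B; lra.
(* The minimizer of tau^2 B^2 - 2 tau k / 4. *)
pose tau := k / 4 / B ^+ 2.
have B2 : 0 < B ^+ 2 by rewrite exprn_gt0.
have tau0 : 0 < tau by rewrite divr_gt0// divr_gt0.
apply: (dense_range_of_contraction ss sD sB s0 (q := 1 - (k / 4) ^+ 2 / B ^+ 2)).
  apply/andP; split.
    rewrite subr_ge0 ler_pdivrMr// mul1r lerXn2r ?nnegrE ?(ltW B0)//.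
      by rewrite divr_ge0// ltW.
    by rewrite /B; lra.
  by rewrite ltrBlDr ltrDl divr_gt0// exprn_gt0// divr_gt0.
move=> f sf; have [u su [h1 h2]] := ht t (lexx _) f sf.
exists (tau *: u); first exact: (siZ ss).
have bf := smooth_cbm cM sf.
have Nf := gi_ge0 ss sf.
have sL := sD _ su.
rewrite (sZ _ _ su) (gi_NB ss (siZ ss tau sL) sf).
rewrite (gi_NZ ss tau sL) (giZ ss tau sL sf).
have h3 : k / 4 * l2dot mu f f <= l2dot mu (shifted Pl J l t u) f.
  apply: le_trans h1.
  have : k * l2dot mu f f <= Int (vol mu) (fun x : @borel M => (\sum_(p <- s) X p x ^+ 2) * sqn (f x)).
    rewrite l2dot_sqn -(IntZ fin); last exact: cbm_sqn.
    apply: (Int_le fin).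
    - by apply: bmeasZ; exact: cbm_sqn.
    - apply: bmeasM; last exact: cbm_sqn.
      by apply: bmeas_sum => p _; apply: bmeasM; exact: (continuous_bmeas cM).
    - by move=> x; rewrite ler_wpM2r ?sqn_ge0.
  have := ler_wpM2r Nf eN; rewrite -/N; lra.
have h4 : l2dot mu (shifted Pl J l t u) (shifted Pl J l t u) <= B ^+ 2 * l2dot mu f f.
  have NL := gi_ge0 ss sL.
  rewrite -[leLHS]sqr_sqrtr// -[l2dot mu f f]sqr_sqrtr// -exprMn.
  rewrite lerXn2r ?nnegrE ?mulr_ge0 ?sqrtr_ge0// ?(ltW B0)//.
  apply: le_trans h2 _; rewrite ler_wpM2r ?sqrtr_ge0// -/N /B; lra.
move: (l2dot mu (shifted _ _ _ _ _) (shifted _ _ _ _ _)) (l2dot mu (shifted _ _ _ _ _) f) (l2dot mu f f) h3 h4 Nf => a b c h3 h4 Nf.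
have t2 : tau ^+ 2 * a <= tau ^+ 2 * (B ^+ 2 * c) by rewrite ler_wpM2l// sqr_ge0.
have t1 : tau * (k / 4 * c) <= tau * b by rewrite ler_wpM2l// ltW.
apply: (@le_trans _ _ (tau ^+ 2 * (B ^+ 2 * c) - 2 * (tau * (k / 4 * c)) + c)); first lra.
rewrite le_eqVlt; apply/orP; left; apply/eqP; rewrite /tau; field.
by rewrite gt_eqF.
Qed.

Lemma approximate_eigenfunctions (b e : R) : 0 < e -> exists2 l, b < l &
  exists2 u : @cfun R M, smooth u & 0 < l2dot mu u u /\
    l2dot mu (Pl u - l *: u) (Pl u - l *: u) <= e * l2dot mu u u.
Proof.
move=> e0.
have unb (b' : R) : exists2 u : @cfun R M, smooth u &
    0 < l2dot mu u u /\ b' * l2dot mu u u < l2dot mu (Pl u) u.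
  have [c cS dx] := charts_cover S point; have iy := img_phi dx.
  have [r [lo [hi [c0 [[r0 sub] [lo0 hilo] hd [c00 hc] osc]]]]] := exists_good_cube cS iy.
  exact: (energy_unbounded n0 m0 Mh cM P_pos fin cS r0 sub lo0 hd hilo c00 hc osc b').
have nontriv : exists2 u : @cfun R M, smooth u & 0 < l2dot mu u u.
  by have [u su [h _]] := unb 0; exists u.
have unb' (b' : R) : exists2 u : @cfun R M, smooth u & b' * l2dot mu u u < l2dot mu (Pl u) u.
  by have [u su [_ h]] := unb b'; exists u.
have [l bl [u su [u0 hu]]] := approximate_spectrum_unbounded ss (smooth_dop P) smooth_multI
  dopD dopZ multID multIZ dop_multI dop_symmetric multI_skew multI_isometry nontriv dense_shifted unb' b e0.
exists l => //; exists u => //; split => //.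
by move: hu; rewrite /shifted scale0r subr0.
Qed.
End Global.

(** * Lebesgue norms and the resolvent *)

Section Norms.
Context {R : realType} {n : nat} {M : ptopologicalType}.
Context (S : smooth_structure R n M) (mu : volume_density S).
Local Notation C := R[i].
Hypothesis fin : (vol mu setT < +oo)%E.

(** On a finite measure space this compares Lebesgue norms of different
    exponents. *)
Lemma powR_le_add (a b t : R) : 0 <= a <= b -> 0 <= t -> t `^ a <= 1 + t `^ b.
Proof.
move=> /andP[a0 ab] t0; have [t1|t1] := leP t 1.
  apply: (@le_trans _ _ 1); last by rewrite lerDl powR_ge0.
  have := ge0_ler_powR a0 (_ : t \in Num.nneg) (_ : 1 \in Num.nneg) t1.
  by rewrite powR1; apply; rewrite nnegrE.
apply: ler_wpDl => //; exact: ler_powR (ltW t1) _ _ ab.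
Qed.

Definition Lmass (r : R) (u : M -> C) : R :=
  Int (vol mu) (fun x => ComplexField.Normc.normc (u x) `^ r).

Lemma normc_powR (z : C) r : ComplexField.Normc.normc z `^ r = sqn z `^ (2^-1 * r).
Proof. by rewrite normcE_sqn powRrM powR12_sqrt// sqn_ge0. Qed.

Lemma bmeas_normc_powR r (u : @cfun R M) : 0 <= r -> cbm u ->
  bmeas (fun x : @borel M => ComplexField.Normc.normc (u x) `^ r).
Proof.
move=> r0 bu; have [ms [K hK]] := cbm_sqn bu.
have -> : (fun x : @borel M => ComplexField.Normc.normc (u x) `^ r) =
    fun x => sqn (u x) `^ (2^-1 * r) by apply/funext => x; exact: normc_powR.
split; first exact: measurableT_comp (measurable_powR _) ms.
exists (K `^ (2^-1 * r)) => x; rewrite ger0_norm ?powR_ge0//.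
have h := le_trans (ler_norm _) (hK x).
apply: ge0_ler_powR => //; first by rewrite mulr_ge0// invr_ge0.
- by rewrite nnegrE sqn_ge0.
- by rewrite nnegrE (le_trans _ h)// sqn_ge0.
Qed.

Lemma Lr_normE r (u : @cfun R M) : 0 < r -> cbm u ->
  Lr_norm mu r u = (Lmass r u `^ r^-1)%:E.
Proof.
move=> r0 bu; rewrite /Lr_norm unlock /Lmass -poweR_EFin; congr (_ `^ _)%E.
have hb := bmeas_normc_powR (ltW r0) bu.
rewrite /Int /Rintegral fineK; last exact: integrable_fin_num (bmeas_integrable fin hb).
apply: eq_integral => x _; rewrite abse_EFin ger0_norm ?poweR_EFin//.
by rewrite normcE_sqn sqrtr_ge0.
Qed.

Lemma Lmass2 (u : @cfun R M) : Lmass 2 u = l2dot mu u u.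
Proof.
rewrite l2dot_sqn; congr Int; apply/funext => x.
by rewrite normc_powR mulVf// powRr1// sqn_ge0.
Qed.

Lemma Lmass_le a b (u : @cfun R M) : 0 <= a <= b -> cbm u ->
  Lmass a u <= fine (vol mu setT) + Lmass b u.
Proof.
move=> /[dup] ab /andP[a0 ab'] bu.
have ha := bmeas_normc_powR a0 bu.
have hb := bmeas_normc_powR (le_trans a0 ab') bu.
have -> : fine (vol mu setT) = Int (vol mu) (fun=> 1) by rewrite Int_cst mul1r.
rewrite /Lmass -(IntD fin)//; last exact: bmeas_cst.
apply: (Int_le fin) => //; first by apply: bmeasD => //; exact: bmeas_cst.
by move=> x; apply: powR_le_add => //; rewrite normcE_sqn sqrtr_ge0.
Qed.

Lemma LmassZ a r (u : @cfun R M) : 0 <= a -> 0 <= r -> cbm u ->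
  Lmass r (a *: u) = a `^ r * Lmass r u.
Proof.
move=> a0 r0 bu; rewrite /Lmass -(IntZ fin); last exact: bmeas_normc_powR.
congr Int; apply/funext => x; rewrite -powRM//; last by rewrite normcE_sqn sqrtr_ge0.
congr (_ `^ _); rewrite cfun_scaleC !normcE_sqn sqnM sqn_real sqrtrM ?sqr_ge0//.
by rewrite sqrtr_sqr ger0_norm.
Qed.

Lemma Lmass_ge0 r (u : @cfun R M) : 0 <= Lmass r u.
Proof. by apply: Int_ge0 => x; exact: powR_ge0. Qed.
End Norms.

Section Resolvent.
Context {R : realType} {n : nat} {M : ptopologicalType}.
Context (S : smooth_structure R n M) (mu : volume_density S).
Context (m : nat) (P : diffop S m).
Local Notation C := R[i].
Hypothesis cM : compact [set: M].
Let fin : (vol mu setT < +oo)%E := finite_volume mu cM.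
Local Notation si := (l2dot_semi_inner fin).

Lemma smooth_L2 (u : @cfun R M) : smooth_fun S u -> L2 mu u.
Proof.
move=> su; have bu := smooth_cbm cM su; split.
  by have [[h1 _] [h2 _]] := bu.
by rewrite (Lr_normE fin)// ltry.
Qed.

(** A smooth function belongs to the domain of the closure of P, through a
    constant sequence. *)
Lemma is_resolvent_smooth (zeta : C) (u : M -> C) : smooth_fun S u ->
  is_resolvent mu P zeta (fun x => P u x - zeta * u x) u.
Proof.
move=> su; rewrite /is_resolvent.
have -> : (fun x => P u x - zeta * u x + zeta * u x) = P u.
  by apply/funext => x; rewrite subrK.
split; [exact: smooth_L2|by apply: smooth_L2; exact: smooth_dop|].
have z (v : M -> C) : (fun k : nat => Lr_norm mu 2 (fun x => v x - v x)) @ \oo --> 0%E.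
  have -> : (fun k : nat => Lr_norm mu 2 (fun x => v x - v x)) = fun=> 0%E.
    apply/funext => k; rewrite (Lr_normE fin)//.
      by rewrite Lmass2 l2dot_sqn (_ : (fun _ => _) = fun=> 0) ?Int_cst ?mul0r ?powR0//;
        apply/funext => x; rewrite subrr /sqn /= expr0n addr0.
    rewrite (_ : (fun _ => _) = (0 : @cfun R M)); first exact: cbm0.
    by apply/funext => x; rewrite subrr.
  exact: cvg_cst.
by exists (fun=> u); split.
Qed.

(** Normalize u and f = (P - zeta) u by a common factor such that the squared
    L^2 norm of u is A and c times the L^2 norm of f is at most 1. The
    inequality t^a <= 1 + t^b, with c adapted to the volume, makes the L^p
    norm of f at most 1, and the integral of |u|^q at least A minus the
    volume. *)
Lemma resolvent_norm_large (p q K : R) : 0 < p <= 2 -> 2 <= q ->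
  exists2 e, 0 < e & forall zeta : C,
    (exists2 u : @cfun R M, smooth_fun S u & 0 < l2dot mu u u /\
      l2dot mu (fun x => P u x - zeta * u x) (fun x => P u x - zeta * u x) <= e * l2dot mu u u) ->
    (K%:E <= resolvent_norm mu P zeta p q)%E.
Proof.
move=> /andP[p0 p2] q2.
have q0 : 0 < q by exact: lt_le_trans q2.
pose D := fine (vol mu setT); have D0 : 0 <= D by exact: fine_ge0.
have D1 : 0 < D + 1 by rewrite ltr_wpDl.
pose c := (D + 1) `^ p^-1; have c0 : 0 < c by exact: powR_gt0.
(* The integral of |u|^q will be at least A - D, hence at least |K|^q. *)
pose A := D + `|K| `^ q + 1.
have A0 : 0 < A by rewrite ltr_wpDl// addr_ge0// powR_ge0.
exists (c ^+ 2 * A)^-1; first by rewrite invr_gt0 mulr_gt0// exprn_gt0.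
move=> zeta [u su [u0 hu]].
have bu := smooth_cbm cM su.
pose a := Num.sqrt (A / l2dot mu u u).
have a0 : 0 < a by rewrite sqrtr_gt0 divr_gt0.
have a2 : a ^+ 2 * l2dot mu u u = A.
  by rewrite sqr_sqrtr ?divr_ge0 ?ltW// divfK// gt_eqF.
pose f : @cfun R M := fun x => P u x - zeta * u x.
have sf : smooth_fun S f.
  have -> : f = (fun x => P u x + - zeta * u x) by apply/funext => x; rewrite mulNr.
  apply: smooth_funD; first exact: smooth_dop.
  exact: (smooth_funZ _ su).
have bf := smooth_cbm cM sf.
have sau := smooth_cfunZ a su.
have saf := smooth_cfunZ a sf.
have bau := smooth_cbm cM sau.
apply: (@le_trans _ _ (Lr_norm mu q (a *: u))); last first.
  apply: ereal_sup_ubound; exists (a *: f), (a *: u); split => //; last first.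
    have -> : (a *: f : M -> C) = fun x => P (a *: u) x - zeta * (a *: u) x.
      apply/funext => x; rewrite cfun_scaleC (dopZ P a su) !cfun_scaleC /f; ring.
    exact: is_resolvent_smooth.
  rewrite (Lr_normE fin)//; last exact: (smooth_cbm cM saf).
  have e1 : (1 : R) `^ p^-1 = 1 by rewrite powR1.
  rewrite lee_fin -[leRHS]e1.
  have hp : 0 <= p <= 2 by rewrite ltW.
  have caf : cbm ((c * a) *: f) by exact: (smooth_cbm cM (smooth_cfunZ _ sf)).
  have := Lmass_le fin hp caf; rewrite Lmass2 -scalerA.
  rewrite (LmassZ fin) ?(ltW c0) ?(ltW p0)//; last exact: (smooth_cbm cM saf).
  rewrite !(gi_NZ si)//; last exact: (smooth_cbm cM saf).
  have -> : c `^ p = D + 1 by rewrite -powRrM mulVf ?gt_eqF// powRr1// ltW.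
  have hf : c ^+ 2 * (a ^+ 2 * l2dot mu f f) <= 1.
    have h : a ^+ 2 * l2dot mu f f <= a ^+ 2 * ((c ^+ 2 * A)^-1 * l2dot mu u u).
      by rewrite ler_wpM2l ?sqr_ge0.
    apply: le_trans (ler_wpM2l (sqr_ge0 c) h) _.
    rewrite [a ^+ 2 * _]mulrCA a2 le_eqVlt; apply/orP; left; apply/eqP; field.
    by rewrite !gt_eqF.
  move=> h; apply: ge0_ler_powR; rewrite ?invr_ge0 ?(ltW p0) ?nnegrE ?Lmass_ge0//.
  rewrite -(ler_pM2l D1) mulr1; apply: le_trans h _; by rewrite lerD2l.
rewrite (Lr_normE fin)// lee_fin.
have h2q : (0 : R) <= 2 <= q by rewrite q2 ler0n.
have := Lmass_le fin h2q bau; rewrite Lmass2 (gi_NZ si)// a2 => h.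
have hK : `|K| `^ q <= Lmass mu q (a *: u) by rewrite /A -/D in h; lra.
apply: le_trans (ler_norm K) _.
have -> : `|K| = (`|K| `^ q) `^ q^-1 by rewrite -powRrM mulfV ?gt_eqF// powRr1.
by apply: ge0_ler_powR; rewrite ?nnegrE ?powR_ge0 ?Lmass_ge0 ?invr_ge0 ?(ltW q0).
Qed.
End Resolvent.

(** * Points near the boundary of the sector *)

Section Points.
Context {R : realType} {n : nat} {M : ptopologicalType}.
Context (S : smooth_structure R n M) (mu : volume_density S).
Context (m : nat) (P : diffop S m).
Local Notation C := R[i].
Hypothesis n0 : (0 < n)%N.
Hypothesis m0 : (0 < m)%N.
Hypothesis Mh : hausdorff_space M.
Hypothesis cM : compact [set: M].
Hypothesis P_pos : positive_principal_symbol P.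
Hypothesis P_sa : formally_self_adjoint mu P.
Let fin : (vol mu setT < +oo)%E := finite_volume mu cM.
Local Notation si := (l2dot_semi_inner fin).

Lemma near0_le (F : R -> R) e : continuous F -> F 0 < e -> \forall t \near (0 : R), F t <= e.
Proof.
move=> cF h; have d0 : 0 < e - F 0 by rewrite subr_gt0.
have /cvgrPdist_le/(_ _ d0) := cF 0; apply: filterS => t.
by rewrite ler_distl => /andP[h1 _]; lra.
Qed.

Lemma near0_ex_gt0 (Q : set R) : (\forall t \near (0 : R), Q t) -> exists2 t, 0 < t & Q t.
Proof.
move=> /nbhs_ballP[d /= d0 hd]; exists (d / 2); first by rewrite divr_gt0.
apply: hd; rewrite -ball_normE/= sub0r normrN gtr0_norm ?divr_gt0//.
by rewrite ltr_pdivrMr// mulr_natr mulr2n ltrDr.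
Qed.

Lemma sqn_expi_sub1 (x : R) : sqn (expi x - 1 : C) = 2 - 2 * cos x.
Proof.
rewrite /sqn /expi /= subr0; have h := cos2Dsin2 x.
have -> : sin x ^+ 2 = 1 - cos x ^+ 2 by lra.
by ring.
Qed.

Lemma l2dot_scale (z : C) (u : @cfun R M) : cbm u ->
  l2dot mu (fun x => z * u x) (fun x => z * u x) = sqn z * l2dot mu u u.
Proof.
move=> bu; rewrite !l2dot_sqn -(IntZ fin); last exact: cbm_sqn.
by congr Int; apply/funext => x; rewrite sqnM.
Qed.

(** The approximate eigenvalue s^m is found first; then t is taken small
    enough for (s exp(i t))^m to be as close to s^m as its approximate
    eigenfunction requires. As the cosine is even, the same t works for s
    exp(-it). *)
Lemma spectral_points (p q : R) (k : nat) : 0 < p <= 2 -> 2 <= q ->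
  exists s t : R, [/\ 0 < s, 0 < t < 2 * pi / m%:R,
    k%:R <= s * cos t /\ 0 < s * sin t <= k.+1%:R^-1,
    ((k%:R : R)%:E <= resolvent_norm mu P ((s%:C%C * expi t) ^+ m)%R p q)%E &
    ((k%:R : R)%:E <= resolvent_norm mu P ((s%:C%C * expi (- t)) ^+ m)%R p q)%E].
Proof.
move=> hp hq.
have [e e0 he] := resolvent_norm_large mu P cM k%:R hp hq.
have e4 : 0 < e / 4 by rewrite divr_gt0.
have [l hl [u su [u0 hu]]] :=
  approximate_eigenfunctions n0 m0 Mh cM P_pos P_sa ((2 * k.+1%:R) ^+ m) e4.
have kk0 : 0 < 2 * k.+1%:R :> R by rewrite mulr_gt0.
have l0 : 0 < l by apply: lt_trans hl; rewrite exprn_gt0.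
have mR : m%:R != 0 :> R by rewrite pnatr_eq0 -lt0n.
have mR0 : 0 < m%:R :> R by rewrite ltr0n.
pose s := l `^ m%:R^-1.
have s0 : 0 < s by exact: powR_gt0.
have sm : s ^+ m = l.
  by rewrite -powR_mulrn ?ltW// -powRrM mulVf// powRr1// ltW.
have hs : 2 * k.+1%:R < s.
  rewrite -sm in hl; rewrite ltNge; apply/negP => h.
  have : s ^+ m <= (2 * k.+1%:R) ^+ m by rewrite lerXn2r ?nnegrE ?(ltW s0) ?(ltW kk0).
  by rewrite leNgt hl.
have bu := smooth_cbm cM su.
have key th : l ^+ 2 * (2 - 2 * cos (m%:R * th)) <= e / 4 ->
    ((k%:R : R)%:E <= resolvent_norm mu P ((s%:C%C * expi th) ^+ m)%R p q)%E.
  move=> hth; apply: he; exists u => //; split => //.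
  set zeta := (_ ^+ m).
  have zE : zeta = l%:C%C * expi (m%:R * th).
    by rewrite /zeta exprMn -rmorphXn/= sm [m%:R * th]mulrC expiM_nat.
  pose f1 : @cfun R M := (P u : @cfun R M) - l *: u.
  pose f2 : @cfun R M := fun x => (l%:C%C - zeta) * u x.
  have sf1 : smooth_fun S f1.
    exact: (siB (smooth_semi_inner mu cM) (smooth_dop P su) (smooth_cfunZ l su)).
  have sf2 : smooth_fun S f2 by exact: (smooth_funZ _ su).
  have -> : (fun x => P u x - zeta * u x) = f1 + f2 :> @cfun R M.
    apply/funext => x.
    have -> : (f1 + f2) x = (P u x - (l *: u) x : C) + f2 x by [].
    rewrite cfun_scaleC /f2; ring.
  have := gi_young si ltr01 (smooth_cbm cM sf1) (smooth_cbm cM sf2).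
  rewrite invr1 => h; apply: le_trans h _.
  rewrite [in X in _ + X]/f2 l2dot_scale//.
  have -> : sqn (l%:C%C - zeta) = l ^+ 2 * (2 - 2 * cos (m%:R * th)).
    have -> : l%:C%C - zeta = (- l)%:C%C * (expi (m%:R * th) - 1).
      by rewrite zE rmorphN/=; ring.
    by rewrite sqnM sqn_real sqn_expi_sub1 sqrrN.
  have := ler_wpM2r (ltW u0) hth.
  move: hu; rewrite -/f1; lra.
have c1 : continuous (fun t : R => l ^+ 2 * (2 - 2 * cos (m%:R * t))).
  move=> t; apply: cvgM; first exact: cvg_cst.
  apply: cvgB; first exact: cvg_cst.
  apply: cvgM; first exact: cvg_cst.
  apply: (cvg_comp (fun t : R => m%:R * t) cos); last exact: continuous_cos.
  by apply: cvgM; [exact: cvg_cst|exact: cvg_id].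
have c2 : continuous (fun t : R => s * sin t).
  by move=> t; apply: cvgM; [exact: cvg_cst|exact: continuous_sin].
have c3 : continuous (fun t : R => - cos t).
  by move=> t; apply: cvgN; exact: continuous_cos.
have h1 := near0_le c1 (e := e / 4).
have h2 := near0_le c2 (e := k.+1%:R^-1).
have h3 := near0_le c3 (e := - 2^-1).
have h4 := near0_le (F := id) (fun x => cvg_id) (e := pi / m%:R).
have h5 := near0_le (F := id) (fun x => cvg_id) (e := pi / 2).
rewrite mulr0 cos0 mulr1 subrr mulr0 in h1.
rewrite sin0 mulr0 in h2.
rewrite cos0 in h3.
have ki : 0 < k.+1%:R^-1 :> R by rewrite invr_gt0.
have half : -1 < - 2^-1 :> R by lra.
have pm : 0 < pi / m%:R :> R by rewrite divr_gt0 ?pi_gt0.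
have p2 : 0 < pi / 2 :> R by rewrite divr_gt0 ?pi_gt0.
have [t t0 [[[[t1 t2] t3] t4] t5]] := near0_ex_gt0
   (filterI (filterI (filterI (filterI (h1 e4) (h2 ki)) (h3 half)) (h4 pm)) (h5 p2)).
exists s, t; split => //.
- rewrite t0/=; apply: le_lt_trans t4 _.
  by rewrite -mulrA mulr_natl mulr2n ltrDl.
- split.
    have : k.+1%:R <= s * cos t.
      have h : s * 2^-1 <= s * cos t by rewrite ler_wpM2l ?(ltW s0)//; lra.
      by apply: le_trans h; rewrite ler_pdivlMr// mulrC ltW.
    by apply: le_trans; rewrite ler_nat.
  apply/andP; split => //; rewrite mulr_gt0// sin_gt0_pi// t0/=.
  by apply: le_lt_trans t5 _; rewrite ltr_pdivrMr// ltr_pMr ?pi_gt0// ltr1n.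
- exact: key.
- by apply: key; rewrite mulrN cosN.
Qed.
End Points.

(** * Blow-up of the resolvent norm *)

Theorem theorem1p2 (R : realType) (n m : nat) (M : ptopologicalType)
    (S : smooth_structure R n M) (mu : volume_density S) (P : diffop S m)
    (n_ge2 : (2 <= n)%N) (m_ge2 : (2 <= m)%N) (m_lt_n : (m < n)%N)
    (M_hausdorff : hausdorff_space M)
    (M_compact : compact [set: M])
    (M_connected : connected [set: M])
    (P_elliptic : elliptic P)
    (P_selfadjoint : formally_self_adjoint mu P)
    (P_symbol_pos : positive_principal_symbol P)
    (P_nonneg : nonnegative_operator mu P)
    (P_convex : strictly_convex_cospheres P)
    (P_subprincipal : subprincipal_symbol_vanishes P mu)
    (P_periodic : hamilton_flow_periodic P) :
  (exists z : nat -> R[i],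
     [/\ (forall k, Xi m (z k)),
         (fun k => complex.Re (z k)) @ \oo --> +oo,
         (forall k, 0 < complex.Im (z k)),
         (fun k => complex.Im (z k)) @ \oo --> (0 : R) &
         (fun k => resolvent_norm mu P (z k ^+ m)
                     (2 * n%:R / (n + m)%N%:R) (2 * n%:R / (n - m)%N%:R))
           @ \oo --> +oo%E]) /\
  (exists z : nat -> R[i],
     let w := fun k => z k * expi (- (2 * pi / m%:R)) in
     [/\ (forall k, Xi m (z k)),
         (fun k => complex.Re (w k)) @ \oo --> +oo,
         (forall k, 0 < - complex.Im (w k)),
         (fun k => - complex.Im (w k)) @ \oo --> (0 : R) &
         (fun k => resolvent_norm mu P (z k ^+ m)
                     (2 * n%:R / (n + m)%N%:R) (2 * n%:R / (n - m)%N%:R))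
           @ \oo --> +oo%E]).
Proof.
have m0 : (0 < m)%N by exact: ltn_trans m_ge2.
have n0 : (0 < n)%N by exact: ltn_trans n_ge2.
set p := 2 * n%:R / (n + m)%N%:R; set q := 2 * n%:R / (n - m)%N%:R.
have nR : 0 < n%:R :> R by rewrite ltr0n.
have hp : 0 < p <= 2.
  rewrite divr_gt0 ?mulr_gt0 ?ltr0n ?addn_gt0 ?n0//=.
  by rewrite ler_pdivrMr ?ltr0n ?addn_gt0 ?n0// ler_wpM2l// ler_nat leq_addr.
have hq : 2 <= q.
  by rewrite ler_pdivlMr ?ltr0n ?subn_gt0// ler_wpM2l// ler_nat leq_subr.
have [s /choice[t st]] := choice (fun k =>
  spectral_points n0 m0 M_hausdorff M_compact P_symbol_pos P_selfadjoint k hp hq).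
have mR : m%:R != 0 :> R by rewrite pnatr_eq0 -lt0n.
have large (f : nat -> R) : (forall k, k%:R <= f k) -> f @ \oo --> +oo.
  move=> hf; apply/cvgryPge => A; near=> k; apply: le_trans (hf k).
  by near: k; exact: nbhs_infty_ger.
have largeE (f : nat -> \bar R) : (forall k, ((k%:R : R)%:E <= f k)%E) -> f @ \oo --> +oo%E.
  move=> hf; apply/cvgeyPge => A; near=> k; apply: le_trans (hf k).
  by rewrite lee_fin; near: k; exact: nbhs_infty_ger.
have small (f : nat -> R) : (forall k, 0 < f k <= k.+1%:R^-1) -> f @ \oo --> 0.
  move=> hf; apply: (@squeeze_cvgr _ _ _ _ (fun=> 0) harmonic).
  - by near=> k; have /andP[/ltW -> ->] := hf k.
  - exact: cvg_cst.
  - exact: cvg_harmonic.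
have ReE (x y : R) : complex.Re (x%:C%C * expi y) = x * cos y.
  by rewrite cReM /= mul0r subr0.
have ImE (x y : R) : complex.Im (x%:C%C * expi y) = x * sin y.
  by rewrite cImM /= mul0r addr0.
split.
  exists (fun k => (s k)%:C%C * expi (t k)); split.
  - by move=> k; have [s0 ht _ _ _] := st k; exists (s k), (t k).
  - by apply: large => k; have [_ _ [h _] _ _] := st k; rewrite ReE.
  - by move=> k; have [_ _ [_ /andP[h _]] _ _] := st k; rewrite ImE.
  - by apply: small => k; have [_ _ [_ h] _ _] := st k; rewrite ImE.
  - by apply: largeE => k; have [_ _ _ h _] := st k.
exists (fun k => (s k)%:C%C * expi (2 * pi / m%:R - t k)) => w.
have wE k : w k = (s k)%:C%C * expi (- t k).
  by rewrite /w -mulrA -expiD; congr (_ * expi _); ring.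
split.
- move=> k; have [s0 /andP[t0 t1] _ _ _] := st k; exists (s k), (2 * pi / m%:R - t k).
  by split => //; rewrite subr_gt0 t1 ltrBlDr ltrDl.
- by apply: large => k; have [_ _ [h _] _ _] := st k; rewrite wE ReE cosN.
- by move=> k; have [_ _ [_ /andP[h _]] _ _] := st k; rewrite wE ImE sinN mulrN opprK.
- by apply: small => k; have [_ _ [_ h] _ _] := st k; rewrite wE ImE sinN mulrN opprK.
- apply: largeE => k; have [_ _ _ _] := st k.
  have -> // : ((s k)%:C%C * expi (- t k)) ^+ m = ((s k)%:C%C * expi (2 * pi / m%:R - t k)) ^+ m.
  rewrite !exprMn -!expiM_nat mulrBl divfK// expiD expi2pi mul1r.
  by rewrite mulNr.
Unshelve. all: by end_near.
Qed.
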